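(* Let $A\in\mathbb{R}^{n\times n}$ be a constant matrix, let $P:\mathbb{R}\to\mathbb{R}^{n\times n}$ be square-integrable over a period and $2\pi/\omega$-periodic, and let $f$ be an $\mathbb{R}^n$-valued function such that $\exp(-At)f(t)$ is integrable on $[0,\hat C\epsilon^{-1}]$ for some $\hat C>0$, where $0<\epsilon\ll 1$. Let $x(t)$ be the solution of $$\dot x = Ax+\epsilon P(t)x+f(t)$$ with initial value $x(0)$. If $\exp(-At)P(t)\exp(At)$ is uniformly bounded in $t\ge 0$, then there exists a constant matrix $B$, independent of $f(\cdot)$, such that $$x(t)=\exp(At)\left(\Omega(t)+\int_0^t\exp(-A\tau)f(\tau)\,d\tau+E(t,\epsilon)\right),$$ where $\Omega$ solves $$\dot\Omega=\epsilon B\Omega+\epsilon F(t),\qquad \Omega(0)=x(0),\qquad F(t):=\exp(-At)P(t)\exp(At)\int_0^t\exp(-A\tau)f(\tau)\,d\tau,$$ and there are positive constants $c$ and $C$, independent of $t$ and $\epsilon$, such that for all $0\le t\le c\,\epsilon^{-1}$ $$\|E(t,\epsilon)\|\le C\epsilon\exp(\epsilon^2Ct)\left(\max_{\tau\in[0,t]}\|\Omega(\tau)\|+\max_{\tau\in[0,t]}\left\|\int_0^\tau\exp(-As)f(s)\,ds\right\|\right).$$ Moreover, $B$ can be identified by either $$B=\mathcal{G}[\exp(-At)P(t)\exp(At)]$$ or $$B=\lim_{T\to\infty}\frac1T\int_0^T\exp(-A\tau)P(\tau)\exp(A\tau)\,d\tau,$$ where this limit exists if and only if $\exp(-At)P(t)\exp(At)$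 is uniformly bounded in $t\ge 0$.
   Context: $\|\cdot\|$ is the Euclidean norm. ''$0<\epsilon\ll1$'' means $\epsilon>0$ ranges over sufficiently small values; $A,P,f$ do not depend on $\epsilon$. Growth operator $\mathcal{G}$: the function $\exp(-At)P(t)\exp(At)$ can be uniquely expressed (in the $L^2$ sense) as $$\exp(-At)P(t)\exp(At)=\sum_{(a,b,k)\in\Sigma}\left(C_{abk}t^ke^{at}\cos(bt)+D_{abk}t^ke^{at}\sin(bt)\right)$$ with constant real matrices $C_{abk},D_{abk}$ and a countable set $\Sigma$, in which the components $a$, $b$, $k$ take values respectively in a finite subset of $\mathbb{R}$, a countable subset of $\mathbb{R}$, and $\{0,1,\ldots,2n-2\}$. Its growth component is $$\mathcal{G}[\exp(-At)P(t)\exp(At)]:=\left(\sum_{(a,b,k)\in\Sigma,\,a>0}+\sum_{(a,b,k)\in\Sigma,\,a=0,\,k\ne0}+\sum_{(a,b,k)\in\Sigma,\,a=0,\,k=0,\,b=0}\right)\left(C_{abk}t^ke^{at}\cos(bt)+D_{abk}t^ke^{at}\sin(bt)\right).$$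
   Formalization: ''Uniformly bounded in t≥0'' is read as a uniform bound on the L² norm over [t,t+2π/ω]; for essentially bounded P the ''if and only if'' is also given with essential boundedness. Literally it fails: A=0, n=1, P unbounded but square-integrable. *)

(* Defs.v *)
From HB Require Import structures.
From mathcomp Require Import all_boot all_order all_algebra finmap.
From mathcomp Require Import all_classical all_reals all_analysis.
From mathcomp Require Export summability.

Set Implicit Arguments.
Unset Strict Implicit.
Unset Printing Implicit Defensive.
Import Order.TTheory GRing.Theory Num.Theory.
Import numFieldNormedType.Exports.
Local Open Scope classical_set_scope.
Local Open Scope ring_scope.

(* Euclidean norm of a column vector, Frobenius norm of a matrix *)
Definition enorm (R : realType) (m p : nat) (M : 'M[R]_(m, p)) : R :=
  Num.sqrt (\sum_i \sum_j M i j ^+ 2).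

(* The series converges entrywise for every [A]; [A ^+ k] is the power in the
   ring of square matrices. *)
Definition mxexp (R : realType) (n : nat) (A : 'M[R]_n) : 'M[R]_n :=
  \matrix_(i, j) limn (series (fun k : nat => (A ^+ k) i j / (k`!)%:R)).

Definition mx_integrable (R : realType) (m p : nat) (a b : R)
    (M : R -> 'M[R]_(m, p)) : Prop :=
  forall i j, (@lebesgue_measure R).-integrable `[a, b]
    (EFin \o (fun t => M t i j)).

Definition mx_integral (R : realType) (m p : nat) (a b : R)
    (M : R -> 'M[R]_(m, p)) : 'M[R]_(m, p) :=
  \matrix_(i, j) \int[@lebesgue_measure R]_(t in `[a, b]) M t i j.

Definition mx_square_integrable (R : realType) (m p : nat) (a b : R)
    (M : R -> 'M[R]_(m, p)) : Prop :=
  (forall i j, measurable_fun `[a, b] (fun t => M t i j)) /\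
  (forall i j, (@lebesgue_measure R).-integrable `[a, b]
     (EFin \o (fun t => M t i j ^+ 2))).

(* Caratheodory solution of [x' = G (t, x)] on [[0, T]] : the right-hand side
   is only integrable in time, so the equation is meant almost everywhere for
   an absolutely continuous [x], that is, in integrated form. *)
Definition solves (R : realType) (n : nat) (T : R)
    (G : R -> 'cV[R]_n -> 'cV[R]_n) (x : R -> 'cV[R]_n) : Prop :=
  mx_integrable 0 T (fun s => G s (x s)) /\
  forall t, 0 <= t <= T -> x t = x 0 + mx_integral 0 t (fun s => G s (x s)).

(* A maximum when [v] is continuous on [[0, t]]. *)
Definition sup_norm (R : realType) (n : nat) (t : R) (v : R -> 'cV[R]_n) : R :=
  sup [set enorm (v tau) | tau in `[0, t]].

Definition conj_flow (R : realType) (n : nat) (A : 'M[R]_n) (P : R -> 'M[R]_n)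
    (t : R) : 'M[R]_n :=
  mxexp (- t *: A) *m P t *m mxexp (t *: A).

(* Uniform boundedness on [t >= 0] for functions that are only locally
   square-integrable: their L^2 norm over [[s, s + L]] is bounded uniformly in
   [s >= 0]. *)
Definition L2_unif_bounded (R : realType) (n : nat) (L : R)
    (Q : R -> 'M[R]_n) : Prop :=
  exists K : R, forall s, 0 <= s ->
    (\int[@lebesgue_measure R]_(t in `[s, (s + L)%R]) (enorm (Q t) ^+ 2)%:E
       <= K%:E)%E.

Definition ess_bounded (R : realType) (n : nat) (Q : R -> 'M[R]_n) : Prop :=
  exists K : R, {ae @lebesgue_measure R, forall t, 0 <= t -> enorm (Q t) <= K}.

Definition is_time_average (R : realType) (n : nat) (Q : R -> 'M[R]_n)
    (B : 'M[R]_n) : Prop :=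
  forall i j, (T^-1 *: mx_integral 0 T Q) i j @[T --> +oo] --> B i j.

(* An index is a triple (a, b, k): growth rate, frequency, power of [t]. *)
Definition exp_trig_term (R : realType) (n : nat)
    (C D : R * R * nat -> 'M[R]_n) (s : R * R * nat) (t : R) : 'M[R]_n :=
  let: (a, b, k) := s in
  (t ^+ k * expR (a * t) * cos (b * t)) *: C s +
  (t ^+ k * expR (a * t) * sin (b * t)) *: D s.

(* The family [(u s)_(s in S)] is (unconditionally) summable to [g] in
   L^2 ([-T, T]) for every [T]; [totally] is the filter of finite sets of
   indices ordered by inclusion. *)
Definition L2_sums_to (R : realType) (n : nat) (S : set (R * R * nat))
    (u : R * R * nat -> R -> 'M[R]_n) (g : R -> 'M[R]_n) : Prop :=
  (forall i j, measurable_fun [set: R] (fun t => g t i j)) /\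
  forall T : R, 0 < T ->
    (fun J : {fset R * R * nat} =>
       \int[@lebesgue_measure R]_(t in `[(- T)%R, T])
         (enorm (g t - \sum_(s <- J | s \in S) u s t) ^+ 2)%:E)%E
      @ totally --> 0%E.

Definition is_expansion (R : realType) (n : nat) (Q : R -> 'M[R]_n)
    (Sigma : set (R * R * nat)) (C D : R * R * nat -> 'M[R]_n) : Prop :=
  [/\ countable Sigma,
      finite_set [set s.1.1 | s in Sigma],
      forall s, Sigma s -> (s.2 <= 2 * n - 2)%N &
      L2_sums_to Sigma (exp_trig_term C D) Q].

Definition growing (R : realType) : set (R * R * nat) :=
  [set s | let: (a, b, k) := s in
     [\/ 0 < a, a = 0 /\ k <> 0%N | [/\ a = 0, k = 0%N & b = 0]]].

(* [H] is the growth component of [Q]. An expansion of [Q] determines [Q], and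
   its growth part [H], up to a null set only, so this is a relation. *)
Definition is_growth_component (R : realType) (n : nat)
    (Q H : R -> 'M[R]_n) : Prop :=
  exists (Sigma : set (R * R * nat)) (C D : R * R * nat -> 'M[R]_n),
    is_expansion Q Sigma C D /\
    L2_sums_to (Sigma `&` @growing R) (exp_trig_term C D) H.

(* Main.v *)
Require Import Defs.
From HB Require Import structures.
From mathcomp Require Import all_boot all_order all_algebra finmap.
From mathcomp Require Import all_classical all_reals all_analysis.
From mathcomp Require Import measurable_realfun complex zify ring lra.

Set Implicit Arguments.
Unset Strict Implicit.
Unset Printing Implicit Defensive.
Import Order.TTheory GRing.Theory Num.Theory.
Import numFieldNormedType.Exports.
Local Open Scope classical_set_scope.
Local Open Scope ring_scope.
Import ComplexField.Normc.

(* Write [Q t = exp (- tA) P t exp (tA)] and [tau = 2 pi / omega]. Splitting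
   along the generalized eigenspaces of [A], the flow [X |-> exp (- tA) X exp (tA)]
   is a finite sum of terms [t ^ k e ^ (at) (cos (bt) Zc X + sin (bt) Zs X)] with
   [Zc], [Zs] linear. Periodicity of [P] gives
     [int_(N tau) ^ (N tau + T) Q = exp (- N tau A) (int_0 ^ T Q) exp (N tau A)].
   If the averages of [Q] converge, or if [Q] is uniformly bounded in L^2, this
   is [o (N)]; hence the terms with [a > 0], or [a = 0] and [k > 0], vanish on
   [int_0 ^ T Q] for every [T], and therefore on [P t] for almost every [t].
   Only decaying terms and terms oscillating against a [tau]-periodic function
   remain: [Q] is dominated by a periodic function, its average [B] is the
   resonant part ([b] in [omega Z]), and [U t = int_0 ^ t (Q - B)] is bounded.
   Inserting the Fourier series of [P] gives the expansion of [Q]; its only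
   growing term is the constant [B].
   For the equation, [E = exp (- tA) x - Omega - g] satisfies
   [E' = eps Q E + eps (Q - B) Omega]. Integrating the last term by parts
   against [U] bounds its contribution by [O (eps)], and since
   [eps int_0 ^ (c / eps) |Q| <= 1 / 2] for small [c], the first term is absorbed
   without Gronwall's inequality. *)

(** * The matrix exponential *)

(** The obstacle is regularity: [P] is only square-integrable, so [Q] need not have pointwise bounds
    or a pointwise Fourier series. Information is first obtained for the matrices [int_0 ^ T Q], to
    which the algebra of the flow applies, and reaches almost every [Q t] by Lebesgue
    differentiation. It cannot stay there, since [Q] is not periodic: if the flow of [Q t] has no
    growing terms, the forward flow of [P t] is bounded, hence has none either, and [P] is periodic.
    The class [o (N)] is wide enough to follow from both hypotheses, convergent averages and bounded
    windows, and narrow enough to exclude a term growing like [t]. On blocks of matrices the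
    exponents are differences of eigenvalues of [A], with a nilpotent part of order at most
    [2 n - 1]; hence the powers of [t] up to [2 n - 2]. Summation over arbitrary finite index sets,
    as [totally] demands, leads to Fourier sums over sets of integers that need not be symmetric:
    these are complex, and their imaginary parts must be shown to vanish in the limit. *)

Lemma mxpow_entry_bound (R : realType) (n : nat) (A : 'M[R]_n) (k : nat) i j :
  `|(A ^+ k) i j| <= (\sum_a \sum_b `|A a b|) ^+ k.
Proof.
set K := \sum_a _.
have K0 : 0 <= K by rewrite sumr_ge0 // => a _; rewrite sumr_ge0.
elim: k i j => [|k IH] i j.
  by rewrite !expr0 mxE; case: eqP => _; rewrite /= ?normr1 ?normr0.
rewrite exprSr mxE (le_trans (ler_norm_sum _ _ _)) //.
apply: (@le_trans _ _ (\sum_l K ^+ k * `|A l j|)).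
  by apply: ler_sum => l _; rewrite normrM ler_wpM2r.
rewrite -mulr_sumr exprSr ler_wpM2l ?exprn_ge0 //.
apply: ler_sum => l _; rewrite (bigD1 j) //= lerDl sumr_ge0 //.
Qed.

(** Termwise differentiation of the exponential series only raises the shift [p], so one comparison,
    with [K ^+ p] times a scalar exponential series, serves the series and all its derived
    series. *)
Lemma mxpow_pseries_cvg (R : realType) (n : nat) (A : 'M[R]_n) (p : nat) i j x :
  cvgn (pseries (fun k => (A ^+ (k + p)) i j / (k`!)%:R) x).
Proof.
set K := \sum_a \sum_b `|A a b|.
have K0 : 0 <= K by rewrite sumr_ge0 // => a _; rewrite sumr_ge0.
apply: normed_cvg; rewrite /normed_series_of /=.
apply: (@series_le_cvg _ _ (fun k => K ^+ p * (exp_coeff (K * `|x|) k))).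
- by move=> k /=.
- move=> k; rewrite /exp_coeff /= mulr_ge0 ?exprn_ge0 // divr_ge0 ?exprn_ge0 //.
  by rewrite mulr_ge0.
- move=> k; rewrite /exp_coeff /= 2!normrM normfV normr_nat normrX exprMn.
  rewrite !mulrA -exprD mulrAC (addnC p) ler_wpM2r ?invr_ge0 //.
  by rewrite ler_wpM2r ?exprn_ge0 // mxpow_entry_bound.
- have := @is_cvg_series_exp_coeff R (K * `|x|).
  exact: (@is_cvg_seriesZ _ _ (K ^+ p)).
Qed.

Definition mxderive (R : realType) (m p : nat) (M : R -> 'M[R]_(m, p)) (t : R)
    (M' : 'M[R]_(m, p)) : Prop :=
  forall i j, is_derive t (1 : R) (fun s => M s i j) (M' i j).

Lemma mxpowZ (R : comPzRingType) (n : nat) (A : 'M[R]_n) (t : R) (k : nat) :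
  (t *: A) ^+ k = t ^+ k *: A ^+ k.
Proof.
elim: k => [|k IH]; first by rewrite !expr0 scale1r.
by rewrite !exprS IH -[LHS]/(_ *m _) -scalemxAl -scalemxAr scalerA.
Qed.

Lemma mxexp_pseries (R : realType) (n : nat) (A : 'M[R]_n) (t : R) i j :
  mxexp (t *: A) i j =
  limn (pseries (fun k => (A ^+ (k + 0)) i j / (k`!)%:R) t).
Proof.
rewrite mxE; congr (limn _); rewrite /pseries /series; apply: eq_fun => N /=.
apply: eq_bigr => k _; rewrite addn0 mxpowZ mxE.
by rewrite [RHS]mulrC mulrA.
Qed.

Lemma mxexp_derive (R : realType) (n : nat) (A : 'M[R]_n) (t : R) :
  mxderive (fun s => mxexp (s *: A)) t (A *m mxexp (t *: A)).
Proof.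
move=> i j; under eq_fun do rewrite mxexp_pseries.
set c := fun k : nat => _.
have dE p : pseries_diffs (fun k => (A ^+ (k + p)) i j / (k`!)%:R) =
    (fun k => (A ^+ (k + p.+1)) i j / (k`!)%:R).
  apply/funext => k; rewrite /pseries_diffs addSnnS factS natrM.
  by rewrite invfM mulrCA mulVKf // pnatr_eq0.
have -> : (A *m mxexp (t *: A)) i j = limn (pseries (pseries_diffs c) t).
  rewrite /c dE mxE; under eq_bigr do rewrite mxexp_pseries.
  apply/esym/cvg_lim => //.
  have -> : pseries (fun k => (A ^+ (k + 1)) i j / (k`!)%:R) t =
      (fun N => \sum_l A i l *
          pseries (fun k => (A ^+ (k + 0)) l j / (k`!)%:R) t N).
    apply/funext => N; rewrite /pseries /series /=.
    under [RHS]eq_bigr do rewrite mulr_sumr.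
    rewrite exchange_big /=; apply: eq_bigr => k _.
    rewrite addn1 exprS mxE !mulr_suml; apply: eq_bigr => l _.
    by rewrite addn0 !mulrA.
  apply: cvg_big; first exact: add_continuous.
  by move=> l _; apply: cvgZl_tmp; exact: mxpow_pseries_cvg.
(* Termwise differentiation at [t] asks for convergence of the series and of its first two derived
   series at a point of larger modulus. *)
apply: (@pseries_snd_diffs _ c (`|t| + 1)).
- exact: mxpow_pseries_cvg.
- by rewrite /c dE; exact: mxpow_pseries_cvg.
- by rewrite /c !dE; exact: mxpow_pseries_cvg.
- by rewrite [X in _ < X]ger0_norm ?addr_ge0 // ltrDl.
Qed.

Lemma der_eq (R : realType) (f g : R -> R) t a b :
  f =1 g -> a = b -> is_derive t (1 : R) f a -> is_derive t (1 : R) g b.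
Proof. by move=> /funext -> ->. Qed.

Lemma der_cst (R : realType) (c t : R) : is_derive t (1 : R) (fun=> c) 0.
Proof. exact: is_derive_cst. Qed.

Lemma derD (R : realType) (f g : R -> R) t f' g' :
  is_derive t (1 : R) f f' -> is_derive t (1 : R) g g' ->
  is_derive t (1 : R) (fun s => f s + g s) (f' + g').
Proof. by move=> hf hg; exact: is_deriveD. Qed.

Lemma derM (R : realType) (f g : R -> R) t f' g' :
  is_derive t (1 : R) f f' -> is_derive t (1 : R) g g' ->
  is_derive t (1 : R) (fun s => f s * g s) (f' * g t + f t * g').
Proof.
move=> hf hg; apply: der_eq (is_deriveM hf hg) => //.
by rewrite addrC [in RHS]mulrC.
Qed.

Lemma der_sum (R : realType) (I : Type) (r : seq I) (f : I -> R -> R) t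
    (f' : I -> R) :
  (forall i, is_derive t (1 : R) (f i) (f' i)) ->
  is_derive t (1 : R) (fun s => \sum_(i <- r) f i s) (\sum_(i <- r) f' i).
Proof.
move=> h; elim: r => [|i r IH].
  by apply: der_eq (der_cst 0 t) => [s|]; rewrite big_nil.
by apply: der_eq (derD (h i) IH) => [s|]; rewrite big_cons.
Qed.

Lemma der_comp (R : realType) (f g : R -> R) t f' g' :
  is_derive (g t) (1 : R) f f' -> is_derive t (1 : R) g g' ->
  is_derive t (1 : R) (fun s => f (g s)) (f' * g').
Proof.
by move=> hf hg; apply: der_eq (is_derive1_comp hf hg) => //.
Qed.

Lemma der_affine (R : realType) (a b t : R) :
  is_derive t (1 : R) (fun s => a * s + b) a.
Proof.
apply: der_eq (derD (derM (der_cst a t) (is_derive_id t 1)) (der_cst b t)) => //=.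
by rewrite mul0r add0r mulr1 addr0.
Qed.

Section MatrixDerivative.
Variable R : realType.

Lemma mxderiveM m p q (M : R -> 'M[R]_(m, p)) (N : R -> 'M[R]_(p, q)) t M' N' :
  mxderive M t M' -> mxderive N t N' ->
  mxderive (fun s => M s *m N s) t (M' *m N t + M t *m N').
Proof.
move=> hM hN i j.
apply: der_eq (@der_sum _ _ _ (fun k s => M s i k * N s k j) t
   (fun k => M' i k * N t k j + M t i k * N' k j) _).
- by move=> s; rewrite mxE.
- by rewrite !mxE -big_split.
- by move=> k; apply: derM.
Qed.

Lemma mxderive_affine m p (M : R -> 'M[R]_(m, p)) a b t M' :
  mxderive M (a * t + b) M' -> mxderive (fun s => M (a * s + b)) t (a *: M').
Proof.
move=> hM i j; rewrite mxE mulrC.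
exact: (@der_comp _ (fun s => M s i j) (fun s => a * s + b) t
   (M' i j) a (hM i j) (der_affine a b t)).
Qed.

Lemma mxderive0_cst m p (M : R -> 'M[R]_(m, p)) s t :
  (forall u, mxderive M u 0) -> M s = M t.
Proof.
move=> hM; apply/matrixP => i j.
apply: (@is_derive_0_is_cst _ (fun u => M u i j)) => u.
by have := hM u i j; rewrite mxE.
Qed.

Variables (n : nat) (A : 'M[R]_n).
Local Notation M t := (mxexp (t *: A)).

Lemma mxexp0 : M 0 = 1%:M.
Proof.
apply/matrixP => i j; rewrite mxexp_pseries; apply/cvg_lim => //.
rewrite -cvg_shiftS; apply: cvg_near_cst; near=> N.
rewrite /pseries /series /= big_nat_recl // big1 => [|k _]; last first.
  by rewrite expr0n mulr0.
by rewrite !expr0 mulr1 divr1 addr0 mxE.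
Unshelve. all: by end_near. Qed.

Lemma mxexp_comm t : A *m M t = M t *m A.
Proof.
apply/matrixP => i j; rewrite !mxE.
under eq_bigr do rewrite mxexp_pseries.
under [RHS]eq_bigr do rewrite mxexp_pseries.
pose u l N := A i l * pseries (fun k => (A ^+ (k + 0)) l j / (k`!)%:R) t N.
pose v l N := pseries (fun k => (A ^+ (k + 0)) i l / (k`!)%:R) t N * A l j.
have uv N : \sum_l u l N = \sum_l v l N.
  rewrite /u /v /pseries /series /=.
  under [LHS]eq_bigr do rewrite mulr_sumr.
  under [RHS]eq_bigr do rewrite mulr_suml.
  rewrite exchange_big [RHS]exchange_big /=; apply: eq_bigr => k _.
  have := exprS A k; rewrite exprSr => /matrixP/(_ i j).
  rewrite !mxE => E.
  transitivity ((\sum_l A i l * (A ^+ k) l j) / (k`!)%:R * t ^+ k).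
    by rewrite !mulr_suml; apply: eq_bigr => l _; rewrite addn0 !mulrA.
  rewrite -E !mulr_suml; apply: eq_bigr => l _; rewrite addn0.
  by ring.
have cu : (fun N => \sum_l u l N) @ \oo -->
    \sum_l A i l * limn (pseries (fun k => (A ^+ (k + 0)) l j / (k`!)%:R) t).
  apply: cvg_big; first exact: add_continuous.
  by move=> l _; apply: cvgZl_tmp; exact: mxpow_pseries_cvg.
have cv : (fun N => \sum_l v l N) @ \oo -->
    \sum_l limn (pseries (fun k => (A ^+ (k + 0)) i l / (k`!)%:R) t) * A l j.
  apply: cvg_big; first exact: add_continuous.
  by move=> l _; apply: cvgMl; exact: mxpow_pseries_cvg.
have uvE : (fun N => \sum_l u l N) = (fun N => \sum_l v l N) by exact/funext.
move: cu; rewrite uvE => cu.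
apply: (cvg_unique _ cu cv) => //; exact: norm_hausdorff.
Qed.

Lemma mxderive_eq m p (M1 M2 : R -> 'M[R]_(m, p)) t N1 N2 :
  M1 =1 M2 -> N1 = N2 -> mxderive M1 t N1 -> mxderive M2 t N2.
Proof. by move=> /funext -> ->. Qed.

Lemma mxexpN_derive t : mxderive (fun s => M (- s)) t (- (A *m M (- t))).
Proof.
apply: mxderive_eq (@mxderive_affine _ _ (fun u => M u) (-1) 0 t _ _).
- by move=> s /=; rewrite mulN1r addr0.
- by rewrite scaleN1r.
- by rewrite mulN1r addr0; exact: mxexp_derive.
Qed.

(** The inverse and the addition law both come from a product with zero derivative, compared with
    its value at [0]; this avoids Cauchy products of series. *)
Lemma mxexpNK t : M (- t) *m M t = 1%:M.
Proof.
transitivity (M (- 0) *m M 0); last by rewrite oppr0 mxexp0 mulmx1.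
apply: (@mxderive0_cst _ _ (fun s => M (- s) *m M s)) => s.
have := mxderiveM (mxexpN_derive s) (mxexp_derive A s).
by rewrite (mxexp_comm (- s)) mulNmx -mulmxA addNr.
Qed.

Lemma mxexpKN t : M t *m M (- t) = 1%:M.
Proof. by have := mxexpNK (- t); rewrite opprK. Qed.

Lemma mxexpD s t : M (s + t) = M s *m M t.
Proof.
have E : M (s + t) *m M (- t) = M s; last first.
  by rewrite -[LHS]mulmx1 -(mxexpNK t) mulmxA E.
have E0 : M (s + 0) *m M (- 0) = M s.
  by rewrite oppr0 addr0 mxexp0 mulmx1.
rewrite -[RHS]E0.
apply: (@mxderive0_cst _ _ (fun u => M (s + u) *m M (- u))) => u.
have d1 : mxderive (fun v => M (s + v)) u (A *m M (s + u)).
  apply: mxderive_eq (@mxderive_affine _ _ (fun v => M v) 1 s u _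
    (mxexp_derive A _)).
  - by move=> v; rewrite mul1r addrC.
  - by rewrite mul1r scale1r addrC.
have := mxderiveM d1 (mxexpN_derive u).
by rewrite mulmxN mxexp_comm -!mulmxA subrr.
Qed.

End MatrixDerivative.

(** Each linear factor divides the squarefree product, and there are [size s] of them. The exponent
    may exceed the multiplicities but is the same for all roots. *)
Lemma prod_XsubC_dvd_undup (F : fieldType) (s : seq F) :
  \prod_(a <- s) ('X - a%:P) %| (\prod_(a <- undup s) ('X - a%:P)) ^+ size s.
Proof.
set W := \prod_(a <- undup s) _.
have hW a : a \in s -> 'X - a%:P %| W.
  rewrite -mem_undup => ha; rewrite /W (big_rem a) //=; exact: dvdp_mulr.
elim: s W hW => [|a s IH] W hW; first by rewrite big_nil dvd1p.
rewrite big_cons exprS dvdp_mul ?hW ?mem_head //.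
by apply: IH => b hb; rewrite hW // in_cons hb orbT.
Qed.

(** Partial fractions with denominators cleared. At a matrix annihilated by the [m]-th power of the
    product, the [u a] sum to the identity and [(X - a) ^ m] kills the [a]-th one: they act as
    spectral projections. *)
Lemma partial_fraction_unity (F : fieldType) (s : seq F) (m : nat) :
  s != [::] -> uniq s ->
  exists u : F -> {poly F}, \sum_(a <- s) u a = 1 /\
    forall a, a \in s ->
      (\prod_(b <- s) ('X - b%:P)) ^+ m %| ('X - a%:P) ^+ m * u a.
Proof.
elim: s => // a [|b s] IH _.
  move=> _; exists (fun=> 1); rewrite big_seq1; split => // c.
  by rewrite inE => /eqP ->; rewrite big_seq1 mulr1.
move=> /= /andP[anb ubs]; have {}[//|//|u [su hu]] := IH.
set s' := b :: s in anb ubs su hu *.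
set Q := (\prod_(c <- s') ('X - c%:P)) ^+ m in hu.
have : coprimep (('X - a%:P) ^+ m) Q.
  rewrite /Q coprimep_expl // coprimep_expr //.
  rewrite coprimep_sym coprimep_XsubC root_prod_XsubC //.
move=> /Bezout_eq1_coprimepP[[x y] /= xy].
(* Bezout splits [1] into [y * Q], assigned to the new root, and [x * (X - a) ^ m], which the
   induction hypothesis distributes over the other roots. *)
exists (fun c => if c == a then y * Q else x * ('X - a%:P) ^+ m * u c); split.
  rewrite big_cons eqxx addrC -[RHS]xy; congr (_ + _).
  rewrite -[RHS]mulr1 -su mulr_sumr; apply: eq_big_seq => c hc.
  by case: eqP hc anb => // -> ->.
move=> c; rewrite inE big_cons exprMn -/Q.
case: eqP => [-> _|_ /= hc]; first by rewrite mulrA (mulrC _ y) -mulrA dvdp_mull.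
rewrite [X in _ %| X](_ : _ = x * (('X - a%:P) ^+ m * (('X - c%:P) ^+ m * u c))); last by ring.
by rewrite dvdp_mull // dvdp_mul // hu.
Qed.

(** * The normal form of the conjugation flow *)

(** The [E i] are polynomials in [A], so they commute with its flow, and Cayley-Hamilton yields the
    last clause. The exponent [n] in place of each multiplicity makes the nilpotency order uniform
    in [i]. *)
Lemma spectral_resolution (F : closedFieldType) (n : nat) (A : 'M[F]_n) :
  exists (r : nat) (l : 'I_r -> F) (E : 'I_r -> 'M[F]_n),
    [/\ \sum_i E i = 1%:M,
        forall i (X : 'M[F]_n), A *m X = X *m A -> E i *m X = X *m E i &
        forall i, (A - (l i)%:M) ^+ n *m E i = 0].
Proof.
case: n A => [|n] A.
  exists 0%N, (fun=> 0), (fun=> 0); split; last by case.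
    by apply/matrixP; case.
  by case.
have [rs hrs] := closed_field_poly_normal (char_poly A).
rewrite (monicP (char_poly_monic A)) scale1r in hrs.
have srs : size rs = n.+1.
  by have := size_char_poly A; rewrite hrs size_prod_XsubC => -[].
have s0 : undup rs != [::].
  by case: rs srs {hrs} => // a rs _; apply/eqP => /undup_nil.
have [u [su hu]] := partial_fraction_unity n.+1 s0 (undup_uniq rs).
exists (size (undup rs)), (fun i => (undup rs)`_i),
   (fun i => horner_mx A (u (undup rs)`_i)); split.
- rewrite -raddf_sum -(big_mkord xpredT (fun i => u (undup rs)`_i)) /=.
  by rewrite -(big_nth 0 xpredT u) su rmorph1.
- by move=> i X AX; apply/esym/comm_mx_horner.
- move=> i; set a := _`_i.
  have -> : A - a%:M = horner_mx A ('X - a%:P).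
    by rewrite rmorphB /= horner_mx_X horner_mx_C.
  rewrite -rmorphXn -[LHS]rmorphM /=.
  have /dvdpP[q ->] : char_poly A %| ('X - a%:P) ^+ n.+1 * u a.
    apply: dvdp_trans (hu a (mem_nth _ (ltn_ord i))).
    by rewrite hrs -srs prod_XsubC_dvd_undup.
  by rewrite rmorphM /= Cayley_Hamilton mulr0.
Qed.

Section ShiftedCommutator.
Variables (F : comNzRingType) (n : nat) (N1 N2 : 'M[F]_n).

(** For [N1 = A - l1] and [N2 = A - l2] this is [X A - A X - (l2 - l1) X]: the generator of the
    conjugation flow with its eigenvalue [l2 - l1] removed. *)
Definition shcomm (X : 'M[F]_n) : 'M[F]_n := X *m N2 - N1 *m X.

(** The iterate expands into monomials [N1 ^ i X N2 ^ j] with [i + j = p + q - 1], so [i >= p] or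
    [j >= q] in each of them. *)
Lemma shcomm_nilp p q X : N1 ^+ p *m X = 0 -> X *m N2 ^+ q = 0 ->
  iter (p + q).-1 shcomm X = 0.
Proof.
have [k] := ubnP (p + q); elim: k p q X => // k IH [|p] [|q] X hk h1 h2.
- by move: h1; rewrite expr0 mul1mx => ->.
- move: h1; rewrite expr0 mul1mx => ->; elim: (_.-1) => //= j ->.
  by rewrite /shcomm mul0mx mulmx0 subrr.
- move: h2; rewrite expr0 mulmx1 => ->; elim: (_.-1) => //= j ->.
  by rewrite /shcomm mul0mx mulmx0 subrr.
(* One application leaves [X N2], with orders [p.+1] and [q], and [N1 X], with orders [p] and
   [q.+1]; both sums of orders have dropped by one. *)
rewrite addSn addnS /= -iterS iterSr.
have itD m Y Z : iter m shcomm (Y - Z) = iter m shcomm Y - iter m shcomm Z.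
  elim: m => //= m ->; rewrite /shcomm mulmxBl mulmxBr.
  by rewrite !opprB addrACA [RHS]addrACA [- _ - _]addrC.
rewrite {2}/shcomm itD.
have hk' : (p + q.+1 < k)%N by rewrite -ltnS -addSn.
have -> : (p + q)%N = (p.+1 + q).-1 by [].
rewrite (IH p.+1 q) //; last 3 first.
- by rewrite addSnnS.
- by rewrite mulmxA h1 mul0mx.
- by rewrite -mulmxA -[N2 *m _]/(N2 * _) -exprS.
have -> : (p.+1 + q).-1 = (p + q.+1).-1 by rewrite addnS.
rewrite (IH p q.+1) ?subr0 //.
- by rewrite mulmxA -[_ *m N1]/(_ * _) -exprSr.
- by rewrite -mulmxA h2 mulmx0.
Qed.

End ShiftedCommutator.

Lemma der_pow (R : realType) (k : nat) (t : R) :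
  is_derive t (1 : R) (fun s => s ^+ k) (k%:R * t ^+ k.-1).
Proof.
elim: k => [|k IH].
  by apply: der_eq (der_cst 1 t) => [s|]; rewrite ?mul0r ?expr0.
apply: der_eq (derM (is_derive_id t (1 : R)) IH) => [s|]; first by rewrite exprS.
case: k {IH} => [|k] /=; first by rewrite !expr0; ring.
by rewrite exprS -(natr1 k.+1); ring.
Qed.

(** * Complex exponentials and the complexified conjugation flow *)

Section ComplexDerivative.
Variable R : realType.
Local Notation C := R[i].
Implicit Types t : R.

Definition cderive (f : R -> C) t (f' : C) : Prop :=
  is_derive t (1 : R) (fun s => complex.Re (f s)) (complex.Re f') /\
  is_derive t (1 : R) (fun s => complex.Im (f s)) (complex.Im f').

Lemma cReD (x y : C) : complex.Re (x + y) = complex.Re x + complex.Re y.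
Proof. by case: x y => [a b] [c d]. Qed.
Lemma cImD (x y : C) : complex.Im (x + y) = complex.Im x + complex.Im y.
Proof. by case: x y => [a b] [c d]. Qed.
Lemma cReM (x y : C) : complex.Re (x * y) =
  complex.Re x * complex.Re y - complex.Im x * complex.Im y.
Proof. by case: x y => [a b] [c d]. Qed.
Lemma cImM (x y : C) : complex.Im (x * y) =
  complex.Re x * complex.Im y + complex.Im x * complex.Re y.
Proof. by case: x y => [a b] [c d]. Qed.

Lemma cRe_sum (I : Type) (r : seq I) (P : pred I) (F : I -> C) :
  complex.Re (\sum_(i <- r | P i) F i) = \sum_(i <- r | P i) complex.Re (F i).
Proof. exact: (big_morph _ cReD). Qed.
Lemma cIm_sum (I : Type) (r : seq I) (P : pred I) (F : I -> C) :
  complex.Im (\sum_(i <- r | P i) F i) = \sum_(i <- r | P i) complex.Im (F i).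
Proof. exact: (big_morph _ cImD). Qed.

Lemma complex_eq (x y : C) :
  complex.Re x = complex.Re y -> complex.Im x = complex.Im y -> x = y.
Proof. by case: x y => [a b] [c d] /= -> ->. Qed.

Lemma cder_eq (f g : R -> C) t (f' g' : C) :
  f =1 g -> f' = g' -> cderive f t f' -> cderive g t g'.
Proof. by move=> /funext -> ->. Qed.

Lemma cder_cst (c : C) t : cderive (fun=> c) t 0.
Proof. by split; exact: der_cst. Qed.

Lemma cderD (f g : R -> C) t (f' g' : C) : cderive f t f' -> cderive g t g' ->
  cderive (fun s => f s + g s) t (f' + g').
Proof.
move=> [f1 f2] [g1 g2]; split.
  by apply: der_eq (derD f1 g1) => [s|]; rewrite cReD.
by apply: der_eq (derD f2 g2) => [s|]; rewrite cImD.
Qed.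

Lemma cderM (f g : R -> C) t (f' g' : C) : cderive f t f' -> cderive g t g' ->
  cderive (fun s => f s * g s) t (f' * g t + f t * g').
Proof.
move=> [f1 f2] [g1 g2]; split.
  apply: der_eq (derD (derM f1 g1) (derM (der_cst (-1) t) (derM f2 g2))) => [s|].
    by rewrite cReM mulN1r.
  by rewrite cReD !cReM; ring.
apply: der_eq (derD (derM f1 g2) (derM f2 g1)) => [s|].
  by rewrite cImM.
by rewrite cImD !cImM; ring.
Qed.

Lemma cder_sum (I : Type) (r : seq I) (f : I -> R -> C) t (f' : I -> C) :
  (forall i, cderive (f i) t (f' i)) ->
  cderive (fun s => \sum_(i <- r) f i s) t (\sum_(i <- r) f' i).
Proof.
move=> h; split.
  apply: der_eq (der_sum r (fun i => (h i).1)) => [s|]; by rewrite cRe_sum.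
apply: der_eq (der_sum r (fun i => (h i).2)) => [s|]; by rewrite cIm_sum.
Qed.

Lemma cder_real (f : R -> R) t f' : is_derive t (1 : R) f f' ->
  cderive (fun s => (f s)%:C%C) t f'%:C%C.
Proof. by move=> h; split => //=; exact: der_cst. Qed.

Definition cexp (mu : C) (t : R) : C :=
  ((expR (complex.Re mu * t) * cos (complex.Im mu * t)) +i*
   (expR (complex.Re mu * t) * sin (complex.Im mu * t)))%C.

Lemma cexp_derive mu t : cderive (cexp mu) t (mu * cexp mu t).
Proof.
case: mu => a b; rewrite /cexp /=.
have lin c : is_derive t (1 : R) (fun s => c * s) c.
  by apply: der_eq (der_affine c 0 t) => [s|] //; rewrite addr0.
have dE := der_comp (is_derive_expR (a * t)) (lin a).
have dC := der_comp (is_derive_cos (b * t)) (lin b).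
have dS := der_comp (is_derive_sin (b * t)) (lin b).
split.
  by apply: der_eq (derM dE dC) => //=; ring.
by apply: der_eq (derM dE dS) => //=; ring.
Qed.

Lemma cexp0 mu : cexp mu 0 = 1.
Proof. by rewrite /cexp !mulr0 expR0 cos0 sin0 mulr1 mulr0. Qed.

Lemma normc_cexp mu t : normc (cexp mu t) = expR (complex.Re mu * t).
Proof.
rewrite /cexp /normc !exprMn -mulrDr cos2Dsin2 mulr1 sqrtr_sqr ger0_norm //.
Qed.

Lemma normc_ge0 (x : C) : 0 <= normc x.
Proof. by case: x => a b; exact: sqrtr_ge0. Qed.

Lemma normcD (x y : C) : normc (x + y) <= normc x + normc y.
Proof. exact: le_normcD. Qed.

Lemma normc_real (x : R) : normc (x%:C%C) = `|x|.
Proof. by rewrite /= expr0n addr0 sqrtr_sqr. Qed.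

End ComplexDerivative.

Section ComplexMatrixDerivative.
Variable R : realType.
Local Notation C := R[i].

Definition cmxderive m p (M : R -> 'M[C]_(m, p)) t (M' : 'M[C]_(m, p)) : Prop :=
  forall i j, cderive (fun s => M s i j) t (M' i j).

Lemma cmxderiveM m p q (M : R -> 'M[C]_(m, p)) (N : R -> 'M[C]_(p, q)) t M' N' :
  cmxderive M t M' -> cmxderive N t N' ->
  cmxderive (fun s => M s *m N s) t (M' *m N t + M t *m N').
Proof.
move=> hM hN i j.
apply: cder_eq (@cder_sum _ _ _ (fun k s => M s i k * N s k j) t
   (fun k => M' i k * N t k j + M t i k * N' k j) _).
- by move=> s; rewrite mxE.
- by rewrite !mxE -big_split.
- by move=> k; apply: cderM.
Qed.

Lemma cmxderive0_cst m p (M : R -> 'M[C]_(m, p)) s t :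
  (forall u, cmxderive M u 0) -> M s = M t.
Proof.
move=> hM; apply/matrixP => i j; apply: complex_eq.
  apply: (@is_derive_0_is_cst _ (fun u => complex.Re (M u i j))) => u.
  by have := (hM u i j).1; rewrite mxE.
apply: (@is_derive_0_is_cst _ (fun u => complex.Im (M u i j))) => u.
by have := (hM u i j).2; rewrite mxE.
Qed.

Variables (n : nat) (A : 'M[R]_n).
Local Notation toC := (map_mx (real_complex R)).
Definition cflow (t : R) : 'M[C]_n := toC (mxexp (t *: A)).
Local Notation AC := (toC A).

Lemma cflow0 : cflow 0 = 1%:M.
Proof. by rewrite /cflow mxexp0 map_mx1. Qed.

Lemma cflowNK t : cflow (- t) *m cflow t = 1%:M.
Proof. by rewrite /cflow -map_mxM mxexpNK map_mx1. Qed.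

Lemma cflow_comm t : AC *m cflow t = cflow t *m AC.
Proof. by rewrite /cflow -!map_mxM mxexp_comm. Qed.

Lemma cflow_derive t : cmxderive cflow t (cflow t *m AC).
Proof.
move=> i j; rewrite -cflow_comm -map_mxM mxE.
apply: cder_eq (cder_real (mxexp_derive A t i j)) => // s.
by rewrite [RHS]mxE.
Qed.

Lemma cflowN_derive t :
  cmxderive (fun s => cflow (- s)) t (- (cflow (- t) *m AC)).
Proof.
move=> i j; rewrite -cflow_comm -map_mxM -map_mxN mxE.
apply: cder_eq (cder_real (mxexpN_derive A t i j)) => // s.
by rewrite [RHS]mxE.
Qed.

Definition cconj (Z : 'M[C]_n) (t : R) : 'M[C]_n := cflow (- t) *m Z *m cflow t.

(** Undoing the conjugation turns a solution of [Y' = Y A - A Y] into a function with zero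
    derivative. *)
Lemma cconj_unique (Y : R -> 'M[C]_n) t :
  (forall u, cmxderive Y u (Y u *m AC - AC *m Y u)) -> Y t = cconj (Y 0) t.
Proof.
move=> hY; have E : cflow t *m Y t *m cflow (- t) = Y 0.
  transitivity (cflow 0 *m Y 0 *m cflow (- 0)); last first.
    by rewrite oppr0 cflow0 mulmx1 mul1mx.
  apply: (@cmxderive0_cst _ _ (fun u => cflow u *m Y u *m cflow (- u))) => u.
  have := cmxderiveM (cmxderiveM (cflow_derive u) (hY u)) (cflowN_derive u).
  rewrite -(cflow_comm (- u)) mulmxBr mulmxN !mulmxA [X in X *m _]addrC.
  by rewrite subrK -!mulmxA subrr.
by rewrite /cconj -E !mulmxA cflowNK mul1mx -mulmxA cflowNK mulmx1.
Qed.

Variables (l1 l2 : C).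
Local Notation N1 := (AC - l1%:M).
Local Notation N2 := (AC - l2%:M).
Local Notation D := (shcomm N1 N2).

Lemma shcommE (X : 'M[C]_n) : D X = X *m AC - AC *m X - (l2 - l1) *: X.
Proof.
rewrite /shcomm mulmxBr mulmxBl mul_mx_scalar mul_scalar_mx scalerBl.
by rewrite !opprB addrACA [RHS]addrACA [- _ - _]addrC.
Qed.

(** The generator is [D + (l2 - l1)], and the exponential series of [D] terminates on [Z]. The
    resulting expression solves the linear equation of the flow, so uniqueness identifies it. *)
Lemma cconj_nilp m Z t : iter m D Z = 0 ->
  cconj Z t = cexp (l2 - l1) t *:
    \sum_(k < m) (t ^+ k / k`!%:R)%:C%C *: iter k D Z.
Proof.
move=> hm.
pose c k s : C := (s ^+ k / k`!%:R)%:C%C.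
have dc0 s : cderive (c 0%N) s 0.
  by apply: cder_eq (cder_cst 1 s) => // u; rewrite /c expr0 divr1.
have dc k s : cderive (c k.+1) s (c k s).
  apply: cder_real.
  apply: der_eq (derM (der_pow k.+1 s) (der_cst (k.+1`!%:R)^-1 s)) => //=.
  rewrite mulr0 addr0 factS natrM invfM.
  have k0 : k.+1%:R != 0 :> R by rewrite pnatr_eq0.
  by rewrite mulrCA mulrA mulrA mulVf // mul1r mulrC.
pose S s := \sum_(k < m) c k s *: iter k D Z.
pose Y s := cexp (l2 - l1) s *: S s.
(* Differentiation lowers the index of the coefficients [c k], just as [D] shifts the iterates; the
   unmatched top term of [D (S s)] is the one annihilated by [hm]. *)
have hS s : cmxderive S s (D (S s)).
  have DS : D (S s) = \sum_(k < m) c k s *: iter k.+1 D Z.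
    rewrite /shcomm /S mulmx_suml mulmx_sumr -sumrB; apply: eq_bigr => k _.
    by rewrite -scalemxAl -scalemxAr -scalerBr.
  case: m hm @S @Y DS => [|m] hm S Y DS.
    rewrite DS big_ord0 => i j; rewrite mxE.
    by apply: cder_eq (cder_cst 0 s) => // u; rewrite /S big_ord0 mxE.
  rewrite DS big_ord_recr /= -/(iter m.+1 D Z) hm scaler0 addr0 => i j.
  rewrite summxE.
  have := cder_sum (index_enum 'I_m)
     (fun k => cderM (dc k s) (cder_cst (iter k.+1 D Z i j) s)).
  move=> h; have := cderD (cderM (dc0 s) (cder_cst (Z i j) s)) h.
  apply: cder_eq => [u|].
    rewrite /S summxE big_ord_recl mxE; congr (_ + _).
    by apply: eq_bigr => k _; rewrite lift0 [RHS]mxE.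
  rewrite mul0r mulr0 !add0r; apply: eq_bigr => k _.
  by rewrite mulr0 addr0 [RHS]mxE.
have Y0 : Y 0 = Z.
  rewrite /Y cexp0 scale1r /S; case: m hm @S @Y hS => [|m] hm S Y hS.
    by rewrite big_ord0 -hm.
  rewrite big_ord_recl /= big1 ?addr0; last first.
    by move=> k _; rewrite /c expr0n mul0r scale0r.
  by rewrite /c expr0 divr1 scale1r.
rewrite -{1}Y0 -[RHS]/(Y t); apply/esym/cconj_unique => s i j.
have := cderM (cexp_derive (l2 - l1) s) (hS s i j).
apply: cder_eq => [u|]; first by rewrite mxE.
rewrite shcommE -/(Y s).
have -> : Y s *m AC - AC *m Y s = cexp (l2 - l1) s *: (S s *m AC - AC *m S s).
  by rewrite scalerBr scalemxAl -scalemxAr.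
rewrite -[in LHS](subrK ((l2 - l1) *: S s) (S s *m AC - AC *m S s)).
by rewrite !mxE; ring.
Qed.

End ComplexMatrixDerivative.

(** * Sequences that are [o (N)], and the growth they exclude *)

Definition slow (R : realType) (z : nat -> R[i]) : Prop :=
  forall e : R, 0 < e -> exists N0 : nat, forall N, (N0 <= N)%N ->
    normc (z N) <= e * N%:R.

Section Slow.
Variable R : realType.
Local Notation C := R[i].

Lemma slowD (u v : nat -> C) : slow u -> slow v -> slow (fun N => u N + v N).
Proof.
move=> hu hv e e0; have e2 : 0 < e / 2 by rewrite divr_gt0.
have [N1 h1] := hu _ e2; have [N2 h2] := hv _ e2.
exists (maxn N1 N2) => N; rewrite geq_max => /andP[n1 n2].
rewrite (le_trans (normcD _ _)) // (le_trans (lerD (h1 _ n1) (h2 _ n2))) //.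
by rewrite -mulrDl -splitr.
Qed.

Lemma slowM (c : C) (u : nat -> C) : slow u -> slow (fun N => c * u N).
Proof.
move=> hu e e0; have e2 : 0 < e / (normc c + 1).
  by rewrite divr_gt0 // ltr_wpDl ?normc_ge0.
have [N1 h1] := hu _ e2; exists N1 => N n1; rewrite normcM.
apply: (@le_trans _ _ ((normc c + 1) * (e / (normc c + 1) * N%:R))).
  by apply: ler_pM; rewrite ?normc_ge0 // ?h1 // lerDl.
by rewrite mulrA mulrCA mulfV ?mulr1 // gt_eqF // ltr_wpDl ?normc_ge0.
Qed.

Lemma slow_sum (I : Type) (r : seq I) (u : I -> nat -> C) :
  (forall i, slow (u i)) -> slow (fun N => \sum_(i <- r) u i N).
Proof.
move=> hu; elim: r => [|i r IH].
  move=> e e0; exists 0%N => N _; rewrite big_nil normc0 mulr_ge0 // ltW //.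
have -> : (fun N => \sum_(j <- i :: r) u j N) =
    (fun N => u i N + \sum_(j <- r) u j N).
  by apply/funext => N; rewrite big_cons.
exact: slowD.
Qed.

(** The inequality [1 + x <= expR x] suffices: the modulus is at least [(1 + N tau Re mu) |w|],
    which exceeds the slope [e = tau |w| Re mu] for every [N]. *)
Lemma slow_cexp_eq0 (mu w : C) (tau : R) : 0 < tau -> 0 < complex.Re mu ->
  slow (fun N => cexp mu (N%:R * tau) * w) -> w = 0.
Proof.
move=> t0 a0 hs; apply: eq0_normc; apply/eqP; rewrite eq_le normc_ge0 andbT.
rewrite leNgt; apply/negP => w0.
have e0 : 0 < complex.Re mu * tau * normc w by rewrite !mulr_gt0.
have [N0 /(_ N0 (leqnn _))] := hs _ e0; rewrite normcM normc_cexp.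
apply/negP; rewrite -ltNge.
have := expR_ge1Dx (complex.Re mu * (N0%:R * tau)).
set E := expR _ => hE.
apply: (@lt_le_trans _ _ ((1 + complex.Re mu * (N0%:R * tau)) * normc w)).
  by rewrite mulrDl mul1r; lra.
by rewrite ler_wpM2r ?normc_ge0.
Qed.

Lemma slow_affine_eq0 (mu w d : C) (tau : R) : 0 < tau -> complex.Re mu = 0 ->
  slow (fun N => cexp mu (N%:R * tau) * (w + (N%:R * tau)%:C%C * d)) -> d = 0.
Proof.
move=> t0 a0 hs; apply: eq0_normc; apply/eqP; rewrite eq_le normc_ge0 andbT.
rewrite leNgt; apply/negP => d0.
(* Half of the slope [tau * normc d] is granted to the slow sequence; the other half must outgrow
   [normc w], which determines [N1]. *)
have e0 : 0 < tau * normc d / 2 by rewrite divr_gt0 // mulr_gt0.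
have [N0 hN0] := hs _ e0.
pose N1 := Num.bound (normc w / (tau * normc d / 2)).
have hN1 : normc w < N1%:R * (tau * normc d / 2).
  by rewrite -ltr_pdivrMr // archi_boundP // divr_ge0 ?normc_ge0 // ltW.
have := hN0 (maxn N0 N1) (leq_maxl _ _).
rewrite normcM normc_cexp a0 mul0r expR0 mul1r.
set N := maxn N0 N1.
have hN : N1%:R <= N%:R :> R by rewrite ler_nat leq_maxr.
have : normc ((N%:R * tau)%:C%C * d) <=
    normc (w + (N%:R * tau)%:C%C * d) + normc w.
  rewrite -{1}[_ * d](addKr w) addrC.
  by rewrite (le_trans (normcD _ _)) // normcN.
have h3 : N1%:R * (tau * normc d / 2) <= N%:R * (tau * normc d / 2).
  by rewrite ler_wpM2r // ltW.
by rewrite normcM normc_real ger0_norm ?mulr_ge0 ?(ltW t0) //; lra.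
Qed.

End Slow.

Section SlowMatrix.
Variables (R : realType) (n : nat) (A : 'M[R]_n) (tau : R).
Hypothesis tau0 : 0 < tau.
Local Notation C := R[i].
Local Notation toC := (map_mx (real_complex R)).
Local Notation AC := (toC A).

(** The flow is sampled at multiples of [tau] because there the periodicity of [P] turns conjugates
    of [int_0 ^ T Q] into increments of the primitive of [Q]. *)
Definition mslow (Z : 'M[C]_n) : Prop :=
  forall i j, slow (fun N => cconj A Z (N%:R * tau) i j).

Lemma mslow_mull (E Z : 'M[C]_n) : (forall t, E *m cflow A t = cflow A t *m E) ->
  mslow Z -> mslow (E *m Z).
Proof.
move=> hE hZ i j.
have -> : (fun N => cconj A (E *m Z) (N%:R * tau) i j) =
    (fun N => \sum_k E i k * cconj A Z (N%:R * tau) k j).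
  apply/funext => N; rewrite /cconj mulmxA -hE -!mulmxA.
  by rewrite mxE; apply: eq_bigr => k _; rewrite mulmxA.
by apply: slow_sum => k; apply: slowM.
Qed.

Lemma mslow_mulr (E Z : 'M[C]_n) : (forall t, E *m cflow A t = cflow A t *m E) ->
  mslow Z -> mslow (Z *m E).
Proof.
move=> hE hZ i j.
have -> : (fun N => cconj A (Z *m E) (N%:R * tau) i j) =
    (fun N => \sum_k E k j * cconj A Z (N%:R * tau) i k).
  apply/funext => N; rewrite /cconj -!mulmxA hE !mulmxA.
  by rewrite mxE; apply: eq_bigr => k _; rewrite mulrC.
by apply: slow_sum => k; apply: slowM.
Qed.

Lemma mslowB (Y Z : 'M[C]_n) : mslow Y -> mslow Z -> mslow (Y - Z).
Proof.
move=> hY hZ i j.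
have -> : (fun N => cconj A (Y - Z) (N%:R * tau) i j) =
    (fun N => cconj A Y (N%:R * tau) i j + (-1) * cconj A Z (N%:R * tau) i j).
  apply/funext => N; rewrite /cconj mulmxBr mulmxBl mulN1r.
  by rewrite [LHS]mxE [X in _ + X = _]mxE.
by apply: slowD => //; apply: slowM.
Qed.

Variables (l1 l2 : C).
Local Notation N1 := (AC - l1%:M).
Local Notation N2 := (AC - l2%:M).
Local Notation D := (shcomm N1 N2).

Lemma shcomm0 : D 0 = 0.
Proof. by rewrite /shcomm mul0mx mulmx0 subrr. Qed.

Lemma flow_shift_comm (l : C) t :
  (AC - l%:M) *m cflow A t = cflow A t *m (AC - l%:M).
Proof. by rewrite mulmxBl mulmxBr cflow_comm scalar_mxC. Qed.

Lemma mslow_shcomm Z : mslow Z -> mslow (D Z).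
Proof.
by move=> hZ; apply: mslowB; [apply: mslow_mulr|apply: mslow_mull] => // t;
  exact: flow_shift_comm.
Qed.

(** Induction on the nilpotency order: [D Z] is again slow and has smaller order, so it vanishes.
    The flow of [Z] is then a pure growing exponential. *)
Lemma mslow_growing_eq0 m Z : 0 < complex.Re (l2 - l1) ->
  iter m D Z = 0 -> mslow Z -> Z = 0.
Proof.
move=> a0; elim: m Z => // m IH Z; rewrite iterSr => hm hZ.
have DZ := IH _ hm (mslow_shcomm hZ).
have h1 : iter 1 D Z = 0 by [].
apply/matrixP => i j; rewrite [RHS]mxE; apply: (slow_cexp_eq0 tau0 a0).
have := hZ i j; congr slow; apply/funext => N; rewrite (cconj_nilp _ h1).
by rewrite big_ord1 /= expr0 divr1 scale1r [LHS]mxE.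
Qed.

(** By induction [D (D Z) = 0], so up to a unimodular factor the flow of [Z] is affine in [t] with
    slope [D Z]. Only the slope is excluded; [Z] itself may oscillate. *)
Lemma mslow_oscillating m Z : complex.Re (l2 - l1) = 0 ->
  iter m D Z = 0 -> mslow Z -> D Z = 0.
Proof.
move=> a0; elim: m Z => [|m IH] Z; first by move=> /= -> _; exact: shcomm0.
rewrite iterSr => hm hZ.
have DDZ := IH _ hm (mslow_shcomm hZ).
have h2 : iter 2 D Z = 0 by [].
apply/matrixP => i j; rewrite [RHS]mxE.
apply: (@slow_affine_eq0 _ (l2 - l1) (Z i j) _ _ tau0 a0).
have := hZ i j; congr slow; apply/funext => N; rewrite (cconj_nilp _ h2).
rewrite big_ord_recr big_ord1 /= expr0 divr1 scale1r expr1 divr1 [LHS]mxE.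
by congr (_ * _); rewrite [LHS]mxE; congr (_ + _); rewrite [LHS]mxE.
Qed.

End SlowMatrix.

Definition mxlin (R : realType) (n : nat) (f : 'M[R]_n -> 'M[R]_n) : Prop :=
  forall c X Y, f (c *: X + Y) = c *: f X + f Y.

Definition power_slow (R : realType) (n : nat) (A : 'M[R]_n) (tau : R)
    (X : 'M[R]_n) : Prop :=
  forall i j (e : R), 0 < e -> exists N0 : nat, forall N, (N0 <= N)%N ->
    `|(mxexp (- (N%:R * tau) *: A) *m X *m mxexp ((N%:R * tau) *: A)) i j|
      <= e * N%:R.

Definition is_normal_form (R : realType) (n : nat) (A : 'M[R]_n) (I : finType)
    (a b : I -> R) (k : I -> nat) (Zc Zs : I -> 'M[R]_n -> 'M[R]_n) : Prop :=
  [/\ forall s, (k s <= 2 * n - 2)%N,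
      forall s, mxlin (Zc s) /\ mxlin (Zs s) &
      forall X t, mxexp (- t *: A) *m X *m mxexp (t *: A) =
        \sum_s ((t ^+ k s * expR (a s * t) * cos (b s * t)) *: Zc s X +
                (t ^+ k s * expR (a s * t) * sin (b s * t)) *: Zs s X)].

Section NormalForm.
Variables (R : realType) (n : nat).
Local Notation C := R[i].
Local Notation toC := (map_mx (real_complex R)).

Lemma shcomm_lin (N1 N2 : 'M[C]_n) k c X Y :
  iter k (shcomm N1 N2) (c *: X + Y) =
  c *: iter k (shcomm N1 N2) X + iter k (shcomm N1 N2) Y.
Proof.
elim: k => //= k ->; rewrite /shcomm mulmxDl mulmxDr -scalemxAl -scalemxAr.
by rewrite opprD addrACA scalerBr.
Qed.

Lemma iter_shcomm0 (N1 N2 : 'M[C]_n) k : iter k (shcomm N1 N2) 0 = 0.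
Proof. by elim: k => //= k ->; rewrite /shcomm mul0mx mulmx0 subrr. Qed.

Lemma cRe_mxlin (c : R) (U V : 'M[C]_n) i j :
  complex.Re ((c%:C%C *: U + V) i j) =
  c * complex.Re (U i j) + complex.Re (V i j).
Proof. by rewrite !mxE cReD cReM /= mul0r subr0. Qed.

Lemma cIm_mxlin (c : R) (U V : 'M[C]_n) i j :
  complex.Im ((c%:C%C *: U + V) i j) =
  c * complex.Im (U i j) + complex.Im (V i j).
Proof. by rewrite !mxE cImD cImM /= mul0r addr0. Qed.

(** Over the complex numbers [X] is the sum of the blocks [E i X E j]. Each evolves with exponent
    [l j - l i] and a nilpotent part of order [2 n - 1], and is slow when [X] is, because the [E i]
    commute with the flow. *)
Lemma conj_flow_normal_form (A : 'M[R]_n) (tau : R) : 0 < tau ->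
  exists (I : finType) (a b : I -> R) (k : I -> nat)
      (Zc Zs : I -> 'M[R]_n -> 'M[R]_n),
    is_normal_form A a b k Zc Zs /\
    forall X, power_slow A tau X -> forall s, 0 < a s \/ (a s = 0 /\ k s <> 0%N) ->
      Zc s X = 0 /\ Zs s X = 0.
Proof.
move=> tau0.
have [r [l [E [sE cE nE]]]] := spectral_resolution (toC A).
pose X_ i j (X : 'M[R]_n) : 'M[C]_n := E i *m toC X *m E j.
pose D i j := shcomm (toC A - (l i)%:M) (toC A - (l j)%:M).
have cflowE i t : E i *m cflow A t = cflow A t *m E i.
  by apply: cE; exact: cflow_comm.
have nil i j X : iter (n + n).-1 (D i j) (X_ i j X) = 0.
  apply: shcomm_nilp; first by rewrite !mulmxA nE !mul0mx.
  rewrite -mulmxA.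
  have -> : E j *m (toC A - (l j)%:M) ^+ n = (toC A - (l j)%:M) ^+ n *m E j.
    apply: cE; have : GRing.comm (toC A) ((toC A - (l j)%:M) ^+ n).
      apply: commrX; rewrite /GRing.comm mulrBr mulrBl; congr (_ - _).
      exact: scalar_mxC.
    by [].
  by rewrite nE mulmx0.
pose I : finType := ('I_r * 'I_r * 'I_(n + n).-1)%type.
pose mu (s : I) := l s.1.2 - l s.1.1.
pose W (s : I) X : 'M[C]_n := iter s.2 (D s.1.1 s.1.2) (X_ s.1.1 s.1.2 X).
have Wlin s c X Y : W s (c *: X + Y) = c%:C%C *: W s X + W s Y.
  rewrite /W -shcomm_lin /X_; congr (iter _ _ _).
  rewrite map_mxD mulmxDr mulmxDl; congr (_ + _).
  by rewrite map_mxZ -scalemxAr -scalemxAl.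
pose f (s : I) : R := (s.2 `!%:R)^-1.
(* Real part of [exp (mu t) t ^ k / k! W]: the cosine carries [Re W / k!] and the sine carries
   [- Im W / k!]. *)
exists I, (fun s => complex.Re (mu s)), (fun s => complex.Im (mu s)),
  (fun s : I => nat_of_ord s.2),
  (fun s X => \matrix_(i, j) (f s * complex.Re (W s X i j))),
  (fun s X => \matrix_(i, j) (- f s * complex.Im (W s X i j))).
pose G X t (s : I) : 'M[R]_n :=
  (t ^+ s.2 * expR (complex.Re (mu s) * t) * cos (complex.Im (mu s) * t)) *:
    (\matrix_(i, j) (f s * complex.Re (W s X i j))) +
  (t ^+ s.2 * expR (complex.Re (mu s) * t) * sin (complex.Im (mu s) * t)) *:
    (\matrix_(i, j) (- f s * complex.Im (W s X i j))).
split; [split|].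
- move=> [[i j] m] /=; rewrite mul2n -addnn -ltnS.
  by apply: leq_trans (ltn_ord m) _; lia.
- move=> s; split=> c X Y; apply/matrixP => i j.
    rewrite [LHS]mxE Wlin cRe_mxlin mulrDr mulrCA.
    rewrite [RHS]mxE; congr (_ + _); last by rewrite [RHS]mxE.
    by rewrite [RHS]mxE; congr (_ * _); rewrite [RHS]mxE.
  rewrite [LHS]mxE Wlin cIm_mxlin mulrDr mulrCA.
  rewrite [RHS]mxE; congr (_ + _); last by rewrite [RHS]mxE.
  by rewrite [RHS]mxE; congr (_ * _); rewrite [RHS]mxE.
- move=> X t.
  have XE : toC X = \sum_(p : 'I_r * 'I_r) X_ p.1 p.2 X.
    rewrite -(pair_bigA _ (fun i j => X_ i j X)) /=.
    under eq_bigr do rewrite -mulmx_sumr sE mulmx1.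
    by rewrite -mulmx_suml sE mul1mx.
  have cE' : toC (mxexp (- t *: A) *m X *m mxexp (t *: A)) =
      \sum_(p : 'I_r * 'I_r) cconj A (X_ p.1 p.2 X) t.
    rewrite !map_mxM XE mulmx_sumr mulmx_suml; apply: eq_bigr => p _ //.
  apply/matrixP => i j.
  have -> : (mxexp (- t *: A) *m X *m mxexp (t *: A)) i j =
     complex.Re (toC (mxexp (- t *: A) *m X *m mxexp (t *: A)) i j).
    by rewrite [X in complex.Re X]mxE.
  rewrite cE' summxE cRe_sum summxE.
  rewrite -(pair_bigA _ (fun p m => G X t (p, m) i j)) /=.
  apply: eq_bigr => p _; rewrite (cconj_nilp t (nil p.1 p.2 X)).
  rewrite [X in complex.Re X]mxE summxE mulr_sumr cRe_sum.
  apply: eq_bigr => m _; rewrite [X in cexp _ _ * X]mxE.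
  rewrite -/(D p.1 p.2) -/(W (p, m) X) !cReM cImM /G !mxE /f /=; ring.
- move=> X sX s hs.
  have slX : mslow A tau (toC X).
    move=> i j e e0; have [N0 h] := sX i j e e0; exists N0 => N hN.
    by rewrite /cconj /cflow -!map_mxM mxE normc_real; exact: h.
  have slij i j : mslow A tau (X_ i j X).
    exact: (mslow_mulr (cflowE j) (mslow_mull (cflowE i) slX)).
  suff W0 : W s X = 0.
    by split; apply/matrixP => i j; rewrite [LHS]mxE [RHS]mxE W0 mxE mulr0.
  (* A positive rate removes the whole block. A zero rate removes its image under [D], that is,
     every coefficient with [k > 0]. *)
  case: hs => [a0|[a0 k0]].
    have X0 : X_ s.1.1 s.1.2 X = 0.
      exact: (mslow_growing_eq0 tau0 a0 (nil _ _ X) (slij _ _)).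
    by rewrite /W X0 iter_shcomm0.
  have X0 : D s.1.1 s.1.2 (X_ s.1.1 s.1.2 X) = 0.
    exact: (mslow_oscillating tau0 a0 (nil _ _ X) (slij _ _)).
  have s2 : nat_of_ord s.2 = (nat_of_ord s.2).-1.+1.
    by rewrite prednK // lt0n; exact/eqP.
  by rewrite /W s2 iterSr X0 iter_shcomm0.
Qed.

End NormalForm.

(** * Integrals on compact intervals *)

Notation L1 a b f :=
  ((@lebesgue_measure _).-integrable `[a, b] (EFin \o f)).

Section IntervalIntegral.
Variable R : realType.
Notation mu := (@lebesgue_measure R).
Implicit Types (a b c K : R) (f g u v : R -> R).

Lemma bounded_on (D : set R) f K :
  (forall x, D x -> `|f x| <= K) -> [bounded f x | x in D].
Proof.
move=> h; exists K; split; first exact: num_real.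
by move=> M KM x Dx /=; apply: le_trans (h x Dx) (ltW KM).
Qed.

Lemma itv_sub a b a' b' : a <= a' -> b' <= b -> `[a', b'] `<=` `[a, b].
Proof.
by move=> ha hb x /=; rewrite !in_itv /= => /andP[h1 h2];
  rewrite (le_trans ha h1) (le_trans h2 hb).
Qed.

Lemma L1_sub a b a' b' f : a <= a' -> b' <= b -> L1 a b f -> L1 a' b' f.
Proof. by move=> ha hb; apply: integrableS => //; exact: itv_sub. Qed.

Lemma L1_measurable a b f : L1 a b f -> measurable_fun `[a, b] f.
Proof. by move=> /integrableP[/measurable_EFinP]. Qed.

Lemma integrable_ext a b (f g : R -> \bar R) : f =1 g ->
  mu.-integrable `[a, b] f -> mu.-integrable `[a, b] g.
Proof. by move=> /funext ->. Qed.

Lemma L1D a b f g : L1 a b f -> L1 a b g -> L1 a b (fun x => f x + g x).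
Proof.
move=> hf hg; by apply: integrable_ext (integrableD _ hf hg) => //.
Qed.

Lemma L1Z a b c f : L1 a b f -> L1 a b (fun x => c * f x).
Proof.
move=> hf; by apply: integrable_ext (integrableZl _ c hf) => //.
Qed.

Lemma L1B a b f g : L1 a b f -> L1 a b g -> L1 a b (fun x => f x - g x).
Proof.
move=> hf hg; have := L1D hf (L1Z (-1) hg).
by congr (_.-integrable _ _); apply/funext => x /=; rewrite mulN1r.
Qed.

Lemma L1_sum a b (I : Type) (r : seq I) (P : pred I) (F : I -> R -> R) :
  (forall i, P i -> L1 a b (F i)) -> L1 a b (fun x => \sum_(i <- r | P i) F i x).
Proof.
move=> hF; elim: r => [|i r IH].
  have : L1 a b (fun=> 0 : R) by apply: integrable0.
  by congr (_.-integrable _ _); apply/funext => x /=; rewrite big_nil.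
case Pi : (P i); last first.
  by move: IH; congr (_.-integrable _ _); apply/funext => x /=; rewrite big_cons Pi.
have := L1D (hF i Pi) IH.
by congr (_.-integrable _ _); apply/funext => x /=; rewrite big_cons Pi.
Qed.

Lemma L1_abs a b f : L1 a b f -> L1 a b (fun x => `|f x|).
Proof. exact: integrable_norm. Qed.

Lemma L1_ext a b f g : (forall x, a <= x <= b -> f x = g x) ->
  L1 a b f -> L1 a b g.
Proof.
move=> fg; apply: eq_integrable => // x; rewrite inE /= in_itv /= => hx.
by rewrite /= fg.
Qed.

Lemma L1_le a b f g : measurable_fun `[a, b] f ->
  (forall x, a <= x <= b -> `|f x| <= g x) -> L1 a b g -> L1 a b f.
Proof.
move=> mf fg; apply: le_integrable => //; first exact/measurable_EFinP.
move=> x; rewrite /= in_itv /= => hx; rewrite lee_fin.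
by rewrite (le_trans (fg x hx)) // ler_norm.
Qed.

Lemma L1_bounded a b f K : measurable_fun `[a, b] f ->
  (forall x, a <= x <= b -> `|f x| <= K) -> L1 a b f.
Proof.
move=> mf hK; apply: measurable_bounded_integrable => //=.
  by rewrite lebesgue_measure_itv /=; case: ifP => // _; rewrite ltry.
by apply: (@bounded_on _ _ K) => x; rewrite /= in_itv; exact: hK.
Qed.

Lemma L1M a b f g K : L1 a b f -> measurable_fun `[a, b] g ->
  (forall x, a <= x <= b -> `|g x| <= K) -> L1 a b (fun x => f x * g x).
Proof.
move=> hf mg hK; apply: integrable_ext (integrableMl _ hf mg _) => //.
by apply: (@bounded_on _ _ K) => x; rewrite /= in_itv; exact: hK.
Qed.

Lemma within_continuous_bounded a b f : {within `[a, b], continuous f} ->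
  exists K, 0 <= K /\ forall x, a <= x <= b -> `|f x| <= K.
Proof.
move=> cf; case: (leP a b) => [ab|ba]; last first.
  exists 0; split => // x /andP[h1 h2].
  by move: (le_trans h1 h2); rewrite leNgt ba.
have [c _ hc] := EVT_max ab cf; have [d _ hd] := EVT_min ab cf.
exists (`|f c| + `|f d|); split => [|x hx]; first exact: addr_ge0.
have hx' : x \in `[a, b] by rewrite in_itv.
have := hc x hx'; have := hd x hx'.
by case: (ger0P (f x)); case: (ger0P (f c)); case: (ger0P (f d)); lra.
Qed.

Lemma within_continuous_measurable a b f : {within `[a, b], continuous f} ->
  measurable_fun `[a, b] f.
Proof.
by move=> cf; apply: measurable_realfun.subspace_continuous_measurable_fun.
Qed.

Lemma L1_cont a b f : {within `[a, b], continuous f} -> L1 a b f.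
Proof.
move=> cf; have [K [_ hK]] := within_continuous_bounded cf.
exact: L1_bounded (within_continuous_measurable cf) hK.
Qed.

Lemma L1_cst a b c : L1 a b (fun=> c).
Proof. by apply: (@L1_bounded _ _ _ `|c|) => //; exact: measurable_cst. Qed.

Lemma int_ext a b f g : (forall x, a <= x <= b -> f x = g x) ->
  \int[mu]_(x in `[a, b]) f x = \int[mu]_(x in `[a, b]) g x.
Proof. by move=> h; apply: eq_Rintegral => x; rewrite inE /= in_itv; exact: h. Qed.

Lemma intD a b f g : L1 a b f -> L1 a b g ->
  \int[mu]_(x in `[a, b]) (f x + g x) =
  \int[mu]_(x in `[a, b]) f x + \int[mu]_(x in `[a, b]) g x.
Proof. by move=> hf hg; exact: RintegralD. Qed.

Lemma intB a b f g : L1 a b f -> L1 a b g ->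
  \int[mu]_(x in `[a, b]) (f x - g x) =
  \int[mu]_(x in `[a, b]) f x - \int[mu]_(x in `[a, b]) g x.
Proof. by move=> hf hg; exact: RintegralB. Qed.

Lemma intZ a b c f : L1 a b f ->
  \int[mu]_(x in `[a, b]) (c * f x) = c * \int[mu]_(x in `[a, b]) f x.
Proof. by move=> hf; exact: RintegralZl. Qed.

Lemma int_cst a b c : a <= b -> \int[mu]_(x in `[a, b]) c = c * (b - a).
Proof.
move=> ab; rewrite Rintegral_cst //= lebesgue_measure_itv /= lte_fin.
by case: ltgtP ab => //= -> _; rewrite subrr.
Qed.

Lemma int_sum a b (I : Type) (r : seq I) (P : pred I) (F : I -> R -> R) :
  (forall i, P i -> L1 a b (F i)) ->
  \int[mu]_(x in `[a, b]) (\sum_(i <- r | P i) F i x) =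
  \sum_(i <- r | P i) \int[mu]_(x in `[a, b]) F i x.
Proof.
move=> hF; elim: r => [|i r IH].
  rewrite big_nil -[RHS](Rintegral_set0 mu (fun=> 0)).
  under eq_Rintegral do rewrite big_nil.
  by rewrite /Rintegral !integral_cst //= !mul0e.
rewrite big_cons; case: ifP => Pi; last first.
  by rewrite -IH; apply: int_ext => x _; rewrite big_cons Pi.
rewrite -IH -intD; [|exact: hF|exact: L1_sum].
by apply: int_ext => x _; rewrite big_cons Pi.
Qed.

Lemma int_le a b f g : L1 a b f -> L1 a b g ->
  (forall x, a <= x <= b -> f x <= g x) ->
  \int[mu]_(x in `[a, b]) f x <= \int[mu]_(x in `[a, b]) g x.
Proof.
by move=> hf hg fg; apply: le_Rintegral.
Qed.

Lemma int_ge0 a b f : (forall x, a <= x <= b -> 0 <= f x) ->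
  0 <= \int[mu]_(x in `[a, b]) f x.
Proof. by move=> h; exact: Rintegral_ge0. Qed.

Lemma int_abs a b f g : L1 a b f -> L1 a b g ->
  (forall x, a <= x <= b -> `|f x| <= g x) ->
  `|\int[mu]_(x in `[a, b]) f x| <= \int[mu]_(x in `[a, b]) g x.
Proof.
move=> hf hg fg; apply: le_trans (le_normr_Rintegral _ hf) _ => //.
by apply: int_le => //; exact: L1_abs.
Qed.

Lemma int_split a b c f : a <= b -> b <= c -> L1 a c f ->
  \int[mu]_(x in `[a, c]) f x =
  \int[mu]_(x in `[a, b]) f x + \int[mu]_(x in `[b, c]) f x.
Proof.
move=> ab bc hf.
have := @Rintegral_itvB _ f (BLeft a) (BRight c) b hf ab bc.
rewrite Rintegral_itv_obnd_cbnd; last first.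
  apply: integrableS hf => // x /=; rewrite !in_itv /= => /andP[h1 ->].
  by rewrite (le_trans ab (ltW h1)).
by move=> <-; rewrite addrC subrK.
Qed.

Lemma int0 a f : \int[mu]_(x in `[a, a]) f x = 0.
Proof. by rewrite set_itv1 Rintegral_set1. Qed.

Lemma prim_continuous a b f : a <= b -> L1 a b f ->
  {within `[a, b], continuous (fun x => \int[mu]_(t in `[a, x]) f t)}.
Proof. by move=> ab hf; exact: parameterized_integral_continuous. Qed.

(* Bisecting at the midpoint of the values of [Phi] halves the bound. *)
Lemma quadratic_oscillation_constant a b (D Phi : R -> R) K :
  {within `[a, b], continuous Phi} -> a <= b ->
  (forall x y, a <= x -> x <= y -> y <= b ->
     Phi x <= Phi y /\ `|D y - D x| <= K * (Phi y - Phi x) ^+ 2) ->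
  D b = D a.
Proof.
move=> cPhi ab hD.
have h k : forall x y, a <= x -> x <= y -> y <= b ->
    `|D y - D x| <= K * (Phi y - Phi x) ^+ 2 / 2 ^+ k.
  elim: k => [|k IH] x y ax xy yb.
    by rewrite expr0 divr1; exact: (hD x y ax xy yb).2.
  have [Pxy _] := hD x y ax xy yb.
  have cxy : {within `[x, y], continuous Phi}.
    by apply: continuous_subspaceW cPhi; exact: itv_sub.
  have [] := @IVT _ Phi x y ((Phi x + Phi y) / 2) xy cxy.
    by rewrite min_l // max_r //; apply/andP; split; lra.
  move=> z; rewrite in_itv /= => /andP[xz zy] Pz.
  have h1 := IH x z ax xz (le_trans zy yb).
  have h2 := IH z y (le_trans ax xz) zy yb.
  have -> : D y - D x = (D z - D x) + (D y - D z) by ring.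
  apply: le_trans (ler_normD _ _) _; apply: le_trans (lerD h1 h2) _.
  rewrite Pz [2 ^+ k.+1]exprS le_eqVlt; apply/orP; left; apply/eqP; field.
  by rewrite expf_neq0.
apply/eqP; rewrite -subr_eq0 -normr_eq0 eq_le normr_ge0 andbT.
apply/ler_addgt0Pl => e e0; rewrite addr0.
have K0 : 0 <= K * (Phi b - Phi a) ^+ 2.
  by have [_] := hD a b (lexx _) ab (lexx _); apply: le_trans.
pose N := Num.bound (K * (Phi b - Phi a) ^+ 2 / e).
apply: le_trans (h N a b (lexx _) ab (lexx _)) _.
rewrite ler_pdivrMr ?exprn_gt0 // -ler_pdivrMl // mulrC.
apply: le_trans (ltW (archi_boundP _)) _; first by rewrite divr_ge0 // ltW.
by rewrite -/N -natrX ler_nat ltnW // ltn_expl.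
Qed.

(** Integration by parts for absolutely continuous functions, without pointwise derivatives. The
    defect of the formula over an interval is at most the square of the increment of [Phi], the
    primitive of [|u| + |v|], so it is constant. *)
Lemma prim_mul a b (u v U V : R -> R) : L1 a b u -> L1 a b v ->
  (forall t, a <= t <= b -> U t = U a + \int[mu]_(s in `[a, t]) u s) ->
  (forall t, a <= t <= b -> V t = V a + \int[mu]_(s in `[a, t]) v s) ->
  L1 a b (fun s => u s * V s + U s * v s) /\
  forall t, a <= t <= b -> U t * V t = U a * V a +
    \int[mu]_(s in `[a, t]) (u s * V s + U s * v s).
Proof.
move=> hu hv hU hV.
have prim w W : L1 a b w ->
    (forall t, a <= t <= b -> W t = W a + \int[mu]_(s in `[a, t]) w s) ->
    {within `[a, b], continuous W}.
  move=> hw hW; case: (leP a b) => [ab|ba]; last first.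
    by rewrite set_itv_ge ?bnd_simp -?ltNge // => x; exact: continuous_subspace0.
  apply: (@subspace_eq_continuous _ _ _
    (fun x => W a + \int[mu]_(s in `[a, x]) w s)).
    by move=> x; rewrite inE /= in_itv /= => hx; rewrite [RHS]hW.
  by move=> x; apply: cvgD; [exact: cvg_cst|exact: (prim_continuous ab hw)].
have cU := prim _ _ hu hU; have cV := prim _ _ hv hV.
have [KU [KU0 bU]] := within_continuous_bounded cU.
have [KV [KV0 bV]] := within_continuous_bounded cV.
have iuV := L1M hu (within_continuous_measurable cV) bV.
have iUv : L1 a b (fun s => U s * v s).
  apply: L1_ext (L1M hv (within_continuous_measurable cU) bU) => x _.
  exact: mulrC.
have iw := L1D iuV iUv; split => // t /andP[at_ tb].
have iuv := L1D (L1_abs hu) (L1_abs hv).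
pose Phi x := \int[mu]_(s in `[a, x]) (`|u s| + `|v s|).
pose D x := U x * V x - \int[mu]_(s in `[a, x]) (u s * V s + U s * v s).
have Da : D a = U a * V a by rewrite /D int0 subr0.
suff E : D t = D a by rewrite -Da -E subrK.
apply: (@quadratic_oscillation_constant a t D Phi 1) => //.
  apply: prim_continuous => //; exact: L1_sub iuv.
move=> x y ax xy yt; have yb := le_trans yt tb.
have xyS w : L1 a b w -> L1 x y w by apply: L1_sub.
have aS w : L1 a b w -> L1 a y w by apply: L1_sub.
have Py : Phi y - Phi x = \int[mu]_(s in `[x, y]) (`|u s| + `|v s|).
  by rewrite /Phi (int_split ax xy (aS _ iuv)) addrC addKr.
have P0 : 0 <= Phi y - Phi x.
  by rewrite Py; apply: int_ge0 => s _; rewrite addr_ge0.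
split; first by rewrite -subr_ge0.
have incr w W : L1 a b w ->
    (forall t, a <= t <= b -> W t = W a + \int[mu]_(s in `[a, t]) w s) ->
    forall z z', a <= z -> z <= z' -> z' <= b ->
    W z' - W z = \int[mu]_(s in `[z, z']) w s.
  move=> hw hW z z' az zz z'b.
  have wz' : L1 a z' w by apply: L1_sub hw.
  rewrite (hW z') ?(le_trans az zz) // (hW z) ?az ?(le_trans zz z'b) //.
  by rewrite (int_split az zz wz'); lra.
have osc w W : L1 a b w -> (forall s, `|w s| <= `|u s| + `|v s|) ->
    (forall t, a <= t <= b -> W t = W a + \int[mu]_(s in `[a, t]) w s) ->
    forall z z', x <= z -> z <= z' -> z' <= y -> `|W z' - W z| <= Phi y - Phi x.
  move=> hw bw hW z z' xz zz zy.
  have az := le_trans ax xz; have z'b := le_trans zy yb.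
  have zS h : L1 a b h -> L1 z z' h by apply: L1_sub.
  have E : W z' - W z = \int[mu]_(s in `[z, z']) w s.
    exact: incr hw hW _ _ az zz z'b.
  rewrite E.
  apply: le_trans (int_abs (zS _ hw) (zS _ iuv) (fun s _ => bw s)) _.
  have S1 : L1 x y (fun s => `|u s| + `|v s|) by exact: xyS.
  rewrite Py (int_split xz (le_trans zz zy) S1).
  rewrite (int_split zz zy) ?(L1_sub _ _ S1) //.
  have p1 : 0 <= \int[mu]_(s in `[x, z]) (`|u s| + `|v s|).
    by apply: int_ge0 => s _; rewrite addr_ge0.
  have p2 : 0 <= \int[mu]_(s in `[z', y]) (`|u s| + `|v s|).
    by apply: int_ge0 => s _; rewrite addr_ge0.
  by lra.
have oU := osc u U hu (fun s => ler_wpDr (normr_ge0 _) (lexx _)) hU.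
have oV := osc v V hv (fun s => ler_wpDl (normr_ge0 _) (lexx _)) hV.
have au := xyS _ hu; have av := xyS _ hv; have aw := xyS _ iw.
have i1 := L1D (L1Z (V y) au) (L1Z (U x) av).
(* The increment of [U V] is written as [V y (U y - U x) + U x (V y - V x)], which leaves only
   differences of [U] and [V] under the integral. *)
have -> : D y - D x = \int[mu]_(s in `[x, y])
    (V y * u s + U x * v s - (u s * V s + U s * v s)).
  rewrite intB // intD; [|exact: L1Z|exact: L1Z].
  rewrite !intZ // -(incr u U hu hU x y) // -(incr v V hv hV x y) //.
  by rewrite /D (int_split ax xy (aS _ iw)); ring.
rewrite mul1r expr2 {2}Py -intZ ?xyS //.
apply: int_abs; [exact: L1B|by apply: L1Z; exact: xyS|].
move=> s /andP[xs sy].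
have -> : V y * u s + U x * v s - (u s * V s + U s * v s) =
  (V y - V s) * u s - (U s - U x) * v s by ring.
apply: le_trans (ler_normB _ _) _; rewrite !normrM mulrDr lerD //.
  by rewrite ler_wpM2r // oV.
by rewrite ler_wpM2r // oU.
Qed.

End IntervalIntegral.

(** * Translation of integrals, periodic functions, functions with zero primitive *)

Section Translation.
Variable R : realType.
Notation mu := (@lebesgue_measure R).
Implicit Types (a b c tau : R) (f : R -> R).

Lemma measurable_shift c : measurable_fun [set: R] (fun x : R => x + c).
Proof. by apply: measurable_funD => //; exact: measurable_cst. Qed.

Lemma shift_preimage_itv c (x y : bool) a b :
  (fun t : R => t + c) @^-1` [set` Interval (BSide x (a + c)) (BSide y (b + c))] =
  [set` Interval (BSide x a) (BSide y b)].
Proof.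
apply/seteqP; split => t /=; rewrite !in_itv /=;
  by case: x; case: y; rewrite /= ?lerD2r ?ltrD2r.
Qed.

(** The pushforward agrees with Lebesgue measure on half-open intervals, and these determine it. *)
Lemma lebesgue_measure_shift c (A : set R) : measurable A ->
  pushforward mu (fun x : measurableTypeR R => (x + c : measurableTypeR R)) A
    = mu A.
Proof.
move=> mA; apply/esym; apply: lebesgue_measure_unique => //; first exact: measurable_shift.
move=> ms _ [[a b]] _ <-.
rewrite /pushforward.
have E := shift_preimage_itv c false false (a - c) (b - c).
rewrite !subrK in E; rewrite [X in _ = mu X]E.
rewrite !lebesgue_measure_itv /= !lte_fin ltrD2r; case: ifP => // _.
by rewrite !EFinN -!EFinD; congr EFin; ring.
Qed.

Lemma ge0_integral_shift a b c (f : R -> \bar R) :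
  measurable_fun [set: R] f -> (forall x, 0%E <= f x)%E ->
  (\int[mu]_(x in `[(a + c)%R, (b + c)%R]) f x =
   \int[mu]_(x in `[a, b]) f (x + c)%R)%E.
Proof.
move=> mf f0; rewrite -(shift_preimage_itv c true false).
pose phi := (fun x : measurableTypeR R => (x + c : measurableTypeR R)).
have mphi : measurable_fun [set: measurableTypeR R] phi.
  exact: measurable_shift.
have mf' : measurable_fun `[a + c, b + c] f by exact: measurable_funS mf.
transitivity (\int[pushforward mu phi]_(x in `[(a + c)%R, (b + c)%R]) f x)%E.
  by apply: eq_measure_integral => A mA _; exact/esym/lebesgue_measure_shift.
by rewrite (ge0_integral_pushforward mphi).
Qed.

Lemma L1_shift a b c f : measurable_fun [set: R] f ->
  L1 a b (fun x => f (x + c)) -> L1 (a + c) (b + c) f.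
Proof.
move=> mf /integrableP[_ h]; apply/integrableP; split.
  by apply/measurable_EFinP; exact: measurable_funS mf.
rewrite (@ge0_integral_shift a b c (fun x => `|(f x)%:E|%E)) //.
by apply: measurableT_comp => //; exact/measurable_EFinP.
Qed.

Lemma int_shift a b c f : measurable_fun [set: R] f ->
  \int[mu]_(x in `[a + c, b + c]) f x = \int[mu]_(x in `[a, b]) f (x + c).
Proof.
move=> mf; rewrite /Rintegral; congr fine.
have mE : measurable_fun [set: R] (EFin \o f) by exact/measurable_EFinP.
rewrite integralE [RHS]integralE; congr (_ - _)%E.
  rewrite (ge0_integral_shift _ _ _ (measurable_funepos mE)); last first.
    by move=> x; exact: funepos_ge0.
  by apply: eq_integral => x _; rewrite !funeposE.
rewrite (ge0_integral_shift _ _ _ (measurable_funeneg mE)); last first.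
  by move=> x; exact: funeneg_ge0.
by apply: eq_integral => x _; rewrite !funenegE.
Qed.

Section Periodic.
Variables (tau : R) (f : R -> R).
Hypothesis tau0 : 0 < tau.
Hypothesis fper : forall t, f (t + tau) = f t.

Lemma periodicD k t : f (t + k%:R * tau) = f t.
Proof.
elim: k t => [|k IH] t; first by rewrite mul0r addr0.
by rewrite -natr1 mulrDl mul1r addrA fper.
Qed.

Lemma periodicB k t : f (t - k%:R * tau) = f t.
Proof. by rewrite -(periodicD k) subrK. Qed.

Lemma periodic_measurable : measurable_fun `[0, tau] f -> measurable_fun [set: R] f.
Proof.
move=> mf.
have blk (c : R) : (forall t, f (t - c) = f t) ->
    measurable_fun `[c, c + tau] f.
  move=> hc; rewrite (_ : f = f \o (fun t => t + - c)); last first.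
    by apply/funext => t /=; rewrite hc.
  apply: (@measurable_comp _ _ _ _ _ _ `[0, tau]) => //.
    move=> y [t /=]; rewrite in_itv /= => /andP[h1 h2] <-.
    by rewrite in_itv /= subr_ge0 h1 lerBlDl.
  exact: measurable_funS (measurable_shift (- c)).
have -> : [set: R] = \bigcup_k (`[k%:R * tau, k%:R * tau + tau] `|`
    `[- (k%:R * tau), - (k%:R * tau) + tau]).
  apply/esym; rewrite -subTset => t _.
  pose m := Num.floor (t / tau).
  have hm : m%:~R * tau <= t <= m%:~R * tau + tau.
    have := floor_itv (t / tau); rewrite -/m => /andP[h1 h2].
    rewrite -ler_pdivlMr // h1 /= -{2}[tau]mul1r -mulrDl -ler_pdivrMr //.
    by rewrite ltW // -intrD1 //.
  case: m hm => k hm.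
    by exists k => //; left; rewrite /= in_itv.
  by exists k.+1 => //; right; rewrite /= in_itv /= NegzE mulrNz mulNr in hm *.
apply/measurable_fun_bigcup => [k|k]; first by apply: measurableU.
apply/measurable_funU => //; split; apply: blk => t; first exact: periodicB.
by rewrite opprK periodicD.
Qed.

Hypothesis fL1 : L1 0 tau f.
Let mfT := periodic_measurable (L1_measurable fL1).

Lemma L1_cat a b c (g : R -> R) : a <= b -> b <= c ->
  L1 a b g -> L1 b c g -> L1 a c g.
Proof.
move=> ab bc h1 h2.
have h2' : mu.-integrable `]b, c] (EFin \o g).
  apply: integrableS h2 => // t /=; rewrite !in_itv /= => /andP[h ->].
  by rewrite ltW.
have -> : `[a, c]%classic = `[a, b] `|` `]b, c].
  apply/seteqP; split => t /=; rewrite !in_itv /=.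
    by move=> /andP[h3 h4]; case: (leP t b) => h5; [left|right];
      rewrite ?h3 ?h4.
  case=> /andP[h3 h4]; rewrite ?h3 ?h4 ?andbT //=; first exact: le_trans h4 bc.
  exact: le_trans ab (ltW h3).
move/integrableP: h1 => [m1 i1]; move/integrableP: h2' => [m2 i2].
have mU : measurable_fun (`[a, b] `|` `]b, c]) (EFin \o g).
  by apply/measurable_funU.
apply/integrableP; split => //.
rewrite ge0_integral_setU //; last 2 first.
- exact: measurableT_comp.
- apply/disj_setPS => t /=; rewrite !in_itv /= => -[/andP[_ h] /andP[h' _]].
  by move: (lt_le_trans h' h); rewrite ltxx.
exact: lte_add_pinfty.
Qed.

Lemma periodic_L1 a b : L1 a b f.
Proof.
have h N : L1 0 (N%:R * tau) f.
  elim: N => [|N IH].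
    by rewrite mul0r; apply: L1_sub fL1 => //; exact: ltW.
  apply: L1_cat IH _.
  - by rewrite mulr_ge0 // ltW.
  - by rewrite ler_wpM2r ?ler_nat // ltW.
  - rewrite -natr1 mulrDl mul1r addrC -{1}[_ * tau]add0r.
    apply: L1_shift => //; move: fL1; congr (_.-integrable _ _).
    by apply/funext => t /=; rewrite periodicD.
pose N := Num.bound ((`|a| + `|b|) / tau).
have hN : `|a| + `|b| <= N%:R * tau.
  by rewrite -ler_pdivrMr // ltW // archi_boundP // divr_ge0 ?addr_ge0 // ltW.
have h2 : L1 (- (N%:R * tau)) (N%:R * tau) f.
  have -> : - (N%:R * tau) = 0 + - (N%:R * tau) by rewrite add0r.
  have -> : L1 (0 + - (N%:R * tau)) (N%:R * tau) f =
    L1 (0 + - (N%:R * tau)) ((N + N)%:R * tau + - (N%:R * tau)) f.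
    by rewrite natrD mulrDl addrK.
  apply: L1_shift => //; have := h (N + N)%N; congr (_.-integrable _ _).
  by apply/funext => t /=; rewrite periodicB.
apply: L1_sub h2.
  by have := ler_norm (- a); rewrite normrN; have := normr_ge0 b; lra.
by have := ler_norm b; have := normr_ge0 a; lra.
Qed.

Lemma periodic_int_shift k a b :
  \int[mu]_(x in `[a + k%:R * tau, b + k%:R * tau]) f x =
  \int[mu]_(x in `[a, b]) f x.
Proof. by rewrite int_shift //; apply: int_ext => x _; rewrite periodicD. Qed.

Lemma periodic_int_blocks N :
  \int[mu]_(x in `[0, N%:R * tau]) f x = N%:R * \int[mu]_(x in `[0, tau]) f x.
Proof.
elim: N => [|N IH]; first by rewrite !mul0r int0.
have h : 0 <= N%:R * tau by rewrite mulr_ge0 // ltW.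
rewrite (int_split (b := N%:R * tau)) //; last 2 first.
- by rewrite ler_wpM2r ?ler_nat // ltW.
- exact: periodic_L1.
rewrite IH -natr1 !mulrDl !mul1r; congr (_ + _).
by rewrite -(periodic_int_shift N 0 tau) add0r addrC.
Qed.

(** [[- N tau, N tau]] consists of [N + N] periods; its symmetric form suits both windows [[0, t]]
    and [[- T, T]]. *)
Lemma periodic_int_le N a b : (forall x, 0 <= f x) ->
  - (N%:R * tau) <= a -> b <= N%:R * tau ->
  \int[mu]_(x in `[a, b]) f x <= (N + N)%:R * \int[mu]_(x in `[0, tau]) f x.
Proof.
move=> f0 ha hb; rewrite -periodic_int_blocks.
have h0 : 0 <= N%:R * tau by rewrite mulr_ge0 // ltW.
have -> : \int[mu]_(x in `[0, (N + N)%:R * tau]) f x =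
    \int[mu]_(x in `[- (N%:R * tau), N%:R * tau]) f x.
  rewrite -(periodic_int_shift N (- (N%:R * tau))) addNr.
  by rewrite natrD mulrDl.
case: (leP a b) => ab; last first.
  by rewrite set_itv_ge ?bnd_simp -?ltNge // Rintegral_set0 int_ge0.
rewrite (int_split ha (le_trans ab hb)) ?(int_split ab hb);
  try exact: periodic_L1.
have h1 : 0 <= \int[mu]_(x in `[- (N%:R * tau), a]) f x by rewrite int_ge0.
have h2 : 0 <= \int[mu]_(x in `[b, N%:R * tau]) f x by rewrite int_ge0.
by lra.
Qed.

End Periodic.

(** Lebesgue differentiation for [f] extended by zero: its primitive from minus infinity is
    identically zero. *)
Lemma ae0_of_prim0 a b f : L1 a b f ->
  (forall t, a <= t <= b -> \int[mu]_(s in `[a, t]) f s = 0) ->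
  {ae mu, forall t, a <= t <= b -> f t = 0}.
Proof.
move=> hf h0.
pose g := f \_ `[a, b].
have ig : mu.-integrable [set: R] (EFin \o g).
  by rewrite /g -restrict_EFin; apply/integrable_restrict => //=; rewrite setTI.
have gI y : mu.-integrable `]-oo, y] (EFin \o g) by exact: integrableS ig.
have gl : locally_integrable [set: R] g.
  by apply: integrable_locally.
have := FTC1Ny gI gl; apply: filterS.
  exact: (ae_filter_ringOfSetsType mu).
move=> t [_]; have -> : (fun x => \int[mu]_(t in [set` `]-oo, x]]) g t) = (fun=> 0).
  apply/funext => x; rewrite /g -Rintegral_mkcondr.
  have -> : [set` `]-oo, x]] `&` `[a, b] = `[a, Num.min x b]%classic.
    apply/seteqP; split => y /=; rewrite !in_itv /= le_min.
      by move=> [-> /andP[-> ->]].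
    by move=> /andP[-> /andP[-> ->]].
  case: (leP a (Num.min x b)) => h; last by rewrite set_itv_ge ?bnd_simp -?ltNge // Rintegral_set0.
  by apply: h0; rewrite h ge_min lexx orbT.
rewrite derive1_cst => g0 tab; rewrite g0 /g patchE mem_set //=.
Qed.

End Translation.

(** * Trigonometric series in L^2 *)

Section SquareIntegrable.
Variable R : realType.
Notation mu := (@lebesgue_measure R).
Implicit Types (a b c e : R) (f g h : R -> R).

Definition M2 a b f := measurable_fun `[a, b] f /\ L1 a b (fun x => f x ^+ 2).

Lemma M2_mul a b f g : M2 a b f -> M2 a b g -> L1 a b (fun x => f x * g x).
Proof.
move=> [mf if2] [mg ig2]; apply: L1_le (L1D if2 ig2); first exact: measurable_funM.
move=> x _; rewrite normrM -[f x ^+ 2]real_normK ?num_real //.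
rewrite -[g x ^+ 2]real_normK ?num_real //.
by have := sqr_ge0 (`|f x| - `|g x|); nra.
Qed.

Lemma M2D a b f g : M2 a b f -> M2 a b g -> M2 a b (fun x => f x + g x).
Proof.
move=> hf hg; have [mf if2] := hf; have [mg ig2] := hg; split.
  exact: measurable_funD.
have := L1D (L1D if2 ig2) (L1Z 2 (M2_mul hf hg)); apply: L1_ext => x _ /=; ring.
Qed.

Lemma M2Z a b c f : M2 a b f -> M2 a b (fun x => c * f x).
Proof.
move=> [mf if2]; split; first by apply: measurable_funM => //; exact: measurable_cst.
have := L1Z (c ^+ 2) if2; apply: L1_ext => x _ /=; ring.
Qed.

Lemma M2B a b f g : M2 a b f -> M2 a b g -> M2 a b (fun x => f x - g x).
Proof.
move=> hf hg; have [m i] := M2D hf (M2Z (-1) hg).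
have -> : (fun x => f x - g x) = (fun x => f x + -1 * g x).
  by apply/funext => x; rewrite mulN1r.
by split.
Qed.

Lemma M2_bounded a b f K : measurable_fun `[a, b] f ->
  (forall x, a <= x <= b -> `|f x| <= K) -> M2 a b f.
Proof.
move=> mf hK; split => //; apply: (@L1_bounded _ _ _ _ (K ^+ 2)).
  exact: measurable_funX.
by move=> x hx; rewrite normrX lerXn2r ?nnegrE // ?hK // (le_trans _ (hK _ hx)).
Qed.

Lemma M2_cont a b f : {within `[a, b], continuous f} -> M2 a b f.
Proof.
move=> cf; have [K [_ hK]] := within_continuous_bounded cf.
exact: M2_bounded (within_continuous_measurable cf) hK.
Qed.

Lemma M2_L1 a b f : M2 a b f -> L1 a b f.
Proof.
move=> hf; have h1 : M2 a b (fun=> 1) by apply: (@M2_bounded _ _ _ 1) => // x _; rewrite normr1.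
by apply: L1_ext (M2_mul hf h1) => x _; rewrite mulr1.
Qed.

Lemma sq_dist_le a b f g h : M2 a b f -> M2 a b g -> M2 a b h ->
  \int[mu]_(x in `[a, b]) ((f x - h x) ^+ 2) <=
  2 * \int[mu]_(x in `[a, b]) ((f x - g x) ^+ 2) +
  2 * \int[mu]_(x in `[a, b]) ((g x - h x) ^+ 2).
Proof.
move=> hf hg hh; have [_ i1] := M2B hf hg; have [_ i2] := M2B hg hh.
have [_ i3] := M2B hf hh.
rewrite -!intZ // -intD ?L1Z //; apply: int_le => //; first by apply: L1D; exact: L1Z.
move=> x _; have := sqr_ge0 ((f x - g x) - (g x - h x)); nra.
Qed.

Lemma int_cvg0 a b (h : nat -> R -> R) (g : R -> R) :
  (forall n, measurable_fun `[a, b] (h n)) ->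
  (forall n x, a <= x <= b -> `|h n x| <= g x) -> L1 a b g ->
  {ae mu, forall x, a <= x <= b -> h n x @[n --> \oo] --> 0} ->
  \int[mu]_(x in `[a, b]) h n x @[n --> \oo] --> 0.
Proof.
move=> mh hg ig h0.
have [] := @dominated_convergence _ _ R mu `[a, b] (measurable_itv _)
   (fun n => EFin \o h n) (fun=> 0%E) (EFin \o g).
- by move=> n; apply/measurable_EFinP; exact: mh.
- exact: measurable_cst.
- move: h0; apply: filterS; first exact: (ae_filter_ringOfSetsType mu).
  move=> x hx; rewrite /= in_itv /= => xab.
  by apply/fine_cvgP; split; [exact: nearW|exact: hx].
- exact: ig.
- by apply: aeW => x n; rewrite /= in_itv /= => xab; rewrite lee_fin hg.
move=> _ _; rewrite integral0 => hc.
by apply: (@fine_cvg _ _ _ _ _ 0).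
Unshelve. all: by end_near. Qed.

End SquareIntegrable.

Section TrigPoly.
Variables (R : realType) (omega tau : R).
Notation mu := (@lebesgue_measure R).
Hypothesis tau0 : 0 < tau.
Hypothesis omtau : omega * tau = pi *+ 2.
Implicit Types (l : seq (int * R * R)) (t : R).

(* [(m, x, y)] stands for the complex monomial [(x - i y) exp (i m omega t)];
   [tre] and [tim] are the real and imaginary parts of the sum. *)
Definition tre l t := \sum_(p <- l)
  (p.1.2 * cos (p.1.1%:~R * omega * t) + p.2 * sin (p.1.1%:~R * omega * t)).
Definition tim l t := \sum_(p <- l)
  (p.1.2 * sin (p.1.1%:~R * omega * t) - p.2 * cos (p.1.1%:~R * omega * t)).

(** With vanishing imaginary part [p] equals the whole complex sum, so products of real
    trigonometric polynomials are obtained by multiplying complex sums with [tmul]. *)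
Definition trigp (p : R -> R) := exists l, (forall t, p t = tre l t) /\
  (forall t, tim l t = 0).

Definition tmul l1 l2 : seq (int * R * R) :=
  [seq (p.1.1 + q.1.1, p.1.2 * q.1.2 - p.2 * q.2, p.1.2 * q.2 + p.2 * q.1.2)
     | p <- l1, q <- l2].

Lemma tmulE l1 l2 t :
  tre (tmul l1 l2) t = tre l1 t * tre l2 t - tim l1 t * tim l2 t /\
  tim (tmul l1 l2) t = tre l1 t * tim l2 t + tim l1 t * tre l2 t.
Proof.
rewrite /tre /tim /tmul !big_allpairs_dep /=; split.
  rewrite !mulr_suml -sumrB; apply: eq_bigr => p _.
  rewrite !mulr_sumr -sumrB; apply: eq_bigr => q _.
  by rewrite intrD !mulrDl cosD sinD; ring.
rewrite !mulr_suml -big_split; apply: eq_bigr => p _ /=.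
rewrite !mulr_sumr -big_split; apply: eq_bigr => q _ /=.
by rewrite intrD !mulrDl cosD sinD; ring.
Qed.

Lemma trigp_cst c : trigp (fun=> c).
Proof.
exists [:: (0, c, 0)]; rewrite /tre /tim; split => t; rewrite big_seq1 /=;
  by rewrite ?mulr0z !mul0r ?cos0 ?sin0; ring.
Qed.

Lemma trigpD p q : trigp p -> trigp q -> trigp (fun t => p t + q t).
Proof.
move=> [l [h1 h2]] [l' [h3 h4]]; exists (l ++ l'); split => t.
  by rewrite h1 h3 /tre big_cat.
by have := h2 t; have := h4 t; rewrite /tim big_cat => /= -> ->; rewrite addr0.
Qed.

Lemma trigpM p q : trigp p -> trigp q -> trigp (fun t => p t * q t).
Proof.
move=> [l [h1 h2]] [l' [h3 h4]]; exists (tmul l l'); split => t.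
  by rewrite (tmulE _ _ _).1 h2 mul0r subr0 h1 h3.
by rewrite (tmulE _ _ _).2 h2 h4 mul0r mulr0 addr0.
Qed.

Lemma trigpX p n : trigp p -> trigp (fun t => p t ^+ n).
Proof.
move=> hp; elim: n => [|n IH]; first exact: trigp_cst 1.
have -> : (fun t => p t ^+ n.+1) = (fun t => p t * p t ^+ n).
  by apply/funext => t; rewrite exprS.
exact: trigpM.
Qed.

Lemma trigp_cos c : trigp (fun t => cos (omega * (t - c))).
Proof.
exists [:: (1, cos (omega * c) / 2, sin (omega * c) / 2);
           (-1, cos (omega * c) / 2, - (sin (omega * c) / 2))].
rewrite /tre /tim; split => t; rewrite !big_cons big_nil /=;
  rewrite mulrN1z ?mulr1z !mulN1r !mul1r !mulNr cosN sinN.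
  by rewrite mulrBr cosB; field.
by field.
Qed.

Lemma trigp_continuous p : trigp p -> continuous p.
Proof.
move=> [l [/funext -> _]].
have lin (c : R) : continuous (fun s : R => c * s).
  by move=> s; apply: cvgM; [exact: cvg_cst|exact: cvg_id].
rewrite /tre; elim: l => [|q l IH].
  rewrite (_ : (fun _ => _) = (fun=> 0)); first exact: cst_continuous.
  by apply/funext => t; rewrite big_nil.
rewrite (_ : (fun _ => _) = (fun t => (q.1.2 * cos (q.1.1%:~R * omega * t) +
    q.2 * sin (q.1.1%:~R * omega * t)) + \sum_(p <- l)
  (p.1.2 * cos (p.1.1%:~R * omega * t) + p.2 * sin (p.1.1%:~R * omega * t)))).
  move=> t; apply: cvgD; last exact: IH.
  apply: cvgD; (apply: cvgM; first exact: cvg_cst);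
    apply: (@continuous_comp _ _ _ (fun s => q.1.1%:~R * omega * s)) => //;
    [exact: lin|exact: continuous_cos|exact: lin|exact: continuous_sin].
by apply/funext => t; rewrite big_cons.
Qed.

Lemma trigp_M2 a b p : trigp p -> M2 a b p.
Proof.
by move=> /trigp_continuous cp; apply: M2_cont; exact: continuous_subspaceT.
Qed.

Definition tapprox f := forall e : R, 0 < e -> exists p, trigp p /\
  \int[mu]_(x in `[0, tau]) ((f x - p x) ^+ 2) <= e.

Lemma tapprox_lim f : M2 0 tau f ->
  (forall e, 0 < e -> exists g, [/\ M2 0 tau g, tapprox g &
     \int[mu]_(x in `[0, tau]) ((f x - g x) ^+ 2) <= e]) -> tapprox f.
Proof.
move=> hf h e e0; have e4 : 0 < e / 4 by rewrite divr_gt0.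
have [g [hg ag fg]] := h _ e4; have [p [hp gp]] := ag _ e4.
exists p; split => //; apply: le_trans (sq_dist_le hf hg (trigp_M2 _ _ hp)) _.
by lra.
Qed.

Lemma tapprox_lin c f g : M2 0 tau f -> M2 0 tau g ->
  tapprox f -> tapprox g -> tapprox (fun x => c * f x + g x).
Proof.
move=> hf hg af ag e e0.
have e4 : 0 < e / 4 by rewrite divr_gt0.
have c1 : 0 < c ^+ 2 + 1 by rewrite ltr_wpDl // sqr_ge0.
have e5 : 0 < e / 4 / (c ^+ 2 + 1) by rewrite divr_gt0.
have [p [hp fp]] := af _ e5; have [q [hq gq]] := ag _ e4.
exists (fun t => c * p t + q t); split.
  by apply: trigpD => //; apply: trigpM => //; exact: trigp_cst.
have hp2 := trigp_M2 0 tau hp; have hq2 := trigp_M2 0 tau hq.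
have [_ i1] := M2B hf hp2; have [_ i2] := M2B hg hq2.
have [_ i3] := M2B (M2D (M2Z c hf) hg) (M2D (M2Z c hp2) hq2).
apply: (@le_trans _ _ (\int[mu]_(x in `[0, tau])
   (2 * c ^+ 2 * (f x - p x) ^+ 2 + 2 * (g x - q x) ^+ 2))).
  apply: int_le => //; first by apply: L1D; exact: L1Z.
  move=> x _; have := sqr_ge0 (c * (f x - p x) - (g x - q x)); nra.
rewrite intD ?intZ; try exact: L1Z; try by [].
have : c ^+ 2 * \int[mu]_(x in `[0, tau]) ((f x - p x) ^+ 2) <= e / 4.
  apply: le_trans (ler_wpM2l (sqr_ge0 c) fp) _.
  rewrite mulrA ler_pdivrMr // mulrC ler_wpM2l ?(ltW e4) //.
  by rewrite lerDl.
by lra.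
Qed.

End TrigPoly.

(** * Polynomials approximating a step *)

Section StepPolynomials.
Variable R : realType.

Lemma bernoulli_sub (x : R) N : 0 <= x <= 1 -> 1 - N%:R * x <= (1 - x) ^+ N.
Proof.
move=> /andP[x0 x1]; elim: N => [|N IH]; first by rewrite mul0r subr0 expr0.
have x1' : 0 <= 1 - x by rewrite subr_ge0.
rewrite exprS; apply: le_trans (ler_wpM2l x1' IH).
rewrite -natr1; have : 0 <= N%:R * x ^+ 2 by rewrite mulr_ge0 // sqr_ge0.
by rewrite expr2; lra.
Qed.

Lemma bernoulli_add (x : R) N : 0 <= x -> 1 + N%:R * x <= (1 + x) ^+ N.
Proof.
move=> x0; elim: N => [|N IH]; first by rewrite mul0r addr0 expr0.
have x1' : 0 <= 1 + x by rewrite addr_ge0.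
rewrite exprS; apply: le_trans (ler_wpM2l x1' IH).
rewrite -natr1; have : 0 <= N%:R * x ^+ 2 by rewrite mulr_ge0 // sqr_ge0.
by rewrite expr2; lra.
Qed.

(* Polynomials in [u] converging to the indicator of [u < 1/2] on [[0, 1]]. *)
Definition qstep n (u : R) : R := (1 - u ^+ n) ^+ (2 ^ n).

Lemma qstep01 n (u : R) : 0 <= u <= 1 -> 0 <= qstep n u <= 1.
Proof.
move=> /andP[u0 u1]; have un0 : 0 <= u ^+ n by rewrite exprn_ge0.
have un1 : u ^+ n <= 1 by rewrite exprn_ile1.
by rewrite exprn_ge0 ?subr_ge0 // exprn_ile1 ?subr_ge0 // gerBl.
Qed.

(** Bernoulli gives [qstep n u >= 1 - (2 u) ^ n], with ratio [2 u < 1]. *)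
Lemma qstep_lt (u : R) : 0 <= u -> u < 2^-1 -> qstep n u @[n --> \oo] --> (1 : R).
Proof.
move=> u0 u2.
have h : geometric (1 : R) (2 * u) n @[n --> \oo] --> (0 : R).
  by apply: cvg_geometric; rewrite ger0_norm; lra.
have h' : 1 - geometric (1 : R) (2 * u) n @[n --> \oo] --> (1 : R).
  by rewrite -[X in _ --> X]subr0; apply: cvgB => //; exact: cvg_cst.
apply: (@squeeze_cvgr _ _ _ _ (fun n => 1 - geometric (1 : R) (2 * u) n)
  (fun=> 1)); [apply: nearW => n|exact: h'|exact: cvg_cst].
have u01 : 0 <= u <= 1 by rewrite u0; lra.
rewrite (andP (qstep01 n u01)).2 andbT /geometric /= mul1r exprMn -natrX.
by apply: bernoulli_sub; rewrite exprn_ge0 // exprn_ile1 //; lra.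
Qed.

(** With [x = u ^ n], the product of [(1 - x) ^ (2 ^ n)] and [(1 + x) ^ (2 ^ n)] is at most [1], and
    Bernoulli bounds the second factor below by [(2 u) ^ n]. *)
Lemma qstep_gt (u : R) : 2^-1 < u -> u <= 1 -> qstep n u @[n --> \oo] --> (0 : R).
Proof.
move=> u2 u1; have u0 : 0 <= u by lra.
have u0' : 0 < u by lra.
have h : geometric (1 : R) ((2 * u)^-1) n @[n --> \oo] --> (0 : R).
  apply: cvg_geometric; rewrite ger0_norm ?invr_ge0 ?mulr_ge0 //.
  by rewrite invf_lt1 ?mulr_gt0 //; lra.
apply: (@squeeze_cvgr _ _ _ _ (fun=> 0) (fun n => geometric (1 : R) (2 * u)^-1 n));
  [apply: nearW => n|exact: cvg_cst|exact: h].
have u01 : 0 <= u <= 1 by rewrite u0; lra.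
rewrite (andP (qstep01 n u01)).1 /= /geometric /= mul1r exprVn.
set x := u ^+ n; have x0 : 0 < x by rewrite exprn_gt0.
have x1 : x <= 1 by rewrite exprn_ile1.
rewrite -[leRHS]div1r ler_pdivlMr ?exprn_gt0 ?mulr_gt0 //.
have h1 : (2 * u) ^+ n <= (1 + x) ^+ (2 ^ n).
  apply: le_trans (bernoulli_add _ (ltW x0)).
  by rewrite exprMn -natrX -/x ler_wpDl.
apply: le_trans (ler_wpM2l _ h1) _; first by rewrite exprn_ge0 ?subr_ge0.
rewrite /qstep -/x -exprMn exprn_ile1 //.
  by rewrite mulr_ge0 // ?subr_ge0 // addr_ge0 // ltW.
by have := sqr_ge0 x; rewrite expr2; lra.
Qed.

End StepPolynomials.

(** * Density of trigonometric polynomials in L^2 of a period *)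

Section Density.
Variables (R : realType) (omega tau : R).
Notation mu := (@lebesgue_measure R).
Hypothesis tau0 : 0 < tau.
Hypothesis omtau : omega * tau = pi *+ 2.
Local Notation tapprox := (tapprox omega tau).
Local Notation trigp := (trigp omega).

Lemma omega_gt0 : 0 < omega.
Proof.
have : 0 < omega * tau by rewrite omtau pmulrn_lgt0 // pi_gt0.
by rewrite pmulr_lgt0.
Qed.

Let om0 := omega_gt0.

Lemma cos_lt_arc (y x : R) : 0 <= y -> y <= pi -> y < x -> x < pi *+ 2 - y ->
  cos x < cos y.
Proof.
move=> y0 ypi yx xpi; case: (leP x pi) => h.
  by rewrite ltr_cos // in_itv /= ?y0 ?ypi //= (le_trans y0 (ltW yx)) h.
have -> : cos x = cos (pi *+ 2 - x).
  by rewrite cosB cos2pi sin2pi mul1r mul0r addr0.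
rewrite ltr_cos ?in_itv /= ?y0 ?ypi //.
  by rewrite ltrBrDl -ltrBrDr.
by rewrite subr_ge0; apply/andP; split; lra.
Qed.

(** Cosine decreases with the distance to the midpoint of [a] and [b], so this first-degree
    trigonometric polynomial is below [1/2] inside the arc and above [1/2] outside. Composition with
    [qstep] then approximates the indicator of the arc. *)
Definition arc_arg (a b t : R) : R :=
  2^-1 - (cos (omega * (t - (a + b) / 2)) - cos (omega * ((b - a) / 2))) / 4.

Lemma arc_arg01 a b t : 0 <= arc_arg a b t <= 1.
Proof.
rewrite /arc_arg.
have := cos_le1 (omega * (t - (a + b) / 2)).
have := cos_geN1 (omega * (t - (a + b) / 2)).
have := cos_le1 (omega * ((b - a) / 2)).
have := cos_geN1 (omega * ((b - a) / 2)).
by move=> *; apply/andP; split; lra.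
Qed.

Lemma qstep_arc (a b t : R) : 0 <= a -> a <= b -> b <= tau -> 0 < t -> t < tau ->
  t != a -> t != b ->
  qstep n (arc_arg a b t) @[n --> \oo] --> (((a < t) && (t < b))%:R : R).
Proof.
move=> a0 ab btau t0 tt ta tb.
set c := (a + b) / 2; set h := (b - a) / 2.
have h0 : 0 <= omega * h by rewrite mulr_ge0 ?divr_ge0 ?subr_ge0 // ltW.
have hpi : omega * h <= pi.
  suff : omega * h <= omega * tau / 2 by rewrite omtau mulr2n; lra.
  by rewrite -mulrA ler_wpM2l ?(ltW om0) // /h; lra.
have cosn : cos (omega * (t - c)) = cos (omega * `|t - c|).
  by case: (ger0P (t - c)) => // _; rewrite mulrN cosN.
have [u0 u1] := andP (arc_arg01 a b t).
case: (boolP ((a < t) && (t < b))) => [/andP[h1 h2]|nin].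
  apply: qstep_lt => //; rewrite /arc_arg -/c -/h.
  suff : cos (omega * h) < cos (omega * (t - c)) by lra.
  rewrite cosn ltr_cos ?in_itv /= ?h0 ?hpi //.
    rewrite ltr_pM2l // /h /c; case: (ger0P _) => _; lra.
  rewrite mulr_ge0 ?(ltW om0) //=; apply: le_trans hpi.
  by rewrite ler_wpM2l ?(ltW om0) // /h /c; case: (ger0P _) => _; lra.
apply: qstep_gt => //; rewrite /arc_arg -/c -/h.
suff : cos (omega * (t - c)) < cos (omega * h) by lra.
have out : (t < a) || (b < t).
  move: ta tb nin; rewrite negb_and -!leNgt !le_eqVlt (eq_sym b).
  by move=> /negbTE -> /negbTE ->.
have hc : h < `|t - c|.
  by case/orP: out => ?; rewrite /h /c; case: (ger0P _) => ?; lra.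
rewrite cosn; apply: cos_lt_arc => //; first by rewrite ltr_pM2l.
rewrite -omtau -mulrBr ltr_pM2l //.
by rewrite /h /c; case: (ger0P _) => ?; lra.
Qed.

Lemma ae_notin (s : seq R) : {ae mu, forall x, x \notin s}.
Proof.
exists [set` s]; split.
- apply: countable_measurable; first by move=> t; exact: measurable_set1.
  by apply: finite_set_countable; exact: finite_seq.
- by apply: countable_lebesgue_measure0; apply: finite_set_countable; exact: finite_seq.
- by move=> x /=; rewrite /setC /= => /negP; rewrite negbK.
Qed.

(** Dominated convergence makes almost everywhere limits into L^2 limits. This one step is reused
    for arcs, for countable disjoint unions and for simple functions. *)
Lemma tapprox_cvg (f : R -> R) (p : nat -> R -> R) (g : R -> R) :
  M2 0 tau f -> (forall n, M2 0 tau (p n)) -> (forall n, tapprox (p n)) ->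
  L1 0 tau g ->
  (forall n x, 0 <= x <= tau -> (f x - p n x) ^+ 2 <= g x) ->
  {ae mu, forall x, 0 <= x <= tau -> p n x @[n --> \oo] --> f x} -> tapprox f.
Proof.
move=> hf hp ap ig hg pf; apply: tapprox_lim => // e e0.
have : \int[mu]_(x in `[0, tau]) ((f x - p n x) ^+ 2) @[n --> \oo] --> 0.
  apply: (@int_cvg0 _ _ _ _ g).
  - by move=> n; apply: measurable_funX; exact: (M2B hf (hp n)).1.
  - by move=> n x hx; rewrite ger0_norm ?sqr_ge0 // hg.
  - exact: ig.
  - move: pf; apply: filterS; first exact: (ae_filter_ringOfSetsType mu).
    move=> x hx xt.
    have h0 : f x - p n x @[n --> \oo] --> (0 : R).
      by rewrite -(subrr (f x)); apply: cvgB; [exact: cvg_cst|exact: hx].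
    rewrite -(mulr0 0) (_ : (fun n => _) =
      (fun n => (f x - p n x) * (f x - p n x))); first exact: (cvgM h0 h0).
    by apply/funext => n; rewrite expr2.
move/cvgrPdist_le => /(_ e e0) [N _ hN].
exists (p N); split => //; have := hN N (leqnn N); rewrite /= sub0r normrN.
by apply: le_trans; rewrite ler_norm.
Qed.

Lemma tapprox_indic_itv a b : tapprox (\1_(`]a, b]%classic : set R)).
Proof.
set f : R -> R := \1_ _.
have mf : measurable_fun `[0, tau] f.
  by apply: measurable_funTS; exact: measurable_indic.
have f01 x : 0 <= f x <= 1.
  by rewrite /f indicE; case: (_ \in _); rewrite lexx ler01.
have hf : M2 0 tau f.
  apply: (@M2_bounded _ _ _ _ 1) => // x _.
  by have /andP[h1 h2] := f01 x; rewrite ger0_norm.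
(* The interval is clipped to the period, keeping [a' <= b'] even when the intersection is empty. *)
pose a' := Num.min tau (Num.max 0 a); pose b' := Num.max a' (Num.min b tau).
have a'0 : 0 <= a' by rewrite le_min ltW // le_max lexx.
have ab' : a' <= b' by rewrite le_max lexx.
have b'tau : b' <= tau by rewrite ge_max !ge_min !lexx orbT.
pose p n t := qstep n (arc_arg a' b' t).
have tp n : trigp (p n).
  rewrite /p /qstep /arc_arg; apply: trigpX.
  set d := cos (omega * ((b' - a') / 2)).
  have -> : (fun t => 1 - (2^-1 - (cos (omega * (t - (a' + b') / 2)) - d) / 4) ^+ n)
      = (fun t => 1 + (-1) * ((2^-1 + d / 4) + (- 4^-1) * cos (omega * (t - (a' + b') / 2))) ^+ n).
    by apply/funext => t; rewrite mulN1r; congr (_ - _ ^+ _); field.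
  apply: trigpD; first exact: trigp_cst.
  apply: trigpM; first exact: trigp_cst.
  apply: trigpX; apply: trigpD; first exact: trigp_cst.
  by apply: trigpM; [exact: trigp_cst|exact: trigp_cos].
have p01 n x : 0 <= p n x <= 1 by apply: qstep01; exact: arc_arg01.
have mp n : M2 0 tau (p n) by exact: trigp_M2.
apply: (tapprox_cvg hf mp _ (L1_cst 0 tau 1)).
- move=> n e e0; exists (p n); split => //.
  under eq_Rintegral do rewrite subrr expr0n.
  by rewrite int_cst ?mul0r // ltW.
- move=> n x _; have := f01 x; have := p01 n x => /andP[h1 h2] /andP[h3 h4].
  by rewrite expr2; nra.
(* At the ends of the arc the argument is [1/2], where [qstep] tends to neither [0] nor [1]; the
   points [0] and [tau] coincide modulo the period. *)
- have := ae_notin [:: 0; tau; a'; b'].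
  apply: filterS; first exact: (ae_filter_ringOfSetsType mu).
  move=> x; rewrite !inE !negb_or => /and4P[x0 xt xa xb] /andP[h1 h2].
  have x0' : 0 < x by rewrite lt_neqAle eq_sym x0.
  have xt' : x < tau by rewrite lt_neqAle xt.
  have -> : f x = ((a' < x) && (x < b'))%:R.
    rewrite /f indicE mem_setE; congr (_%:R); congr nat_of_bool.
    rewrite in_itv /=.
    have -> : (a < x) = (a' < x).
      by rewrite /a' gt_min gt_max x0' /= ltNge (ltW xt').
    case: (ltP a' x) => //= ax; rewrite /b' lt_max ltNge (ltW ax) /= lt_min xt' andbT.
    rewrite le_eqVlt; case: eqP => //= xb'; move: xb.
    by rewrite /b' -xb' min_l ?max_r ?eqxx // ltW.
  exact: qstep_arc.
Qed.

End Density.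

Section DensityL2.
Import HBSimple HBNNSimple.
Variables (R : realType) (omega tau : R).
Notation mu := (@lebesgue_measure R).
Hypothesis tau0 : 0 < tau.
Hypothesis omtau : omega * tau = pi *+ 2.
Local Notation tapprox := (tapprox omega tau).

Lemma indic_M2 (A : set (measurableTypeR R)) : measurable A ->
  M2 0 tau (\1_A : R -> R).
Proof.
move=> mA; apply: (@M2_bounded _ _ _ _ 1).
  by apply: measurable_funTS; exact: measurable_indic.
by move=> x _; rewrite indicE; case: (_ \in _); rewrite ?normr1 ?normr0.
Qed.

Lemma M2_cst a b (c : R) : M2 a b (fun=> c).
Proof. by apply: (@M2_bounded _ _ _ _ `|c|) => //; exact: measurable_cst. Qed.

Lemma tapprox_trigp p : trigp omega p -> tapprox p.
Proof.
move=> hp e e0; exists p; split => //.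
by under eq_Rintegral do rewrite subrr expr0n; rewrite int_cst ?mul0r // ltW.
Qed.

Lemma tapprox_cst c : tapprox (fun=> c).
Proof. apply: tapprox_trigp; exact: trigp_cst. Qed.

Lemma tapprox_sum (I : Type) (r : seq I) (c : I -> R) (F : I -> R -> R) :
  (forall i, M2 0 tau (F i) /\ tapprox (F i)) ->
  M2 0 tau (fun x => \sum_(i <- r) c i * F i x) /\
  tapprox (fun x => \sum_(i <- r) c i * F i x).
Proof.
move=> hF; elim: r => [|i r [IH1 IH2]].
  have -> : (fun x => \sum_(i <- [::]) c i * F i x) = (fun=> 0).
    by apply/funext => x; rewrite big_nil.
  by split; [exact: M2_cst|exact: tapprox_cst].
have -> : (fun x => \sum_(j <- i :: r) c j * F j x) =
    (fun x => c i * F i x + \sum_(j <- r) c j * F j x).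
  by apply/funext => x; rewrite big_cons.
have [h1 h2] := hF i; split; first by apply: M2D => //; exact: M2Z.
exact: tapprox_lin.
Qed.

Lemma sum_indic_trivIset (F : (set R)^nat) n x : trivIset setT F ->
  (\sum_(k < n) \1_(F k) x = 0 :> R /\ forall k, (k < n)%N -> ~ F k x) \/
  (\sum_(k < n) \1_(F k) x = 1 :> R /\ exists k, (k < n)%N /\ F k x).
Proof.
move=> tF; elim: n => [|n [[IH h]|[IH [k [kn Fk]]]]].
- by left; rewrite big_ord0.
- rewrite big_ord_recr /= IH add0r indicE; case: (boolP (x \in F n)) => hx.
    by right; split => //; exists n; rewrite inE in hx.
  left; split => // k; rewrite ltnS leq_eqVlt => /predU1P[->|].
    by move=> Fn; move: hx; rewrite notin_setE.
  exact: h.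
- right; split; last by exists k; split => //; exact: ltnW.
  rewrite big_ord_recr /= IH indicE memNset ?addr0 // => Fn.
  have nk : n = k by apply: tF => //; exists x.
  by rewrite nk ltnn in kn.
Qed.

(** Approximability survives complements and countable disjoint unions, and half-open intervals are
    closed under intersection: the pi-lambda theorem applies. *)
Lemma tapprox_indic (A : set (measurableTypeR R)) : measurable A ->
  tapprox (\1_A : R -> R).
Proof.
move=> mA; apply: (@dynkin_induction _ (measurableTypeR R) (@ocitv R)
  (fun A => measurable A -> tapprox (\1_A : R -> R))) => //.
- exact: ocitvI.
- by move=> _; rewrite indicT; exact: tapprox_cst.
- by move=> _ [[a b]] _ <- _; exact: tapprox_indic_itv.
- move=> S mS aS _; rewrite indicC.
  have -> : (fun x : R => (x \notin S)%:R : R) = (fun x => (-1) * \1_S x + 1).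
    by apply/funext => x; rewrite indicE; case: (_ \in _); rewrite /=; ring.
  by apply: tapprox_lin; [exact: indic_M2|exact: M2_cst|exact: aS|exact: tapprox_cst].
- move=> F mF tF aF mU.
  pose p n (x : R) : R := \sum_(k <- index_enum 'I_n) 1 * \1_(F k) x.
  have hp n : M2 0 tau (p n) /\ tapprox (p n).
    by apply: tapprox_sum => k; split; [exact: indic_M2|exact: aF].
  have pE n x : p n x = \sum_(k < n) \1_(F k) x.
    by apply: eq_bigr => k _; rewrite mul1r.
  apply: (tapprox_cvg (p := p) _ _ _ (L1_cst 0 tau 1)).
  + exact: indic_M2.
  + by move=> n; exact: (hp n).1.
  + by move=> n; exact: (hp n).2.
  + move=> n x _; rewrite pE indicE.
    by case: (sum_indic_trivIset n x tF) => -[-> _]; case: (_ \in _);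
      rewrite /= ?subrr ?subr0 ?sub0r ?sqrrN ?expr1n ?expr0n.
  + apply: aeW => x _; rewrite indicE.
    case: (boolP (x \in \bigcup_k F k)) => [|hx] /=.
      rewrite inE => -[m _ Fm]; apply: cvg_near_cst; exists m.+1 => // n /= mn.
      rewrite pE; case: (sum_indic_trivIset n x tF) => -[-> h] //.
      by case: (h m mn).
    apply: cvg_near_cst; apply: nearW => n.
    rewrite pE; case: (sum_indic_trivIset n x tF) => -[-> //].
    by move=> [k [_ Fk]]; move: hx; rewrite notin_setE; case; exists k.
Qed.

Lemma tapprox_nonneg f : M2 0 tau f -> (forall x, 0 <= f x) -> tapprox f.
Proof.
move=> hf f0.
have mE : measurable_fun `[0, tau] (EFin \o f) by apply/measurable_EFinP; exact: hf.1.
pose p := nnsfun_approx (measurable_itv `[0, tau]) mE.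
have f0' x : `[0, tau]%classic x -> (0 <= (EFin \o f) x)%E by rewrite lee_fin.
have pf n x : 0 <= x <= tau -> 0 <= p n x <= f x.
  move=> hx; rewrite fun_ge0 /= -lee_fin.
  by rewrite /p nnsfun_approxE; apply: (@le_approx _ _ R `[0, tau]%classic (EFin \o f)).
have hp n : M2 0 tau (p n) /\ tapprox (p n).
  have -> : (p n : R -> R) = fun x =>
    \sum_(y <- fset_set (range (p n))) y * \1_((p n) @^-1` [set y]) x.
    apply/funext => x; rewrite fimfunE fsbig_finite //.
  have my (y : R) : measurable (p n @^-1` [set y] : set (measurableTypeR R)).
    exact: (measurable_funPTI (p n) (measurable_set1 y)).
  by apply: tapprox_sum => y; split; [apply: indic_M2|apply: tapprox_indic]; exact: my.
apply: (tapprox_cvg (p := fun n => p n) hf _ _ hf.2).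
- by move=> n; exact: (hp n).1.
- by move=> n; exact: (hp n).2.
- move=> n x hx; have /andP[h1 h2] := pf n x hx; nra.
- apply: aeW => x hx.
  have := @cvg_nnsfun_approx _ _ _ _ (measurable_itv `[0, tau]) _ mE f0' x hx.
  by move=> /fine_cvg.
Qed.

Lemma tapprox_M2 f : M2 0 tau f -> tapprox f.
Proof.
move=> hf.
have M2le (g : R -> R) : measurable_fun `[0, tau] g -> (forall x, `|g x| <= `|f x|) -> M2 0 tau g.
  move=> mg gf; split => //; apply: L1_le hf.2; first exact: measurable_funX.
  move=> x _; rewrite normrX -[f x ^+ 2]real_normK ?num_real //.
  by rewrite lerXn2r ?nnegrE.
pose fp x := Num.max (f x) 0; pose fm x := Num.max (- f x) 0.
have hp : M2 0 tau fp.
  apply: M2le; first by apply: measurable_maxr => //; exact: hf.1.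
  by move=> x; rewrite /fp; case: (lerP (f x) 0); rewrite ?normr0.
have hm : M2 0 tau fm.
  apply: M2le.
    apply: measurable_maxr => //; apply: measurableT_comp => //; exact: hf.1.
  by move=> x; rewrite /fm; case: (lerP (- f x) 0); rewrite ?normr0 ?normrN.
have -> : f = (fun x => (-1) * fm x + fp x).
  apply/funext => x; rewrite /fm /fp mulN1r oppr_max opprK oppr0.
  by rewrite /Num.max /Num.min; case: ltP; case: ltP => *; lra.
have fp0 x : 0 <= fp x by rewrite /fp le_max lexx orbT.
have fm0 x : 0 <= fm x by rewrite /fm le_max lexx orbT.
by apply: tapprox_lin => //; exact: tapprox_nonneg.
Qed.

End DensityL2.

(** * Fourier series in L^2, summed over arbitrary finite sets of frequencies *)

Section Fourier.
Variables (R : realType) (omega tau : R).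
Notation mu := (@lebesgue_measure R).
Hypothesis tau0 : 0 < tau.
Hypothesis omtau : omega * tau = pi *+ 2.
Implicit Types (f : R -> R) (l : seq (int * R * R)) (m j : int).

Lemma cos_sin_2pi_int j : cos (j%:~R * (pi *+ 2)) = 1 :> R /\
  sin (j%:~R * (pi *+ 2)) = 0 :> R.
Proof.
have h (n : nat) : cos (n%:R * (pi *+ 2)) = 1 :> R /\
    sin (n%:R * (pi *+ 2)) = 0 :> R.
  elim: n => [|n [IH1 IH2]]; first by rewrite mul0r cos0 sin0.
  rewrite -natr1 mulrDl mul1r (cosD (n%:R * _)) (sinD (n%:R * _)) IH1 IH2 cos2pi sin2pi.
  by split; ring.
case: j => n; first exact: h.
by rewrite NegzE mulrNz mulNr cosN sinN; have [-> ->] := h n.+1; rewrite oppr0.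
Qed.

Lemma int_deriv (F f : R -> R) a b : a < b -> continuous f ->
  (forall x, is_derive x (1 : R) F (f x)) ->
  \int[mu]_(x in `[a, b]) f x = F b - F a.
Proof.
move=> ab cf dF.
have dvF x : derivable F x 1 by have [] := dF x.
have cF : continuous F.
  by move=> x; apply: differentiable_continuous; exact/derivable1_diffP.
rewrite /Rintegral (@continuous_FTC2 _ f F) //.
- exact: continuous_subspaceT.
- split; first by move=> x _; exact: dvF.
    exact/cvg_at_right_filter/cF.
  exact/cvg_at_left_filter/cF.
- by move=> x _; rewrite derive1E; have [_ ->] := dF x.
Qed.

Lemma lin_continuous (c : R) : continuous (fun s : R => c * s).
Proof. by move=> s; apply: cvgM; [exact: cvg_cst|exact: cvg_id]. Qed.

Lemma comp_lin_continuous (h : R -> R) (c : R) :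
  continuous h -> continuous (fun t => h (c * t)).
Proof.
move=> ch t; apply: (@continuous_comp _ _ _ (fun s => c * s) h); last exact: ch.
exact: lin_continuous.
Qed.

Lemma cos_lin_continuous (c : R) : continuous (fun t => cos (c * t)).
Proof. by apply: (comp_lin_continuous (h := cos)); exact: continuous_cos. Qed.

Lemma sin_lin_continuous (c : R) : continuous (fun t => sin (c * t)).
Proof. by apply: (comp_lin_continuous (h := sin)); exact: continuous_sin. Qed.

Lemma lin_derive (c t : R) : is_derive t (1 : R) (fun s => c * s) c.
Proof. by apply: der_eq (der_affine c 0 t) => [s|] //; rewrite addr0. Qed.

Lemma int_cos_lin j : \int[mu]_(t in `[0, tau]) cos (j%:~R * omega * t) =
  if j == 0 then tau else 0.
Proof.
case: eqP => [->|/eqP j0].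
  under eq_Rintegral do rewrite mulr0z !mul0r cos0.
  by rewrite int_cst ?mul1r ?subr0 // ltW.
have om : omega != 0.
  apply/eqP => om; move: omtau; rewrite om mul0r => /esym/eqP.
  by rewrite mulrn_eq0 /= gt_eqF // pi_gt0.
set c := j%:~R * omega.
have c0 : c != 0 by rewrite mulf_neq0 // intr_eq0.
have dF x : is_derive x (1 : R) (fun t => c^-1 * sin (c * t)) (cos (c * x)).
  apply: der_eq (derM (der_cst c^-1 x)
    (der_comp (is_derive_sin (c * x)) (lin_derive c x))) => //.
  by rewrite mul0r add0r mulrCA mulVf // mulr1.
rewrite (int_deriv tau0 (@cos_lin_continuous c) dF).
by rewrite mulr0 sin0 mulr0 subr0 -mulrA omtau (cos_sin_2pi_int j).2 mulr0.
Qed.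

Lemma int_sin_lin j : \int[mu]_(t in `[0, tau]) sin (j%:~R * omega * t) = 0.
Proof.
have [->|j0] := eqVneq j 0.
  under eq_Rintegral do rewrite mulr0z !mul0r sin0.
  by rewrite int_cst ?mul0r // ltW.
have om : omega != 0.
  apply/eqP => om; move: omtau; rewrite om mul0r => /esym/eqP.
  by rewrite mulrn_eq0 /= gt_eqF // pi_gt0.
set c := j%:~R * omega.
have c0 : c != 0 by rewrite mulf_neq0 // intr_eq0.
have dF x : is_derive x (1 : R) (fun t => - c^-1 * cos (c * t)) (sin (c * x)).
  apply: der_eq (derM (der_cst (- c^-1) x)
    (der_comp (is_derive_cos (c * x)) (lin_derive c x))) => //.
  by rewrite mul0r add0r !mulNr mulrN opprK mulrCA mulVf // mulr1.
rewrite (int_deriv tau0 (@sin_lin_continuous c) dF).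
by rewrite mulr0 cos0 -mulrA omtau (cos_sin_2pi_int j).1 subrr.
Qed.

(** [fourier_cos f m - i fourier_sin f m] is the complex Fourier coefficient, hence the factor
    [tau^-1] for every integer [m], positive or negative. *)
Definition fourier_cos f m : R :=
  tau^-1 * \int[mu]_(t in `[0, tau]) (f t * cos (m%:~R * omega * t)).
Definition fourier_sin f m : R :=
  tau^-1 * \int[mu]_(t in `[0, tau]) (f t * sin (m%:~R * omega * t)).

Definition fourier_list f (J : seq int) :=
  [seq (m, fourier_cos f m, fourier_sin f m) | m <- J].

Lemma cos_lin_M2 c : M2 0 tau (fun t => cos (c * t)).
Proof. apply/M2_cont/continuous_subspaceT; exact: cos_lin_continuous. Qed.
Lemma sin_lin_M2 c : M2 0 tau (fun t => sin (c * t)).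
Proof. apply/M2_cont/continuous_subspaceT; exact: sin_lin_continuous. Qed.

Lemma M2_sum (I : Type) (r : seq I) (F : I -> R -> R) :
  (forall i, M2 0 tau (F i)) -> M2 0 tau (fun x => \sum_(i <- r) F i x).
Proof.
move=> hF; elim: r => [|i r IH].
  rewrite (_ : (fun _ => _) = fun=> 0); first exact: M2_cst.
  by apply/funext => x; rewrite big_nil.
rewrite (_ : (fun _ => _) = fun x => F i x + \sum_(j <- r) F j x).
  exact: M2D.
by apply/funext => x; rewrite big_cons.
Qed.

Lemma tre_M2 l : M2 0 tau (tre omega l).
Proof.
by apply: M2_sum => p; apply: M2D; apply: M2Z;
  [exact: cos_lin_M2|exact: sin_lin_M2].
Qed.

Lemma tim_M2 l : M2 0 tau (tim omega l).
Proof.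
by apply: M2_sum => p; apply: M2B; apply: M2Z;
  [exact: sin_lin_M2|exact: cos_lin_M2].
Qed.

(** The integrands are the real part and minus the imaginary part of the partial sum times
    [exp (- i m omega t)]; only the mode [m] has nonzero mean. *)
Lemma tre_tim_orth f (J : seq int) m : uniq J -> m \in J ->
  \int[mu]_(t in `[0, tau]) (tre omega (fourier_list f J) t * cos (m%:~R * omega * t)
    + tim omega (fourier_list f J) t * sin (m%:~R * omega * t)) =
    tau * fourier_cos f m /\
  \int[mu]_(t in `[0, tau]) (tre omega (fourier_list f J) t * sin (m%:~R * omega * t)
    - tim omega (fourier_list f J) t * cos (m%:~R * omega * t)) =
    tau * fourier_sin f m.
Proof.
move=> uJ mJ.
have L1c (c d : R) : L1 0 tau (fun t => c * cos (d * t)).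
  by apply: L1Z; exact: (M2_L1 (cos_lin_M2 _)).
have L1s (c d : R) : L1 0 tau (fun t => c * sin (d * t)).
  by apply: L1Z; exact: (M2_L1 (sin_lin_M2 _)).
split.
  transitivity (\int[mu]_(t in `[0, tau]) \sum_(k <- J)
     (fourier_cos f k * cos ((k - m)%:~R * omega * t) +
      fourier_sin f k * sin ((k - m)%:~R * omega * t))).
    apply: int_ext => t _; rewrite /tre /tim !big_map !mulr_suml -big_split /=.
    apply: eq_bigr => k _; rewrite intrB !mulrBl cosB sinB; ring.
  rewrite int_sum; last by move=> k _; exact: L1D.
  rewrite (bigD1_seq m) //= big1 => [|k km].
    rewrite intD // !intZ ?int_cos_lin ?int_sin_lin ?subrr ?eqxx;
    try exact: (M2_L1 (cos_lin_M2 _)); try exact: (M2_L1 (sin_lin_M2 _)).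
    ring.
  rewrite intD // !intZ ?int_cos_lin ?int_sin_lin ?subr_eq0 ?(negbTE km);
    try exact: (M2_L1 (cos_lin_M2 _)); try exact: (M2_L1 (sin_lin_M2 _)).
  ring.
transitivity (\int[mu]_(t in `[0, tau]) \sum_(k <- J)
     (- fourier_cos f k * sin ((k - m)%:~R * omega * t) +
      fourier_sin f k * cos ((k - m)%:~R * omega * t))).
  apply: int_ext => t _; rewrite /tre /tim !big_map !mulr_suml -sumrB /=.
  apply: eq_bigr => k _; rewrite intrB !mulrBl cosB sinB; ring.
rewrite int_sum; last by move=> k _; exact: L1D.
rewrite (bigD1_seq m) //= big1 => [|k km].
  rewrite intD // !intZ ?int_cos_lin ?int_sin_lin ?subrr ?eqxx;
    try exact: (M2_L1 (cos_lin_M2 _)); try exact: (M2_L1 (sin_lin_M2 _)).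
  ring.
rewrite intD // !intZ ?int_cos_lin ?int_sin_lin ?subr_eq0 ?(negbTE km);
    try exact: (M2_L1 (cos_lin_M2 _)); try exact: (M2_L1 (sin_lin_M2 _)).
ring.
Qed.

(** This integral is the real part of the inner product of the complex residual with the sum [l],
    whose frequencies lie in [J]. *)
Lemma fourier_residual_orth f (J : seq int) l : M2 0 tau f -> uniq J ->
  (forall p, p \in l -> p.1.1 \in J) ->
  \int[mu]_(t in `[0, tau])
    ((f t - tre omega (fourier_list f J) t) * tre omega l t -
     tim omega (fourier_list f J) t * tim omega l t) = 0.
Proof.
move=> hf uJ hl; set u := tre _ (fourier_list f J); set v := tim _ _.
have hu : M2 0 tau u by exact: tre_M2.
have hv : M2 0 tau v by exact: tim_M2.
pose c m t := cos (m%:~R * omega * t); pose s m t := sin (m%:~R * omega * t).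
have hc m : M2 0 tau (c m) by exact: cos_lin_M2.
have hs m : M2 0 tau (s m) by exact: sin_lin_M2.
pose X m t := f t * c m t - (u t * c m t + v t * s m t).
pose Y m t := f t * s m t - (u t * s m t - v t * c m t).
have iX m : L1 0 tau (X m).
  by apply: L1B; [exact: M2_mul|apply: L1D; exact: M2_mul].
have iY m : L1 0 tau (Y m).
  by apply: L1B; [exact: M2_mul|apply: L1B; exact: M2_mul].
have tK : tau != 0 by rewrite gt_eqF.
have X0 m : m \in J -> \int[mu]_(t in `[0, tau]) X m t = 0.
  move=> mJ; rewrite intB; [|exact: M2_mul|by apply: L1D; exact: M2_mul].
  by rewrite (tre_tim_orth f uJ mJ).1 /fourier_cos mulVKf // subrr.
have Y0 m : m \in J -> \int[mu]_(t in `[0, tau]) Y m t = 0.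
  move=> mJ; rewrite intB; [|exact: M2_mul|by apply: L1B; exact: M2_mul].
  by rewrite (tre_tim_orth f uJ mJ).2 /fourier_sin mulVKf // subrr.
transitivity (\int[mu]_(t in `[0, tau]) \sum_(p <- l)
    (p.1.2 * X p.1.1 t + p.2 * Y p.1.1 t)).
  apply: int_ext => t _; rewrite /tre /tim !mulr_sumr -sumrB.
  by apply: eq_bigr => p _; rewrite /X /Y /c /s; ring.
rewrite int_sum; last by move=> p _; apply: L1D; exact: L1Z.
rewrite big_seq big1 // => p /hl pJ.
by rewrite intD ?intZ ?X0 ?Y0 ?mulr0 ?addr0 //; exact: L1Z.
Qed.

Definition topp l : seq (int * R * R) := [seq (q.1.1, - q.1.2, - q.2) | q <- l].

Lemma tre_cat l1 l2 t : tre omega (l1 ++ l2) t = tre omega l1 t + tre omega l2 t.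
Proof. by rewrite /tre big_cat. Qed.

Lemma tim_cat l1 l2 t : tim omega (l1 ++ l2) t = tim omega l1 t + tim omega l2 t.
Proof. by rewrite /tim big_cat. Qed.

Lemma tre_opp l t : tre omega (topp l) t = - tre omega l t.
Proof.
by rewrite /tre /topp big_map -sumrN; apply: eq_bigr => q _ /=; ring.
Qed.

Lemma tim_opp l t : tim omega (topp l) t = - tim omega l t.
Proof.
by rewrite /tim /topp big_map -sumrN; apply: eq_bigr => q _ /=; ring.
Qed.

(** The partial sum over [J] is the best approximation with frequencies in [J], so it is at least as
    good as a dense trigonometric polynomial once [J] contains its frequencies. As [J] may be
    asymmetric the sum is complex, and its imaginary part counts as error. *)
Theorem fourier_L2_cvg f : M2 0 tau f -> forall e : R, 0 < e ->
  exists J0 : seq int, forall J, uniq J -> {subset J0 <= J} ->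
    \int[mu]_(t in `[0, tau])
      ((f t - tre omega (fourier_list f J) t) ^+ 2 +
       tim omega (fourier_list f J) t ^+ 2) <= e.
Proof.
move=> hf e e0; have [p [[l [pl l0]] hp]] := tapprox_M2 tau0 omtau hf e0.
exists [seq q.1.1 | q <- l] => J uJ hJ.
set u := tre _ (fourier_list f J); set v := tim _ (fourier_list f J).
pose w := fourier_list f J ++ topp l.
have wre t : tre omega w t = u t - p t.
  by rewrite tre_cat tre_opp pl.
have wim t : tim omega w t = v t.
  by rewrite tim_cat tim_opp l0 oppr0 addr0.
have hu : M2 0 tau u by exact: tre_M2.
have hv : M2 0 tau v by exact: tim_M2.
have hw1 : M2 0 tau (tre omega w) by exact: tre_M2.
have hw2 : M2 0 tau (tim omega w) by exact: tim_M2.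
have hp2 : M2 0 tau p.
  by rewrite (_ : p = tre omega l); [exact: tre_M2|exact/funext].
have orth : \int[mu]_(t in `[0, tau])
    ((f t - u t) * tre omega w t - v t * tim omega w t) = 0.
  apply: fourier_residual_orth => // q; rewrite mem_cat => /orP[] /mapP[].
    by move=> m mJ -> /=.
  by move=> q' q'l -> /=; apply: hJ; apply/mapP; exists q'.
have hfu := M2B hf hu.
have i1 : L1 0 tau (fun t => (f t - u t) ^+ 2 + v t ^+ 2).
  by apply: L1D; [exact: hfu.2|exact: hv.2].
have i2 : L1 0 tau (fun t => (f t - u t) * tre omega w t - v t * tim omega w t).
  by apply: L1B; exact: M2_mul.
(* Adding twice the vanishing inner product makes the comparison with [(f - p) ^ 2] hold
   pointwise. *)
have := intD i1 (L1Z 2 i2); rewrite intZ // orth mulr0 addr0 => <-.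
apply: le_trans hp; apply: int_le; first by apply: L1D => //; exact: L1Z.
  exact: (M2B hf hp2).2.
move=> t _; rewrite wre wim.
have := sqr_ge0 (u t - p t); nra.
Qed.

End Fourier.

(** * Boundedness and time averages *)

Section ScalarAverages.
Variables (R : realType) (omega tau : R).
Notation mu := (@lebesgue_measure R).
Hypothesis tau0 : 0 < tau.
Hypothesis omtau : omega * tau = pi *+ 2.

Lemma nat_block (t : R) : 0 <= t -> exists N s, 0 <= s <= tau /\ t = s + N%:R * tau.
Proof.
move=> t0; have tt : 0 <= t / tau by rewrite divr_ge0 // ltW.
exists (Num.truncn (t / tau)), (t - (Num.truncn (t / tau))%:R * tau).
split; last by rewrite subrK.
have /andP[h1 h2] := truncn_itv tt; move: h1 h2.
set N := Num.truncn _; rewrite ler_pdivlMr // ltr_pdivrMr // -natr1 mulrDl mul1r.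
by move=> h1 h2; apply/andP; split; lra.
Qed.

Lemma bounded_of_contraction (G : R -> R) K0 : 0 <= K0 ->
  (forall s, 0 <= s <= tau -> `|G s| <= K0) ->
  (forall t, 0 <= t -> `|G (t + tau)| <= `|G t|) ->
  forall t, 0 <= t -> `|G t| <= K0.
Proof.
move=> K00 h0 hG t /nat_block [N [s [hs ->]]]; have /andP[s0 _] := hs.
elim: N => [|N IH]; first by rewrite mul0r addr0 h0.
rewrite -natr1 mulrDl mul1r addrA; apply: le_trans (hG _ _) IH.
by rewrite addr_ge0 // mulr_ge0 // ltW.
Qed.

(** The constant comes from [x <= expR x] at [x = - c t / k.+1], raised to the power [k.+1]. *)
Lemma pow_exp_bounded (c : R) k : c < 0 ->
  exists C, 0 <= C /\ forall t, 0 <= t -> t ^+ k * expR (c * t) <= C.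
Proof.
move=> c0; case: k => [|k].
  exists 1; split => // t t0; rewrite expr0 mul1r -expR0 ler_expR.
  by rewrite nmulr_rle0.
have k0 : 0 < k.+1%:R :> R by rewrite ltr0n.
exists ((k.+1%:R / - c) ^+ k.+1); split => [|t t0].
  by rewrite exprn_ge0 // divr_ge0 ?oppr_ge0 ?ltW.
have h : t <= k.+1%:R / - c * expR (- c * t / k.+1%:R).
  have : - c * t / k.+1%:R <= expR (- c * t / k.+1%:R).
    by apply: le_trans (expR_ge1Dx _); rewrite lerDr.
  rewrite ler_pdivrMr // => hx.
  by rewrite mulrAC ler_pdivlMr ?oppr_gt0 // mulrC (mulrC k.+1%:R).
have h2 : t ^+ k.+1 <= (k.+1%:R / - c) ^+ k.+1 * expR (- c * t).
  have -> : expR (- c * t) = expR (- c * t / k.+1%:R) ^+ k.+1.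
    by rewrite -expRM_natl [X in _ = expR X]mulrC divfK // gt_eqF.
  by rewrite -exprMn lerXn2r ?nnegrE // (le_trans t0).
apply: le_trans (ler_wpM2r (expR_ge0 _) h2) _.
by rewrite -mulrA -expRD mulNr addNr expR0 mulr1.
Qed.

Lemma cos_eq1_int (x : R) : cos x = 1 -> exists m : int, x = m%:~R * (pi *+ 2).
Proof.
move=> cx; have pi2 : 0 < pi *+ 2 :> R by rewrite pmulrn_lgt0 // pi_gt0.
exists (Num.floor (x / (pi *+ 2))); set m := Num.floor _.
have /andP[h1 h2] := floor_itv (x / (pi *+ 2)); rewrite -/m in h1 h2.
rewrite ler_pdivlMr // in h1; rewrite ltr_pdivrMr // intrD mulrDl mul1r in h2.
set y := x - m%:~R * (pi *+ 2).
have y0 : 0 <= y by rewrite subr_ge0.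
have y2 : y < pi *+ 2 by rewrite ltrBlDl.
have cy : cos y = 1.
  have [c1 s0] := cos_sin_2pi_int R m.
  by rewrite /y cosB c1 s0 mulr1 mulr0 addr0.
have pi0 := pi_gt0 R; have pi0' := pi_ge0 R.
have in0 : (0 : R) \in `[0, pi] by rewrite in_itv /= lexx.
apply/eqP; rewrite -subr_eq0 -/y; apply/eqP; case: (leP y pi) => hy.
  by apply: (cos_inj _ in0); rewrite ?in_itv /= ?y0 // cy cos0.
have h : pi *+ 2 - y = 0.
  apply: (cos_inj _ in0).
    by rewrite in_itv /= mulr2n; apply/andP; split; rewrite mulr2n in y2; lra.
  by rewrite cosB cos2pi sin2pi cy cos0; ring.
by move: y2; rewrite -subr_gt0 h ltxx.
Qed.

Section OneFunction.
Variable p : R -> R.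
Hypothesis pper : forall t, p (t + tau) = p t.
Hypothesis pL1 : L1 0 tau p.

Let mp := periodic_measurable tau0 pper (L1_measurable pL1).
Let pL1ab a b : L1 a b p := periodic_L1 tau0 pper pL1 a b.

Lemma L1_mulc a b (w : R -> R) : continuous w -> L1 a b (fun t => w t * p t).
Proof.
move=> cw; have cw' : {within `[a, b], continuous w} by exact: continuous_subspaceT.
have [K [_ hK]] := within_continuous_bounded cw'.
apply: L1_ext (L1M (pL1ab a b) (within_continuous_measurable cw') hK) => t _.
exact: mulrC.
Qed.

(** The dominating integral satisfies [J (t + tau) = J tau + z * J t] with [z = expR (a * tau) < 1];
    the fixed point [J tau / (1 - z)] of this recursion bounds it. *)
Lemma decaying_int_bounded (a C : R) (w : R -> R) : a < 0 -> continuous w ->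
  0 <= C -> (forall t, 0 <= t -> `|w t| <= C * expR (a * t)) ->
  exists K, forall t, 0 <= t -> `|\int[mu]_(s in `[0, t]) (w s * p s)| <= K.
Proof.
move=> a0 cw C0 hw.
have ce : continuous (fun t => expR (a * t)).
  move=> t; apply: (@continuous_comp _ _ _ (fun s => a * s) expR).
    exact: lin_continuous.
  exact: continuous_expR.
pose h s := expR (a * s) * `|p s|.
have hL1 x y : L1 x y h.
  apply: L1_ext (L1_abs (L1_mulc x y ce)) => s _.
  by rewrite normrM ger0_norm ?expR_ge0.
have h0 s : 0 <= h s by rewrite mulr_ge0 // expR_ge0.
pose J t := \int[mu]_(s in `[0, t]) h s.
have mh : measurable_fun [set: R] h.
  apply: measurable_funM; first exact: measurable_realfun.continuous_measurable_fun.
  exact: measurableT_comp.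
have Jshift t : 0 <= t -> J (t + tau) = J tau + expR (a * tau) * J t.
  move=> t0; rewrite /J (int_split (b := tau)) ?(ltW tau0) ?lerDr //.
  congr (_ + _); rewrite -{1}[tau]add0r int_shift // -intZ //.
  apply: int_ext => s _; rewrite /h mulrDr expRD pper; ring.
have z1 : expR (a * tau) < 1 by rewrite -expR0 ltr_expR nmulr_rlt0.
have z0 : 0 <= expR (a * tau) by exact: expR_ge0.
set z := expR (a * tau) in Jshift z1 z0.
have J0 t : 0 <= J t by apply: int_ge0.
have z1' : 0 < 1 - z by rewrite subr_gt0.
have KE : J tau / (1 - z) = J tau + z * (J tau / (1 - z)).
  by field; rewrite gt_eqF.
have Jle : forall t, 0 <= t -> J t <= J tau / (1 - z).
  move=> t /nat_block [N [s [/andP[s0 st] ->]]].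
  elim: N => [|N IH].
    rewrite mul0r addr0; apply: (@le_trans _ _ (J tau)).
      by rewrite /J (int_split s0 st) // lerDl int_ge0.
    by rewrite ler_pdivlMr // ler_piMr // gerBl.
  rewrite -natr1 mulrDl mul1r addrA Jshift ?addr_ge0 ?mulr_ge0 ?(ltW tau0) //.
  by rewrite KE lerD2l ler_wpM2l.
exists (C * (J tau / (1 - z))) => t t0.
apply: le_trans (ler_wpM2l C0 (Jle t t0)); rewrite /J -intZ //.
apply: int_abs; [exact: L1_mulc|exact: L1Z|].
move=> s /andP[s0 _]; rewrite normrM mulrA ler_wpM2r // hw //.
Qed.

(* For [z = exp (i b tau)]: if [z <> 1] the partial integrals [J] satisfy
   [J (t + tau) - w = z (J t - w)] with [w = J tau / (1 - z)]; if [z = 1],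
   [J t - t J tau / tau] is periodic. *)
Lemma oscillating_int_bounded (b : R) :
  let Jc t := \int[mu]_(s in `[0, t]) (cos (b * s) * p s) in
  let Js t := \int[mu]_(s in `[0, t]) (sin (b * s) * p s) in
  let res := `[< exists m : int, b = m%:~R * omega >] in
  exists K, forall t, 0 <= t ->
    `|Jc t - t * (if res then tau^-1 * Jc tau else 0)| <= K /\
    `|Js t - t * (if res then tau^-1 * Js tau else 0)| <= K.
Proof.
move=> Jc Js res.
have Lc x y : L1 x y (fun s => cos (b * s) * p s).
  by apply: L1_mulc; exact: cos_lin_continuous.
have Ls x y : L1 x y (fun s => sin (b * s) * p s).
  by apply: L1_mulc; exact: sin_lin_continuous.
have mc : measurable_fun [set: R] (fun s => cos (b * s) * p s).
  apply: measurable_funM => //; apply: measurable_realfun.continuous_measurable_fun.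
  exact: cos_lin_continuous.
have ms : measurable_fun [set: R] (fun s => sin (b * s) * p s).
  apply: measurable_funM => //; apply: measurable_realfun.continuous_measurable_fun.
  exact: sin_lin_continuous.
set cz := cos (b * tau); set sz := sin (b * tau).
have Jcs t : 0 <= t -> Jc (t + tau) = Jc tau + (cz * Jc t - sz * Js t).
  move=> t0; rewrite /Jc (int_split (b := tau)) ?(ltW tau0) ?lerDr //.
  congr (_ + _); rewrite -{1}[tau]add0r int_shift // -!intZ // -intB; try exact: L1Z.
  by apply: int_ext => s _; rewrite mulrDr cosD pper /cz /sz; ring.
have Jss t : 0 <= t -> Js (t + tau) = Js tau + (sz * Jc t + cz * Js t).
  move=> t0; rewrite /Js (int_split (b := tau)) ?(ltW tau0) ?lerDr //.
  congr (_ + _); rewrite -{1}[tau]add0r int_shift // -!intZ // -intD; try exact: L1Z.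
  by apply: int_ext => s _; rewrite mulrDr sinD pper /cz /sz; ring.
pose K1 := \int[mu]_(s in `[0, tau]) `|p s|.
have K10 : 0 <= K1 by apply: int_ge0.
have Jb w : (forall s, `|w s| <= 1) -> (forall x y, L1 x y (fun s => w s * p s)) ->
    forall t, 0 <= t <= tau -> `|\int[mu]_(s in `[0, t]) (w s * p s)| <= K1.
  move=> w1 Lw t /andP[t0 tt].
  apply: le_trans (int_abs (Lw _ _) (L1_abs (pL1ab 0 t)) _) _.
    by move=> s _; rewrite normrM ler_piMl.
  by rewrite /K1 (int_split t0 tt) ?L1_abs // lerDl int_ge0.
have Jcb := Jb (fun s => cos (b * s)) (fun s => cos_max _) Lc.
have Jsb := Jb (fun s => sin (b * s)) (fun s => sin_max _) Ls.
have tt : 0 <= tau <= tau by rewrite lexx ltW.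
have cs1 : cz ^+ 2 + sz ^+ 2 = 1 by exact: cos2Dsin2.
case: (boolP res) => [/asboolP[m bm]|/asboolPn nres].
  have [c1 s0] : cz = 1 /\ sz = 0.
    rewrite /cz /sz bm -mulrA omtau; exact: cos_sin_2pi_int.
  exists (K1 + K1) => t t0.
  have bnd J : (forall t, 0 <= t <= tau -> `|J t| <= K1) ->
      (forall t, 0 <= t -> J (t + tau) = J tau + J t) ->
      `|J t - t * (tau^-1 * J tau)| <= K1 + K1.
    move=> hJ hJ2; apply: (@bounded_of_contraction
        (fun t => J t - t * (tau^-1 * J tau)) (K1 + K1)) => //.
    - exact: addr_ge0.
    - move=> s hs; apply: le_trans (ler_normB _ _) _; apply: lerD; first exact: hJ.
      have /andP[s0' st] := hs.
      rewrite mulrA normrM ger0_norm ?divr_ge0 ?(ltW tau0) //.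
      apply: le_trans (hJ tau tt); rewrite ler_piMl // ler_pdivrMr // mul1r //.
    - move=> s s0'; rewrite hJ2 // mulrDl [tau * _]mulrA mulfV ?gt_eqF //.
      by rewrite mul1r le_eqVlt; apply/orP; left; apply/eqP; congr (`|_|); ring.
  split; apply: bnd => //.
    by move=> s s0'; rewrite Jcs // c1 s0; ring.
  by move=> s s0'; rewrite Jss // c1 s0; ring.
pose d := (1 - cz) ^+ 2 + sz ^+ 2.
have d0 : d != 0.
  apply/eqP => d0; apply: nres.
  have : cz = 1.
    apply/eqP; rewrite -subr_eq0 -oppr_eq0 opprB -sqrf_eq0 eq_le sqr_ge0 andbT.
    by have := sqr_ge0 sz; move: d0; rewrite /d; lra.
  move=> /cos_eq1_int[m hm]; exists m; apply: (mulIf (lt0r_neq0 tau0)).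
  by rewrite hm -mulrA omtau.
pose wc := ((1 - cz) * Jc tau - sz * Js tau) / d.
pose ws := (sz * Jc tau + (1 - cz) * Js tau) / d.
have w1 : Jc tau = (1 - cz) * wc + sz * ws by rewrite /wc /ws /d in d0 *; field.
have w2 : Js tau = (1 - cz) * ws - sz * wc by rewrite /wc /ws /d in d0 *; field.
pose G t := (Jc t - wc) ^+ 2 + (Js t - ws) ^+ 2.
pose K2 := (K1 + `|wc|) ^+ 2 + (K1 + `|ws|) ^+ 2.
have G0 t : 0 <= G t by rewrite addr_ge0 // sqr_ge0.
have sq (K x w : R) : `|x| <= K -> (x - w) ^+ 2 <= (K + `|w|) ^+ 2.
  move=> xK; rewrite -[leLHS]real_normK ?num_real // lerXn2r ?nnegrE //.
    by rewrite addr_ge0 // (le_trans _ xK).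
  by rewrite (le_trans (ler_normB _ _)) // lerD2r.
have GK t : 0 <= t -> `|G t| <= K2.
  apply: (@bounded_of_contraction G K2).
  - by rewrite addr_ge0 // sqr_ge0.
  - by move=> s hs; rewrite ger0_norm //; apply: lerD; apply: sq; [exact: Jcb|exact: Jsb].
  - move=> s s0; rewrite !ger0_norm // le_eqVlt; apply/orP; left; apply/eqP.
    transitivity ((cz ^+ 2 + sz ^+ 2) * G s); last by rewrite cs1 mul1r.
    by rewrite /G Jcs // Jss // w1 w2; ring.
exists (`|wc| + `|ws| + 1 + K2) => t t0; rewrite !mulr0 !subr0.
have hG : G t <= K2 by rewrite -[G t]ger0_norm // GK.
rewrite /G in hG.
have nc := ler_normD (Jc t - wc) wc; rewrite subrK in nc.
have ns := ler_normD (Js t - ws) ws; rewrite subrK in ns.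
have q1 := sqr_ge0 (Jc t - wc); have q2 := sqr_ge0 (Js t - ws).
have x1 (x : R) : `|x| <= 1 + x ^+ 2.
  rewrite -[x ^+ 2]real_normK ?num_real //.
  by have := sqr_ge0 (`|x| - 2^-1); rewrite !expr2; lra.
have := x1 (Jc t - wc); have := x1 (Js t - ws).
have := normr_ge0 wc; have := normr_ge0 ws.
by move=> *; split; lra.
Qed.

End OneFunction.
End ScalarAverages.

(** This norm is submultiplicative and passes through integrals entry by entry; it is comparable
    with [enorm], into which the final estimate is converted. *)
Definition n1 (R : realType) (m p : nat) (X : 'M[R]_(m, p)) : R :=
  \sum_i \sum_j `|X i j|.

Section EntrywiseNorm.
Variable R : realType.

Lemma n1_ge0 m p (X : 'M[R]_(m, p)) : 0 <= n1 X.
Proof. by apply: sumr_ge0 => i _; apply: sumr_ge0. Qed.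

Lemma entry_le_n1 m p (X : 'M[R]_(m, p)) i j : `|X i j| <= n1 X.
Proof.
rewrite /n1 (bigD1 i) //= (bigD1 j) //= -addrA lerDl addr_ge0 //.
  by apply: sumr_ge0.
by apply: sumr_ge0 => i' _; apply: sumr_ge0.
Qed.

Lemma n1_le m p (X : 'M[R]_(m, p)) K : (forall i j, `|X i j| <= K) ->
  n1 X <= (m * p)%:R * K.
Proof.
move=> h; apply: (@le_trans _ _ (\sum_(i < m) \sum_(j < p) K)).
  by apply: ler_sum => i _; apply: ler_sum => j _.
by rewrite !sumr_const !card_ord -mulrnA mulr_natl mulnC.
Qed.

Lemma enorm_le_n1 m p (X : 'M[R]_(m, p)) : enorm X <= n1 X.
Proof.
rewrite /enorm -[leRHS]ger0_norm ?n1_ge0 // -sqrtr_sqr ler_wsqrtr //.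
rewrite /n1 !pair_bigA /=.
have h (I : Type) (r : seq I) (f : I -> R) : (forall i, 0 <= f i) ->
    \sum_(i <- r) f i ^+ 2 <= (\sum_(i <- r) f i) ^+ 2.
  move=> f0; elim: r => [|i r IH]; first by rewrite !big_nil expr0n.
  rewrite !big_cons; have s0 : 0 <= \sum_(j <- r) f j by apply: sumr_ge0.
  have := mulr_ge0 (f0 i) s0; rewrite sqrrD; lra.
apply: le_trans (h _ _ (fun q => `|X q.1 q.2|) _) => //.
by apply: ler_sum => q _; rewrite real_normK // num_real.
Qed.

Lemma entry_le_enorm m p (X : 'M[R]_(m, p)) i j : `|X i j| <= enorm X.
Proof.
rewrite -sqrtr_sqr /enorm ler_wsqrtr // (bigD1 i) //= (bigD1 j) //= -addrA.
rewrite lerDl addr_ge0 //; first by apply: sumr_ge0 => *; exact: sqr_ge0.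
by apply: sumr_ge0 => *; apply: sumr_ge0 => *; exact: sqr_ge0.
Qed.

Lemma enorm_sq m p (X : 'M[R]_(m, p)) : enorm X ^+ 2 = \sum_i \sum_j X i j ^+ 2.
Proof.
by rewrite sqr_sqrtr //; apply: sumr_ge0 => *; apply: sumr_ge0 => *; exact: sqr_ge0.
Qed.

Lemma mxlin_delta n (f : 'M[R]_n -> 'M[R]_n) X i j : mxlin f ->
  f X i j = \sum_(q : 'I_n * 'I_n) X q.1 q.2 * f (delta_mx q.1 q.2) i j.
Proof.
move=> hf.
have f0 : f 0 = 0.
  by have := hf (-1) 0 0; rewrite scaler0 add0r scaleN1r addNr.
have fsum (I : Type) (r : seq I) (c : I -> R) (Y : I -> 'M[R]_n) :
    f (\sum_(s <- r) c s *: Y s) = \sum_(s <- r) c s *: f (Y s).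
  by elim: r => [|s r IH]; rewrite ?big_nil // !big_cons hf IH.
rewrite {1}[X]matrix_sum_delta pair_bigA /= fsum summxE.
by apply: eq_bigr => q _; rewrite mxE.
Qed.

Lemma mxlin_bound n (f : 'M[R]_n -> 'M[R]_n) : mxlin f ->
  exists C, 0 <= C /\ forall X i j, `|f X i j| <= C * n1 X.
Proof.
move=> hf; exists (\sum_(q : 'I_n * 'I_n) n1 (f (delta_mx q.1 q.2))); split.
  by apply: sumr_ge0 => q _; exact: n1_ge0.
move=> X i j; rewrite mxlin_delta // mulr_suml.
apply: le_trans (ler_norm_sum _ _ _) _; apply: ler_sum => q _.
by rewrite normrM mulrC ler_pM // entry_le_n1.
Qed.

End EntrywiseNorm.

Section LebesgueAE.
Variable R : realType.
Notation mu := (@lebesgue_measure R).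
Implicit Types G H : R -> Prop.

Lemma aeS G H : (forall t, G t -> H t) -> {ae mu, forall t, G t} ->
  {ae mu, forall t, H t}.
Proof. by apply: filterS; exact: (ae_filter_ringOfSetsType mu). Qed.

Lemma aeI G H : {ae mu, forall t, G t} -> {ae mu, forall t, H t} ->
  {ae mu, forall t, G t /\ H t}.
Proof. by apply: filterI; exact: (ae_filter_ringOfSetsType mu). Qed.

Lemma ae_fin (I : finType) (G : I -> R -> Prop) :
  (forall i, {ae mu, forall t, G i t}) -> {ae mu, forall t, forall i, G i t}.
Proof.
move=> hG.
have h (r : seq I) : {ae mu, forall t, forall i, i \in r -> G i t}.
  elim: r => [|i r IH]; first by apply: aeW.
  apply: aeS (aeI (hG i) IH) => t [h1 h2] j; rewrite inE => /predU1P[->//|].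
  exact: h2.
by apply: aeS (h (enum I)) => t ht i; apply: ht; rewrite mem_enum.
Qed.

End LebesgueAE.

Section PeriodicAE.
Variables (R : realType) (tau : R).
Notation mu := (@lebesgue_measure R).
Hypothesis tau0 : 0 < tau.

Lemma ae_shift (c : R) (G : R -> Prop) : {ae mu, forall t, G t} ->
  {ae mu, forall t, G (t + c)}.
Proof.
move=> [N [mN N0 hN]]; exists ((fun t : R => t + c) @^-1` N); split.
- rewrite -[_ @^-1` _]setTI; exact: (measurable_shift c).
- by rewrite -N0; exact: lebesgue_measure_shift.
- by move=> t /= ht; apply: hN.
Qed.

(** The exceptional set is covered by countably many translates of a null set. *)
Lemma periodic_ae (G : R -> Prop) : (forall t, G (t + tau) <-> G t) ->
  {ae mu, forall t, 0 <= t <= tau -> G t} -> {ae mu, forall t, G t}.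
Proof.
move=> Gper hG.
have GD k t : G (t + k%:R * tau) <-> G t.
  elim: k t => [|k IH] t; first by rewrite mul0r addr0.
  by rewrite -natr1 mulrDl mul1r addrA Gper.
have h1 : {ae mu, forall t, forall k : nat, 0 <= t + k%:R * tau <= tau -> G t}.
  apply/ae_foralln => k; apply: aeS (ae_shift (k%:R * tau) hG).
  by move=> t h /h /GD.
have h2 : {ae mu, forall t, forall k : nat, 0 <= t - k%:R * tau <= tau -> G t}.
  apply/ae_foralln => k; apply: aeS (ae_shift (- (k%:R * tau)) hG).
  by move=> t h /h; rewrite -(GD k (t - _)) subrK.
apply: aeS (aeI h1 h2) => t [g1 g2]; case: (leP 0 t) => t0.
  have [N [s [hs ts]]] := nat_block tau0 t0.
  by apply: (g2 N); rewrite ts addrK.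
have t0' : 0 <= - t by rewrite oppr_ge0 ltW.
have [N [s [/andP[s0 st] ts]]] := nat_block tau0 t0'.
apply: (g1 N.+1); have -> : t = - (s + N%:R * tau) by rewrite -ts opprK.
by rewrite -natr1 mulrDl mul1r; apply/andP; split; lra.
Qed.

End PeriodicAE.

(** * Regularity of the conjugated coefficient and its primitive along periods *)

Section ConjFlow.
Variables (R : realType) (n : nat) (A : 'M[R]_n) (P : R -> 'M[R]_n) (tau : R).
Notation mu := (@lebesgue_measure R).
Hypothesis tau0 : 0 < tau.
Hypothesis Pper : forall t, P (t + tau) = P t.
Hypothesis PL2 : mx_square_integrable 0 tau P.
Local Notation M t := (mxexp (t *: A)).
Local Notation Q := (conj_flow A P).

Lemma mxexp_entry_continuous i j : continuous (fun t : R => M t i j).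
Proof.
move=> t; apply: differentiable_continuous; apply/derivable1_diffP.
by have [] := mxexp_derive A t i j.
Qed.

Lemma mxexpN_entry_continuous i j : continuous (fun t : R => mxexp (- t *: A) i j).
Proof.
move=> t; apply: differentiable_continuous; apply/derivable1_diffP.
by have [] := mxexpN_derive A t i j.
Qed.

Lemma M2_mulc a b (w f : R -> R) : continuous w -> M2 a b f ->
  M2 a b (fun t => w t * f t).
Proof.
move=> cw [mf if2]; have cw' : {within `[a, b], continuous w} by exact: continuous_subspaceT.
have [K [K0 hK]] := within_continuous_bounded cw'.
have mw := within_continuous_measurable cw'.
split; first exact: measurable_funM.
apply: L1_ext (L1M (K := K ^+ 2) if2 (measurable_funX 2 mw) _).
  by move=> x _; rewrite exprMn mulrC.
by move=> x hx; rewrite normrX lerXn2r ?nnegrE // hK.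
Qed.

Lemma P_entry_measurable i j : measurable_fun [set: R] (fun t => P t i j).
Proof.
by apply: (periodic_measurable tau0 _ (PL2.1 i j)) => t; rewrite Pper.
Qed.

Lemma P_entry_M2 a b i j : M2 a b (fun t => P t i j).
Proof.
split; first exact: measurable_funTS (P_entry_measurable i j).
by apply: (periodic_L1 tau0 _ (PL2.2 i j)) => t; rewrite Pper.
Qed.

Lemma Q_entryE t i j : Q t i j = \sum_k \sum_l
  (mxexp (- t *: A) i l * M t k j) * P t l k.
Proof.
rewrite /conj_flow mxE; apply: eq_bigr => k _; rewrite mxE mulr_suml.
by apply: eq_bigr => l _; rewrite mulrAC.
Qed.

Lemma Q_weight_continuous i j l k : continuous
  (fun t : R => mxexp (- t *: A) i l * M t k j).
Proof.
by move=> t; apply: cvgM; [exact: mxexpN_entry_continuous|exact: mxexp_entry_continuous].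
Qed.

Lemma M2_sum_gen a b (I : Type) (r : seq I) (F : I -> R -> R) :
  (forall i, M2 a b (F i)) -> M2 a b (fun x => \sum_(i <- r) F i x).
Proof.
move=> hF; elim: r => [|i r IH].
  rewrite (_ : (fun _ => _) = fun=> 0); first exact: M2_cst.
  by apply/funext => x; rewrite big_nil.
rewrite (_ : (fun _ => _) = fun x => F i x + \sum_(j <- r) F j x).
  exact: M2D.
by apply/funext => x; rewrite big_cons.
Qed.

Lemma Q_entry_M2 a b i j : M2 a b (fun t => Q t i j).
Proof.
rewrite (_ : (fun _ => _) = (fun t => \sum_k \sum_l
  (mxexp (- t *: A) i l * M t k j) * P t l k)).
  apply: M2_sum_gen => k; apply: M2_sum_gen => l.
  by apply: M2_mulc (P_entry_M2 _ _ _ _); exact: Q_weight_continuous.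
by apply/funext => t; rewrite Q_entryE.
Qed.

Lemma Q_entry_measurable i j : measurable_fun [set: R] (fun t => Q t i j).
Proof.
rewrite (_ : (fun _ => _) = (fun t => \sum_k \sum_l
  (mxexp (- t *: A) i l * M t k j) * P t l k)); last first.
  by apply/funext => t; rewrite Q_entryE.
apply: measurable_sum => k; apply: measurable_sum => l.
apply: measurable_funM; last exact: P_entry_measurable.
apply: measurable_realfun.continuous_measurable_fun; exact: Q_weight_continuous.
Qed.

Lemma Q_shift N t : Q (t + N%:R * tau) =
  mxexp (- (N%:R * tau) *: A) *m Q t *m M (N%:R * tau).
Proof.
have -> : Q (t + N%:R * tau) = mxexp (- (t + N%:R * tau) *: A) *m P t *m M (t + N%:R * tau).
  rewrite /conj_flow; congr (_ *m _ *m _).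
  elim: N => [|N IH]; first by rewrite mul0r addr0.
  by rewrite -natr1 mulrDl mul1r addrA Pper.
have -> : - (t + N%:R * tau) = - (N%:R * tau) + - t by rewrite opprD addrC.
by rewrite /conj_flow !mxexpD !mulmxA.
Qed.

Definition prim_Q T := mx_integral 0 T Q.

Lemma mx_integral_conj a b (C D : 'M[R]_n) (G : R -> 'M[R]_n) :
  mx_integrable a b G ->
  mx_integral a b (fun t => C *m G t *m D) = C *m mx_integral a b G *m D.
Proof.
move=> hG; apply/matrixP => i j; rewrite [LHS]mxE [RHS]mxE.
transitivity (\int[mu]_(t in `[a, b]) \sum_k \sum_l (C i l * D k j) * G t l k).
  apply: int_ext => t _; rewrite mxE; apply: eq_bigr => k _; rewrite mxE mulr_suml.
  by apply: eq_bigr => l _; rewrite mulrAC.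
rewrite int_sum => [|k _]; last by apply: L1_sum => l _; apply: L1Z; exact: hG.
apply: eq_bigr => k _; rewrite int_sum => [|l _]; last by apply: L1Z; exact: hG.
rewrite [X in _ = X * _]mxE mulr_suml; apply: eq_bigr => l _.
rewrite intZ; last exact: hG.
by rewrite [mx_integral a b G l k]mxE mulrAC.
Qed.

Lemma prim_Q_shift N T : 0 <= T ->
  mxexp (- (N%:R * tau) *: A) *m prim_Q T *m M (N%:R * tau) =
  prim_Q (T + N%:R * tau) - prim_Q (N%:R * tau).
Proof.
move=> T0; rewrite -mx_integral_conj; last first.
  by move=> i j; exact: (M2_L1 (Q_entry_M2 _ _ _ _)).
apply/matrixP => i j; rewrite !mxE.
have Nt : 0 <= N%:R * tau by rewrite mulr_ge0 // ltW.
rewrite (int_split (b := N%:R * tau) (c := T + _)) ?lerDr //; last first.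
  exact: (M2_L1 (Q_entry_M2 _ _ _ _)).
have E := int_shift 0 T (N%:R * tau) (Q_entry_measurable i j).
rewrite add0r in E; rewrite addrC addKr E.
by apply: int_ext => t _; rewrite Q_shift.
Qed.

(** The conjugate is the increment of [prim_Q] from [N tau] to [T + N tau]. Both values are [S *: B]
    up to [o (S)], and the linear parts cancel except for [T *: B]. *)
Lemma prim_Q_slow_of_average B T : is_time_average Q B -> 0 <= T <= tau ->
  power_slow A tau (prim_Q T).
Proof.
move=> hB /andP[T0 Tt] i j e e0.
(* Budget: accuracy [e / (4 tau)] costs [N e / 4] at [N tau] and at most [(N + 1) e / 4] at
   [T + N tau]; [N0] makes [tau * b <= N e / 4] and [T1 < N tau]. *)
have d0 : 0 < e / (4 * tau) by rewrite divr_gt0 // mulr_gt0.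
have := hB i j; move/cvgrPdist_le => /(_ _ d0) [T1 [_ hT1]].
pose b := `|B i j|.
pose N0 := (Num.bound `|T1 / tau| + Num.bound (4 * tau * b / e) + 1)%N.
have I1 S : T1 < S -> 0 < S -> `|prim_Q S i j - S * B i j| <= e / (4 * tau) * S.
  move=> h1 S0; have := hT1 S h1; rewrite mxE -/(prim_Q S) => h.
  have -> : prim_Q S i j - S * B i j = - (S * (B i j - S^-1 * prim_Q S i j)).
    by rewrite mulrBr mulVKf ?gt_eqF // opprB.
  by rewrite normrN normrM gtr0_norm // mulrC ler_wpM2r // ltW.
exists N0 => N N0N; rewrite prim_Q_shift // [X in `|X|]mxE [X in _ + X]mxE.
have NR : N0%:R <= N%:R :> R by rewrite ler_nat.
have N1 : 1 <= N%:R :> R by rewrite ler1n (leq_trans _ N0N) // /N0 addn1.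
have NT : T1 < N%:R * tau.
  rewrite -ltr_pdivrMr //; apply: lt_le_trans NR.
  apply: (@lt_le_trans _ _ (Num.bound `|T1 / tau|)%:R).
    by apply: le_lt_trans (ler_norm _) _; apply: archi_boundP.
  by rewrite ler_nat /N0 -addnA leq_addr.
have Nb : 4 * tau * b <= N%:R * e.
  rewrite -ler_pdivrMr //; apply: le_trans NR; apply: ltW.
  apply: (@lt_le_trans _ _ (Num.bound (4 * tau * b / e))%:R).
    by apply: archi_boundP; rewrite divr_ge0 ?(ltW e0) // !mulr_ge0 ?(ltW tau0) ?normr_ge0.
  by rewrite ler_nat /N0 addnAC leq_addl.
have Nt : 0 < N%:R * tau by rewrite mulr_gt0 // (lt_le_trans ltr01).
have J1 := I1 _ NT Nt.
have J2 : `|prim_Q (T + N%:R * tau) i j - (T + N%:R * tau) * B i j| <=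
    e / (4 * tau) * (T + N%:R * tau).
  by apply: I1; lra.
have dE : e / (4 * tau) * tau = e / 4.
  by field; rewrite gt_eqF.
have J1' : `|prim_Q (N%:R * tau) i j - N%:R * tau * B i j| <= N%:R * (e / 4).
  by apply: le_trans J1 _; rewrite mulrCA dE.
have J2' : `|prim_Q (T + N%:R * tau) i j - (T + N%:R * tau) * B i j| <=
    e / 4 + N%:R * (e / 4).
  apply: le_trans J2 _; rewrite mulrDr [in X in _ + X]mulrCA dE lerD2r -dE.
  by rewrite ler_wpM2l // ltW.
have bT : `|T * B i j| <= tau * b by rewrite normrM ger0_norm // ler_wpM2r.
have e4 : e / 4 <= N%:R * (e / 4) by rewrite ler_peMl // divr_ge0 // ltW.
have b4 : tau * b <= N%:R * (e / 4) by lra.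
have -> : prim_Q (T + N%:R * tau) i j - prim_Q (N%:R * tau) i j =
  (prim_Q (T + N%:R * tau) i j - (T + N%:R * tau) * B i j) -
  (prim_Q (N%:R * tau) i j - N%:R * tau * B i j) + T * B i j by ring.
apply: le_trans (ler_normD _ _) _; apply: le_trans (lerD (ler_normB _ _) bT) _.
by lra.
Qed.

End ConjFlow.

(** * Disappearance of the growing terms *)

Section Growth.
Variables (R : realType) (n : nat) (A : 'M[R]_n) (P : R -> 'M[R]_n) (tau : R).
Notation mu := (@lebesgue_measure R).
Hypothesis tau0 : 0 < tau.
Hypothesis Pper : forall t, P (t + tau) = P t.
Hypothesis PL2 : mx_square_integrable 0 tau P.
Local Notation M t := (mxexp (t *: A)).
Local Notation Q := (conj_flow A P).

Let QM2 x y i j : M2 x y (fun t => Q t i j).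
Proof. by apply: Q_entry_M2 tau0 Pper PL2 _ _ _ _. Qed.

Lemma power_slow_of_bounded X C (N1 : nat) :
  (forall (N : nat) i j, (N1 <= N)%N ->
    `|(mxexp (- (N%:R * tau) *: A) *m X *m M (N%:R * tau)) i j| <= C) ->
  power_slow A tau X.
Proof.
move=> hC i j e e0; exists (N1 + Num.bound (`|C| / e))%N => N hN.
apply: le_trans (hC N i j (leq_trans (leq_addr _ _) hN)) _.
apply: le_trans (ler_norm C) _; rewrite mulrC -ler_pdivrMr //.
apply: le_trans (ltW (archi_boundP _)) _; first by rewrite divr_ge0 // ltW.
by rewrite ler_nat (leq_trans (leq_addl _ _) hN).
Qed.

Lemma enormQ_L1 a b : L1 a b (fun t => enorm (Q t) ^+ 2).
Proof.
have : L1 a b (fun t => \sum_i \sum_j Q t i j ^+ 2).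
  by apply: L1_sum => i _; apply: L1_sum => j _; exact: (QM2 a b i j).2.
by apply: L1_ext => t _; rewrite enorm_sq.
Qed.

Lemma ge0_L1_integralE a b (f : R -> R) : L1 a b f ->
  (\int[mu]_(t in `[a, b]) (f t)%:E = (\int[mu]_(t in `[a, b]) f t)%:E)%E.
Proof. by move=> hf; rewrite /Rintegral fineK //; exact: integrable_fin_num. Qed.

(** By [|x| <= 1 + x ^ 2] an entry of [Q] integrates to at most [tau + K] over a window of length
    [T <= tau], so the conjugates are even bounded. *)
Lemma prim_Q_slow_of_L2 T : L2_unif_bounded tau Q -> 0 <= T <= tau ->
  power_slow A tau (prim_Q A P T).
Proof.
move=> [K hK] /andP[T0 Tt].
apply: (@power_slow_of_bounded _ (tau + K) 0) => N i j _.
rewrite prim_Q_shift // [X in `|X|]mxE [X in _ + X]mxE.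
have Nt : 0 <= N%:R * tau by rewrite mulr_ge0 // ltW.
have LQ a b : L1 a b (fun t => Q t i j) by exact: (M2_L1 (QM2 _ _ _ _)).
rewrite mxE [X in _ - X]mxE (int_split (b := N%:R * tau) (c := T + _)) ?lerDr //.
rewrite addrC addKr.
have i1 a b := L1D (L1_cst a b 1) (enormQ_L1 a b).
have le1 s : `|Q s i j| <= 1 + enorm (Q s) ^+ 2.
  apply: le_trans (entry_le_enorm (Q s) i j) _.
  by have := sqr_ge0 (enorm (Q s) - 2^-1); rewrite !expr2; lra.
apply: le_trans (int_abs (LQ _ _) (i1 _ _) (fun s _ => le1 s)) _.
apply: (@le_trans _ _ (\int[mu]_(s in `[N%:R * tau, N%:R * tau + tau]) (1 + enorm (Q s) ^+ 2))).
  rewrite (int_split (b := T + N%:R * tau) (c := N%:R * tau + tau)) ?lerDr //.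
    by rewrite lerDl int_ge0 // => s _; rewrite addr_ge0 // sqr_ge0.
  by rewrite addrC lerD2l.
rewrite intD; [|exact: L1_cst|exact: enormQ_L1].
rewrite int_cst ?lerDl ?(ltW tau0) // mul1r.
have -> : N%:R * tau + tau - N%:R * tau = tau by ring.
rewrite lerD2l.
by rewrite -lee_fin -ge0_L1_integralE; [exact: hK|exact: enormQ_L1].
Qed.

Variables (I : finType) (a b : I -> R) (k : I -> nat) (Zc Zs : I -> 'M[R]_n -> 'M[R]_n).
Hypothesis NF : is_normal_form A a b k Zc Zs.
Hypothesis slowNF : forall X, power_slow A tau X -> forall s,
  0 < a s \/ (a s = 0 /\ k s <> 0%N) -> Zc s X = 0 /\ Zs s X = 0.

Definition growing_index s := (0 < a s) || ((a s == 0) && (k s != 0%N)).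
Definition tame X := forall s, growing_index s -> Zc s X = 0 /\ Zs s X = 0.

Lemma slow_tame X : power_slow A tau X -> tame X.
Proof.
move=> sX s /orP[a0|/andP[/eqP a0 /eqP k0]]; apply: slowNF => //; first by left.
by right.
Qed.

Lemma nongrowingP s : ~~ growing_index s -> a s < 0 \/ (a s = 0 /\ k s = 0%N).
Proof.
rewrite negb_or -leNgt le_eqVlt negb_and negbK => /andP[/orP[/eqP a0|]].
  by rewrite a0 eqxx /= => /eqP; right.
by left.
Qed.

Lemma mxlin_integral (f : 'M[R]_n -> 'M[R]_n) x y i j (G : R -> 'M[R]_n) :
  mxlin f -> mx_integrable x y G ->
  L1 x y (fun t => f (G t) i j) /\
  f (mx_integral x y G) i j = \int[mu]_(t in `[x, y]) f (G t) i j.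
Proof.
move=> hf hG.
have Lt (q : 'I_n * 'I_n) : L1 x y (fun t => f (delta_mx q.1 q.2) i j * G t q.1 q.2).
  by apply: L1Z; exact: hG.
have E t : f (G t) i j = \sum_(q : 'I_n * 'I_n) f (delta_mx q.1 q.2) i j * G t q.1 q.2.
  by rewrite mxlin_delta //; apply: eq_bigr => q _; exact: mulrC.
split.
  apply: L1_ext (L1_sum (index_enum _) (P := xpredT) (fun q _ => Lt q)) => t _.
  by rewrite E.
under [RHS]eq_Rintegral do rewrite E.
rewrite int_sum // mxlin_delta //; apply: eq_bigr => q _.
by rewrite intZ; [rewrite mxE mulrC|exact: hG].
Qed.

(** [Zc s] and [Zs s] are linear, so they commute with the integral: their entries along [Q] have a
    vanishing primitive. Finitely many null sets are collected. *)
Lemma tame_prim_ae : (forall T, 0 <= T <= tau -> tame (prim_Q A P T)) ->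
  {ae mu, forall t, 0 <= t <= tau -> tame (Q t)}.
Proof.
move=> hT.
have linc s : mxlin (Zc s) by have [_ /(_ s) []] := NF.
have lins s : mxlin (Zs s) by have [_ /(_ s) []] := NF.
have LQ x y : mx_integrable x y Q.
  by move=> i j; exact: (M2_L1 (QM2 _ _ _ _)).
have h s i j : {ae mu, forall t, 0 <= t <= tau -> growing_index s ->
    Zc s (Q t) i j = 0 /\ Zs s (Q t) i j = 0}.
  case: (boolP (growing_index s)) => gs; last by apply: aeW.
  have hc := @ae0_of_prim0 _ 0 tau (fun t => Zc s (Q t) i j).
  have hs := @ae0_of_prim0 _ 0 tau (fun t => Zs s (Q t) i j).
  have {}hc := hc (mxlin_integral i j (linc s) (LQ _ _)).1.
  have {}hs := hs (mxlin_integral i j (lins s) (LQ _ _)).1.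
  have {}hc : {ae mu, forall t, 0 <= t <= tau -> Zc s (Q t) i j = 0}.
    apply: hc => t ht; rewrite -(mxlin_integral i j (linc s) (LQ _ _)).2.
    by rewrite (hT t ht s gs).1 mxE.
  have {}hs : {ae mu, forall t, 0 <= t <= tau -> Zs s (Q t) i j = 0}.
    apply: hs => t ht; rewrite -(mxlin_integral i j (lins s) (LQ _ _)).2.
    by rewrite (hT t ht s gs).2 mxE.
  by apply: aeS (aeI hc hs) => t [h1 h2] ht _; split; [exact: h1|exact: h2].
have := ae_fin (fun s => ae_fin (fun i => ae_fin (h s i))).
apply: aeS => t ht tt s gs; split; apply/matrixP => i j; rewrite [RHS]mxE;
  by have [] := ht s i j tt gs.
Qed.

Lemma weight_bounded s : ~~ growing_index s ->
  exists C, 0 <= C /\ forall t, 0 <= t -> t ^+ k s * expR (a s * t) <= C.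
Proof.
move=> /nongrowingP[a0|[-> ->]]; first exact: pow_exp_bounded.
by exists 1; split => // t _; rewrite expr0 mul0r expR0 mulr1.
Qed.

Lemma tame_flow_bounded : exists C, 0 <= C /\ forall X, tame X -> forall t, 0 <= t ->
  forall i j, `|(mxexp (- t *: A) *m X *m M t) i j| <= C * n1 X.
Proof.
have [_ lin nf] := NF.
have hs s : exists C, 0 <= C /\ forall X, tame X -> forall t, 0 <= t -> forall i j,
    `|((t ^+ k s * expR (a s * t) * cos (b s * t)) *: Zc s X +
       (t ^+ k s * expR (a s * t) * sin (b s * t)) *: Zs s X) i j| <= C * n1 X.
  case: (boolP (growing_index s)) => gs.
    exists 0; split => // X tX t _ i j; have [-> ->] := tX s gs.
    by rewrite !scaler0 addr0 mxE normr0 mul0r.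
  have [C [C0 hC]] := weight_bounded gs.
  have [Kc [Kc0 hKc]] := mxlin_bound (lin s).1.
  have [Ks [Ks0 hKs]] := mxlin_bound (lin s).2.
  exists (C * (Kc + Ks)); split => [|X _ t t0 i j].
    by rewrite mulr_ge0 // addr_ge0.
  rewrite mxE [X in `|X + _|]mxE [X in `|_ + X|]mxE.
  have w0 : 0 <= t ^+ k s * expR (a s * t) by rewrite mulr_ge0 ?exprn_ge0 ?expR_ge0.
  apply: le_trans (ler_normD _ _) _; rewrite mulrDr mulrDl.
  have term (c z K : R) : `|c| <= 1 -> `|z| <= K * n1 X ->
      `|t ^+ k s * expR (a s * t) * c * z| <= C * K * n1 X.
    move=> c1 zK; have := hC t t0; move: w0.
    move: (t ^+ k s * expR (a s * t)) => w w0 wC.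
    rewrite 2!normrM (ger0_norm w0) -!mulrA; apply: ler_pM => //.
    by apply: le_trans zK; rewrite ler_piMl.
  by apply: lerD; apply: term => //; [exact: cos_max|exact: sin_max].
pose C s := projT1 (cid (hs s)).
have hC s := projT2 (cid (hs s)).
exists (\sum_s C s); split; first by apply: sumr_ge0 => s _; exact: (hC s).1.
move=> X tX t t0 i j; rewrite nf summxE mulr_suml.
apply: le_trans (ler_norm_sum _ _ _) _; apply: ler_sum => s _.
exact: (hC s).2.
Qed.

(** The flow of [P t] at time [N tau] is the flow of [Q t] at time [N tau - t], bounded as soon as
    [N tau >= t]; boundedness at large multiples of [tau] implies tameness. *)
Lemma tame_P_of_Q t : 0 <= t -> tame (Q t) -> tame (P t).
Proof.
move=> t0 tQ; have [C [C0 hC]] := tame_flow_bounded.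
apply: slow_tame; apply: (@power_slow_of_bounded _ (C * n1 (Q t)) (Num.bound (t / tau))).
move=> N i j hN.
have tN : t <= N%:R * tau.
  rewrite -ler_pdivrMr //; apply: ltW; apply: lt_le_trans (archi_boundP _) _.
    by rewrite divr_ge0 // ltW.
  by rewrite ler_nat.
have u0 : 0 <= N%:R * tau - t by rewrite subr_ge0.
have -> : mxexp (- (N%:R * tau) *: A) *m P t *m M (N%:R * tau) =
    mxexp (- (N%:R * tau - t) *: A) *m Q t *m M (N%:R * tau - t).
  have -> : mxexp (- (N%:R * tau) *: A) =
      mxexp (- (N%:R * tau - t) *: A) *m mxexp (- t *: A).
    by rewrite -mxexpD; congr (mxexp (_ *: A)); ring.
  have -> : M (N%:R * tau) = M t *m M (N%:R * tau - t).
    by rewrite -mxexpD; congr (mxexp (_ *: A)); ring.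
  by rewrite /conj_flow !mulmxA.
exact: hC.
Qed.

Lemma tame_ae : (forall T, 0 <= T <= tau -> tame (prim_Q A P T)) ->
  {ae mu, forall t, tame (P t)}.
Proof.
move=> /tame_prim_ae h; apply: (periodic_ae tau0); first by move=> t; rewrite Pper.
by apply: aeS h => t ht tt; apply: tame_P_of_Q; [by case/andP: tt|exact: ht].
Qed.

End Growth.

(** Absolute continuity in integrated form. [solves T G x] unfolds to
    [primitive T x (fun s => G s (x s))], so solutions can be combined by the rules for
    primitives. *)
Definition primitive (R : realType) (m p : nat) (T : R)
    (U u : R -> 'M[R]_(m, p)) : Prop :=
  mx_integrable 0 T u /\ forall t, 0 <= t <= T -> U t = U 0 + mx_integral 0 t u.

(** * Calculus of absolutely continuous matrix functions *)

Section Primitive.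
Variable R : realType.
Notation mu := (@lebesgue_measure R).

Lemma mx_integralE m p (T : R) (u : R -> 'M[R]_(m, p)) i j :
  mx_integral 0 T u i j = \int[mu]_(t in `[0, T]) u t i j.
Proof. by rewrite mxE. Qed.

Lemma mx_integral_ext m p (T : R) (u v : R -> 'M[R]_(m, p)) :
  (forall t, 0 <= t <= T -> u t = v t) -> mx_integral 0 T u = mx_integral 0 T v.
Proof.
by move=> h; apply/matrixP => i j; rewrite !mxE; apply: int_ext => t /h ->.
Qed.

Lemma mx_integrable_ext m p (T : R) (u v : R -> 'M[R]_(m, p)) :
  (forall t, 0 <= t <= T -> u t = v t) -> mx_integrable 0 T u -> mx_integrable 0 T v.
Proof. by move=> h hu i j; apply: L1_ext (hu i j) => t /h ->. Qed.

Lemma mx_integral0 m p (u : R -> 'M[R]_(m, p)) : mx_integral 0 0 u = 0.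
Proof. by apply/matrixP => i j; rewrite !mxE int0. Qed.

Lemma primitive_ext m p (T : R) (U V u v : R -> 'M[R]_(m, p)) : 0 <= T ->
  (forall t, 0 <= t <= T -> U t = V t) -> (forall t, 0 <= t <= T -> u t = v t) ->
  primitive T U u -> primitive T V v.
Proof.
move=> T0 UV uv [hu hU]; split; first exact: mx_integrable_ext hu.
move=> t ht; have [t0 tT] := andP ht; rewrite -!UV ?lexx // hU //.
congr (_ + _); apply: mx_integral_ext => s /andP[s0 st]; apply: uv.
by rewrite s0 (le_trans st).
Qed.

Lemma primitive_entry m p (T : R) (U u : R -> 'M[R]_(m, p)) i j : primitive T U u ->
  L1 0 T (fun t => u t i j) /\ forall t, 0 <= t <= T ->
  U t i j = U 0 i j + \int[mu]_(s in `[0, t]) u s i j.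
Proof. by move=> [hu hU]; split=> // t /hU ->; rewrite [LHS]mxE mx_integralE. Qed.

Lemma entry_primitive m p (T : R) (U u : R -> 'M[R]_(m, p)) :
  (forall i j, L1 0 T (fun t => u t i j) /\ forall t, 0 <= t <= T ->
     U t i j = U 0 i j + \int[mu]_(s in `[0, t]) u s i j) -> primitive T U u.
Proof.
move=> h; split=> [i j|t ht]; first exact: (h i j).1.
by apply/matrixP => i j; rewrite (h i j).2 // [RHS]mxE mx_integralE.
Qed.

Lemma primitiveM m p q (T : R) (U u : R -> 'M[R]_(m, p)) (V v : R -> 'M[R]_(p, q)) :
  primitive T U u -> primitive T V v ->
  primitive T (fun t => U t *m V t) (fun t => u t *m V t + U t *m v t).
Proof.
move=> hU hV; apply: entry_primitive => i j.
have hp l := prim_mul (primitive_entry i l hU).1 (primitive_entry l j hV).1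
  (primitive_entry i l hU).2 (primitive_entry l j hV).2.
have E t : (u t *m V t + U t *m v t) i j =
    \sum_l (u t i l * V t l j + U t i l * v t l j).
  by rewrite [LHS]mxE [X in X + _]mxE [X in _ + X]mxE -big_split.
have LS : L1 0 T (fun t => \sum_l (u t i l * V t l j + U t i l * v t l j)).
  by apply: L1_sum => l _; exact: (hp l).1.
split; first by apply: L1_ext LS => t _; rewrite E.
move=> t ht; have [t0 tT] := andP ht.
under [X in _ + X]eq_Rintegral do rewrite E.
rewrite int_sum => [|l _]; last exact: L1_sub (lexx _) tT (hp l).1.
by rewrite !mxE -big_split; apply: eq_bigr => l _ /=; exact: (hp l).2.
Qed.

Lemma primitiveD m p (T : R) (U u V v : R -> 'M[R]_(m, p)) :
  primitive T U u -> primitive T V v ->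
  primitive T (fun t => U t + V t) (fun t => u t + v t).
Proof.
move=> hU hV; apply: entry_primitive => i j.
have [hu eU] := primitive_entry i j hU; have [hv eV] := primitive_entry i j hV.
split; first by apply: L1_ext (L1D hu hv) => t _; rewrite mxE.
move=> t ht; have [t0 tT] := andP ht.
under [X in _ = _ + X]eq_Rintegral do rewrite mxE.
rewrite intD; [|exact: L1_sub (lexx _) tT hu|exact: L1_sub (lexx _) tT hv].
by rewrite [LHS]mxE (eU t ht) (eV t ht) [X in _ = X + _]mxE; ring.
Qed.

Lemma primitiveZ m p (T c : R) (U u : R -> 'M[R]_(m, p)) : primitive T U u ->
  primitive T (fun t => c *: U t) (fun t => c *: u t).
Proof.
move=> hU; apply: entry_primitive => i j; have [hu eU] := primitive_entry i j hU.
split; first by apply: L1_ext (L1Z c hu) => t _; rewrite mxE.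
move=> t ht; have [t0 tT] := andP ht.
under [X in _ = _ + X]eq_Rintegral do rewrite mxE.
rewrite intZ; last exact: L1_sub (lexx _) tT hu.
by rewrite [LHS]mxE (eU t ht) [X in _ = X + _]mxE mulrDr.
Qed.

Lemma primitiveB m p (T : R) (U u V v : R -> 'M[R]_(m, p)) :
  primitive T U u -> primitive T V v ->
  primitive T (fun t => U t - V t) (fun t => u t - v t).
Proof.
move=> hU /(primitiveZ (-1)) /(primitiveD hU).
by rewrite (_ : (fun t => U t + -1 *: V t) = fun t => U t - V t)
   1?(_ : (fun t => u t + -1 *: v t) = fun t => u t - v t) //;
  apply/funext => t; rewrite scaleN1r.
Qed.

Lemma primitive_integral m p (T : R) (c : 'M[R]_(m, p)) (u : R -> 'M[R]_(m, p)) :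
  mx_integrable 0 T u -> primitive T (fun t => c + mx_integral 0 t u) u.
Proof. by move=> hu; split=> // t _; rewrite mx_integral0 addr0. Qed.

Lemma primitive_continuous m p (T : R) (U u : R -> 'M[R]_(m, p)) i j :
  0 <= T -> primitive T U u -> {within `[0, T], continuous (fun t => U t i j)}.
Proof.
move=> T0 hU; have [hu eU] := primitive_entry i j hU.
apply: (@subspace_eq_continuous _ _ _
  (fun t : subspace `[0, T] => U 0 i j + \int[mu]_(s in `[0, t]) u s i j) _ _) => [t|].
  by rewrite inE /= in_itv /= => ht; rewrite [RHS](eU t ht).
move=> t; apply: cvgD; first exact: cvg_cst.
exact: (prim_continuous T0 hu).
Qed.

Lemma primitive_bounded m p (T : R) (U u : R -> 'M[R]_(m, p)) : 0 <= T ->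
  primitive T U u -> exists K, forall t, 0 <= t <= T -> n1 (U t) <= K.
Proof.
move=> T0 hU.
have h i j := within_continuous_bounded (@primitive_continuous m p T U u i j T0 hU).
pose K i j := projT1 (cid (h i j)); have hK i j := projT2 (cid (h i j)).
exists (\sum_i \sum_j K i j) => t ht; apply: ler_sum => i _.
by apply: ler_sum => j _; exact: (hK i j).2.
Qed.

Lemma primitive_derive m p (T : R) (U u : R -> 'M[R]_(m, p)) :
  (forall t, mxderive U t (u t)) -> (forall i j, continuous (fun t => u t i j)) ->
  primitive T U u.
Proof.
move=> dU cu; apply: entry_primitive => i j.
split; first exact/L1_cont/continuous_subspaceT/cu.
move=> t /andP[]; rewrite le_eqVlt => /predU1P[<- _|t0 _].
  by rewrite int0 addr0.
rewrite (int_deriv (F := fun s => U s i j) t0 (cu i j) (fun s => dU s i j)).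
by rewrite addrC subrK.
Qed.

Lemma n1_mulmx m p q (X : 'M[R]_(m, p)) (Y : 'M[R]_(p, q)) :
  n1 (X *m Y) <= n1 X * n1 Y.
Proof.
rewrite /n1 mulr_suml; apply: ler_sum => i _.
apply: (@le_trans _ _ (\sum_j \sum_l `|X i l| * `|Y l j|)).
  apply: ler_sum => j _; rewrite mxE; apply: le_trans (ler_norm_sum _ _ _) _.
  by apply: ler_sum => l _; rewrite normrM.
rewrite exchange_big /= mulr_suml; apply: ler_sum => l _.
rewrite -mulr_sumr; apply: ler_wpM2l => //.
rewrite [leRHS](bigD1 l) //= lerDl.
by apply: sumr_ge0 => l' _; apply: sumr_ge0.
Qed.

Lemma n1D m p (X Y : 'M[R]_(m, p)) : n1 (X + Y) <= n1 X + n1 Y.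
Proof.
rewrite /n1 -big_split /=; apply: ler_sum => i _.
by rewrite -big_split /=; apply: ler_sum => j _; rewrite mxE ler_normD.
Qed.

Lemma n1Z m p c (X : 'M[R]_(m, p)) : n1 (c *: X) = `|c| * n1 X.
Proof.
rewrite /n1 mulr_sumr; apply: eq_bigr => i _; rewrite mulr_sumr.
by apply: eq_bigr => j _; rewrite mxE normrM.
Qed.

Lemma n1_integral m p (t : R) (u : R -> 'M[R]_(m, p)) : mx_integrable 0 t u ->
  n1 (mx_integral 0 t u) <= \int[mu]_(s in `[0, t]) n1 (u s).
Proof.
move=> hu; rewrite /n1 int_sum => [|i _]; last first.
  by apply: L1_sum => j _; exact: L1_abs (hu i j).
apply: ler_sum => i _; rewrite int_sum => [|j _]; last exact: L1_abs (hu i j).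
apply: ler_sum => j _; rewrite mxE.
by apply: int_abs => //; exact: L1_abs (hu i j).
Qed.

Lemma n1_L1 m p (t : R) (u : R -> 'M[R]_(m, p)) : mx_integrable 0 t u ->
  L1 0 t (fun s => n1 (u s)).
Proof.
by move=> hu; apply: L1_sum => i _; apply: L1_sum => j _; exact: L1_abs (hu i j).
Qed.

Lemma n1_le_enorm m p (X : 'M[R]_(m, p)) : n1 X <= (m * p)%:R * enorm X.
Proof. by apply: n1_le => i j; exact: entry_le_enorm. Qed.

(** The bound [K] is there because [sup] takes a default value on unbounded sets. *)
Lemma sup_norm_ge (n : nat) (t K : R) (v : R -> 'cV[R]_n) s :
  (forall s, 0 <= s <= t -> n1 (v s) <= K) -> 0 <= s <= t ->
  enorm (v s) <= sup_norm t v.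
Proof.
move=> hK hs; apply: ub_le_sup; last by exists s => //=; rewrite in_itv.
exists K => y [s1 /=]; rewrite in_itv /= => hs1 <-.
exact: le_trans (enorm_le_n1 _) (hK _ hs1).
Qed.

End Primitive.

Lemma int_ae (R : realType) (x y : R) (f g : R -> R) :
  measurable_fun `[x, y] f -> measurable_fun `[x, y] g ->
  {ae (@lebesgue_measure R), forall t, f t = g t} ->
  \int[@lebesgue_measure R]_(t in `[x, y]) f t =
  \int[@lebesgue_measure R]_(t in `[x, y]) g t.
Proof.
move=> mf mg fg; rewrite /Rintegral; congr fine; apply: ae_eq_integral => //.
- exact/measurable_EFinP.
- exact/measurable_EFinP.
- by apply: aeS fg => t ft _; rewrite ft.
Qed.

Lemma int_le_ae (R : realType) (x y : R) (f g : R -> R) : L1 x y f -> L1 x y g ->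
  (forall t, 0 <= f t) -> (forall t, 0 <= g t) ->
  {ae (@lebesgue_measure R), forall t, x <= t <= y -> f t <= g t} ->
  \int[@lebesgue_measure R]_(t in `[x, y]) f t <=
  \int[@lebesgue_measure R]_(t in `[x, y]) g t.
Proof.
move=> Lf Lg f0 g0 fg; rewrite -lee_fin -!ge0_L1_integralE //.
apply: ae_ge0_le_integral => //.
- by move=> t _; rewrite lee_fin.
- by apply/measurable_EFinP; exact: L1_measurable Lf.
- by move=> t _; rewrite lee_fin.
- by apply/measurable_EFinP; exact: L1_measurable Lg.
Qed.

Lemma sq_sum_le (R : realType) (I : Type) (r : seq I) (u : I -> R) :
  (\sum_(i <- r) u i) ^+ 2 <= 2 ^+ size r * \sum_(i <- r) u i ^+ 2.
Proof.
elim: r => [|i r IH]; first by rewrite !big_nil mulr0 expr0n.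
rewrite !big_cons /= [2 ^+ (size r).+1]exprS; set S := \sum_(j <- r) u j in IH *.
set T := \sum_(j <- r) u j ^+ 2 in IH *.
have T0 : 0 <= T by apply: sumr_ge0 => j _; exact: sqr_ge0.
have p1 : 1 <= 2 ^+ size r :> R by rewrite exprn_ege1 // ler1n.
have := sqr_ge0 (u i - S); have := sqr_ge0 (u i); move: IH p1 T0.
move: (2 ^+ size r) T => x T IH p1 T0 h1 h2.
have : u i ^+ 2 <= x * u i ^+ 2 by rewrite ler_peMl.
by move: h2; rewrite sqrrB sqrrD; lra.
Qed.

Lemma totally_cvge0 (R : realType) (T : choiceType) (h : {fset T} -> \bar R) :
  (forall J, 0 <= h J)%E ->
  (forall e : R, 0 < e -> exists J0 : {fset T}, forall J, (J0 `<=` J)%fset ->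
     (h J <= e%:E)%E) ->
  h @ totally --> 0%E.
Proof.
move=> h0 hb; have FF : Filter (@totally T) := totally_filter.
have fin J (e : R) : (h J <= e%:E)%E -> h J \is a fin_num.
  by move=> hJ; rewrite ge0_fin_numE // (le_lt_trans hJ) // ltry.
apply/fine_cvgP; split.
  by have [J0 hJ0] := hb 1 ltr01; exists J0 => // J /= /hJ0 /fin.
apply/cvgrPdist_le => e e0; have [J0 hJ0] := hb e e0.
exists J0 => // J /= /hJ0 hJ; rewrite sub0r normrN.
by rewrite ger0_norm ?fine_ge0 // -lee_fin fineK // (fin J e).
Qed.

(** * Periodic domination and the time average *)

Section TameAverages.
Variables (R : realType) (n : nat) (A : 'M[R]_n) (P : R -> 'M[R]_n) (omega tau : R).
Notation mu := (@lebesgue_measure R).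
Hypothesis tau0 : 0 < tau.
Hypothesis omtau : omega * tau = pi *+ 2.
Hypothesis Pper : forall t, P (t + tau) = P t.
Hypothesis PL2 : mx_square_integrable 0 tau P.
Local Notation Q := (conj_flow A P).
Variables (I : finType) (a b : I -> R) (k : I -> nat) (Zc Zs : I -> 'M[R]_n -> 'M[R]_n).
Hypothesis NF : is_normal_form A a b k Zc Zs.
Hypothesis tP : {ae mu, forall t, tame a k Zc Zs (P t)}.
Local Notation grow := (growing_index a k).

Let QM2 x y i j : M2 x y (fun t => Q t i j).
Proof. by apply: Q_entry_M2 tau0 Pper PL2 _ _ _ _. Qed.

Lemma conj_flow_bound : exists C, 0 <= C /\
  {ae mu, forall t, 0 <= t -> forall i j, `|Q t i j| <= C * n1 (P t)}.
Proof.
have [C [C0 hC]] := tame_flow_bounded NF.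
by exists C; split => //; apply: aeS tP => t tt t0 i j; exact: hC.
Qed.

Lemma ess_bounded_conj_flow : ess_bounded P -> ess_bounded Q.
Proof.
move=> [K hK]; have [C [C0 hC]] := conj_flow_bound.
exists ((n * n)%:R * (C * ((n * n)%:R * K))).
apply: aeS (aeI hK hC) => t [h1 h2] t0.
apply: le_trans (enorm_le_n1 _) _; apply: n1_le => i j.
apply: le_trans (h2 t0 i j) _; apply: ler_wpM2l => //.
by apply: n1_le => i' j'; apply: le_trans (entry_le_enorm _ _ _) (h1 t0).
Qed.

Lemma n1P_M2 x y : M2 x y (fun t => n1 (P t)).
Proof.
apply: M2_sum_gen => i; apply: M2_sum_gen => j.
have [m1 i1] := P_entry_M2 tau0 Pper PL2 x y i j; split.
  exact: measurableT_comp.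
by apply: L1_ext i1 => t _; rewrite real_normK // num_real.
Qed.

Lemma tame_L2_unif_bounded : L2_unif_bounded tau Q.
Proof.
have [C [C0 hC]] := conj_flow_bound.
pose p t := n1 (P t) ^+ 2.
have pper t : p (t + tau) = p t by rewrite /p Pper.
have Lp x y : L1 x y p by exact: (n1P_M2 x y).2.
have p0 t : 0 <= p t by exact: sqr_ge0.
pose K := ((n * n)%:R * C) ^+ 2.
(* Translated by whole periods, the window becomes [[s1, s1 + tau]] with [s1 <= tau], inside
   [[- 2 tau, 2 tau]], which is four periods. *)
exists (K * ((2 + 2)%:R * \int[mu]_(t in `[0, tau]) p t)) => s s0.
have LK x y : L1 x y (fun t => K * p t) by exact: L1Z.
have EL := enormQ_L1 A tau0 Pper PL2 s (s + tau).
rewrite ge0_L1_integralE // lee_fin.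
apply: le_trans (int_le_ae EL (LK _ _) _ _ _) _ => [t|t||].
- exact: sqr_ge0.
- by rewrite mulr_ge0 // sqr_ge0.
- apply: aeS hC => t h /andP[st _].
  rewrite /K /p -exprMn lerXn2r ?nnegrE ?sqrtr_ge0 //.
    by rewrite !mulr_ge0 // n1_ge0.
  apply: le_trans (enorm_le_n1 _) _; rewrite -mulrA; apply: n1_le => i j.
  by apply: h; exact: le_trans st.
rewrite intZ // ler_wpM2l ?sqr_ge0 //.
have [N [s1 [/andP[s10 s1t] ->]]] := nat_block tau0 s0.
have -> : s1 + N%:R * tau + tau = s1 + tau + N%:R * tau by ring.
rewrite (periodic_int_shift tau0 pper (Lp _ _)).
apply: periodic_int_le => //; first by lra.
by lra.
Qed.

(** Decaying terms have mean zero, and so do oscillating ones with [b s] outside [omega Z]; for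
    resonant [b s] the integrand is periodic and its mean is taken over one period. The explicit
    form is compared both with the limit and with the constant coefficient of the expansion. *)
Definition averaged_part : 'M[R]_n := \matrix_(i, j)
  \sum_(s | ~~ grow s)
    if (a s == 0) && `[< exists m : int, b s = m%:~R * omega >] then
      tau^-1 * (\int[mu]_(t in `[0, tau]) (cos (b s * t) * Zc s (P t) i j)) +
      tau^-1 * (\int[mu]_(t in `[0, tau]) (sin (b s * t) * Zs s (P t) i j))
    else 0.

Lemma Z_entry_per (f : 'M[R]_n -> 'M[R]_n) i j t :
  f (P (t + tau)) i j = f (P t) i j.
Proof. by rewrite Pper. Qed.

Lemma P_integrable x y : mx_integrable x y P.
Proof. by move=> i j; exact: (M2_L1 (P_entry_M2 tau0 Pper PL2 _ _ _ _)). Qed.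

Lemma Z_entry_L1 (f : 'M[R]_n -> 'M[R]_n) i j x y : mxlin f ->
  L1 x y (fun t => f (P t) i j).
Proof. by move=> hf; exact: (mxlin_integral i j hf (P_integrable x y)).1. Qed.

Definition weight (trig : R -> R) s t := t ^+ k s * expR (a s * t) * trig (b s * t).

Lemma weight_continuous (trig : R -> R) s : continuous trig ->
  continuous (weight trig s).
Proof.
move=> ct t; apply: cvgM; first apply: cvgM.
- exact: exprn_continuous.
- by apply: (comp_lin_continuous (h := expR)); exact: continuous_expR.
- exact: (comp_lin_continuous (h := trig)).
Qed.

Lemma conj_flow_ae i j : {ae mu, forall t, Q t i j =
  \sum_(s | ~~ grow s) (weight cos s t * Zc s (P t) i j +
                        weight sin s t * Zs s (P t) i j)}.
Proof.
have [_ _ nf] := NF; apply: aeS tP => t tt.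
rewrite /conj_flow nf summxE (bigID grow) /= big1 ?add0r => [|s gs].
  by apply: eq_bigr => s _; rewrite mxE [X in X + _ = _]mxE [X in _ + X = _]mxE.
by have [-> ->] := tt s gs; rewrite !scaler0 addr0 mxE.
Qed.

(** Half of the decay rate absorbs the power of [t]; the other half remains for the integral. *)
Lemma decaying_weight_bound s (trig : R -> R) : a s < 0 ->
  (forall u, `|trig u| <= 1) ->
  exists C, 0 <= C /\ forall t, 0 <= t -> `|weight trig s t| <= C * expR (a s / 2 * t).
Proof.
move=> a0 tr1; have a20 : a s / 2 < 0 by rewrite pmulr_llt0.
have [C [C0 hC]] := pow_exp_bounded (k s) a20; exists C; split => // t t0.
rewrite /weight normrM -[leRHS]mulr1; apply: ler_pM => //.
have -> : expR (a s * t) = expR (a s / 2 * t) * expR (a s / 2 * t).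
  by rewrite -expRD; congr expR; field.
rewrite mulrA ger0_norm; first by rewrite ler_wpM2r ?expR_ge0 // hC.
by rewrite !mulr_ge0 ?exprn_ge0 ?expR_ge0.
Qed.

Lemma average_deviation_bounded : exists K, forall t, 0 <= t -> forall i j,
  `|\int[mu]_(u in `[0, t]) (Q u i j - averaged_part i j)| <= K.
Proof.
have [_ lin _] := NF.
(* The mean contributed by the single term [s]; over the nongrowing [s] these add up to
   [averaged_part]. *)
pose beta s i j := if (a s == 0) && `[< exists m : int, b s = m%:~R * omega >] then
      tau^-1 * (\int[mu]_(t in `[0, tau]) (cos (b s * t) * Zc s (P t) i j)) +
      tau^-1 * (\int[mu]_(t in `[0, tau]) (sin (b s * t) * Zs s (P t) i j))
    else 0.
have Lw (trig : R -> R) s f i j x y : continuous trig -> mxlin f ->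
    L1 x y (fun t => weight trig s t * f (P t) i j).
  move=> ct hf.
  have h := @L1_mulc R tau tau0 (fun t => f (P t) i j)
    (fun t => Z_entry_per f i j t) (Z_entry_L1 i j 0 tau hf) x y _ (weight_continuous (s := s) ct).
  exact: h.
have Lsum s i j x y : L1 x y (fun t => weight cos s t * Zc s (P t) i j +
      weight sin s t * Zs s (P t) i j).
  by apply: L1D; apply: Lw; [exact: continuous_cos|exact: (lin s).1|
                             exact: continuous_sin|exact: (lin s).2].
have hs s i j : exists K, ~~ grow s -> forall t, 0 <= t ->
    `|\int[mu]_(u in `[0, t]) (weight cos s u * Zc s (P u) i j +
      weight sin s u * Zs s (P u) i j) - t * beta s i j| <= K.
  case: (boolP (grow s)) => gs; first by exists 0.
  have /nongrowingP[a0|[a0 k0]] := gs.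
    have bnd (trig : R -> R) f : continuous trig -> (forall u, `|trig u| <= 1) -> mxlin f ->
      exists K, forall t, 0 <= t ->
      `|\int[mu]_(u in `[0, t]) (weight trig s u * f (P u) i j)| <= K.
      move=> ct tr1 hf; have [C [C0 hC]] := decaying_weight_bound a0 tr1.
      apply: (decaying_int_bounded tau0 (fun t => Z_entry_per f i j t)
        (Z_entry_L1 i j 0 tau hf) _ (weight_continuous (s := s) ct) C0 hC).
      by rewrite pmulr_llt0.
    have [K1 h1] := bnd cos _ (@continuous_cos R) (@cos_max R) (lin s).1.
    have [K2 h2] := bnd sin _ (@continuous_sin R) (@sin_max R) (lin s).2.
    exists (K1 + K2) => _ t t0; rewrite /beta lt_eqF //= mulr0 subr0.
    rewrite intD; [|by apply: Lw; [exact: continuous_cos|exact: (lin s).1]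
                   |by apply: Lw; [exact: continuous_sin|exact: (lin s).2]].
    by apply: le_trans (ler_normD _ _) _; apply: lerD; [exact: h1|exact: h2].
  have [K1 h1] := oscillating_int_bounded tau0 omtau (fun t => Z_entry_per (Zc s) i j t)
    (Z_entry_L1 i j 0 tau (lin s).1) (b s).
  have [K2 h2] := oscillating_int_bounded tau0 omtau (fun t => Z_entry_per (Zs s) i j t)
    (Z_entry_L1 i j 0 tau (lin s).2) (b s).
  exists (K1 + K2) => _ t t0.
  have wE trig u : weight trig s u = trig (b s * u).
    by rewrite /weight a0 k0 expr0 mul0r expR0 !mul1r.
  rewrite intD; [|by apply: Lw; [exact: continuous_cos|exact: (lin s).1]
                 |by apply: Lw; [exact: continuous_sin|exact: (lin s).2]].
  under eq_Rintegral do rewrite wE.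
  under [X in _ + X - _]eq_Rintegral do rewrite wE.
  have g1 := (h1 t t0).1; have g2 := (h2 t t0).2.
  have -> : beta s i j = (if `[< exists m : int, b s = m%:~R * omega >] then
      tau^-1 * (\int[mu]_(t in `[0, tau]) (cos (b s * t) * Zc s (P t) i j)) else 0) +
    (if `[< exists m : int, b s = m%:~R * omega >] then
      tau^-1 * (\int[mu]_(t in `[0, tau]) (sin (b s * t) * Zs s (P t) i j)) else 0).
    by rewrite /beta a0 eqxx /=; case: ifP => // _; rewrite addr0.
  rewrite mulrDr opprD addrACA.
  by apply: le_trans (ler_normD _ _) _; apply: lerD.
pose K s i j := projT1 (cid (hs s i j)).
have hK s i j := projT2 (cid (hs s i j)).
exists (\sum_i \sum_j \sum_s `|K s i j|) => t t0 i j.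
have -> : \int[mu]_(u in `[0, t]) (Q u i j - averaged_part i j) =
  \sum_(s | ~~ grow s) (\int[mu]_(u in `[0, t]) (weight cos s u * Zc s (P u) i j +
      weight sin s u * Zs s (P u) i j) - t * beta s i j).
  rewrite intB; [|exact: (M2_L1 (QM2 _ _ _ _))|exact: L1_cst].
  rewrite int_cst // subr0 mulrC sumrB; congr (_ - _); last first.
    by rewrite -mulr_sumr mxE.
  rewrite -int_sum //; apply: int_ae (conj_flow_ae i j).
    exact: (QM2 _ _ _ _).1.
  by apply: L1_measurable; apply: L1_sum.
apply: (@le_trans _ _ (\sum_s `|K s i j|)).
  apply: le_trans (ler_norm_sum _ _ _) _; rewrite big_mkcond /=.
  apply: ler_sum => s _; case: ifP => // gs.
  by apply: le_trans (hK s i j gs t t0) _; exact: ler_norm.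
rewrite [leRHS](bigD1 i) //= (bigD1 j) //= -addrA lerDl addr_ge0 //.
  by apply: sumr_ge0 => *; apply: sumr_ge0.
by apply: sumr_ge0 => *; apply: sumr_ge0 => *; apply: sumr_ge0.
Qed.

Lemma tame_time_average : is_time_average Q averaged_part.
Proof.
have [K hK] := average_deviation_bounded => i j.
have K0 : 0 <= K by apply: le_trans (hK 0 (lexx _) i j).
apply/cvgrPdist_le => e e0.
exists (K / e); split; first exact: num_real.
move=> T KT.
have T0 : 0 < T by apply: le_lt_trans KT; rewrite divr_ge0 // ltW.
rewrite [X in _ - X]mxE [X in _ * X]mxE.
have := hK T (ltW T0) i j.
rewrite intB; [|exact: (M2_L1 (QM2 _ _ _ _))|exact: L1_cst].
rewrite int_cst ?(ltW T0) // subr0 => h.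
rewrite distrC.
have -> : T^-1 * (\int[mu]_(t in `[0, T]) Q t i j) - averaged_part i j =
  T^-1 * (\int[mu]_(t in `[0, T]) Q t i j - averaged_part i j * T).
  by rewrite mulrBr mulrCA mulVf ?mulr1 // gt_eqF.
rewrite normrM gtr0_norm ?invr_gt0 // mulrC ler_pdivrMr //.
apply: le_trans h _; rewrite mulrC -ler_pdivrMr //; exact: ltW.
Qed.

(** * The almost periodic expansion *)

Lemma mxlinZ (f : 'M[R]_n -> 'M[R]_n) c X : mxlin f -> f (c *: X) = c *: f X.
Proof.
move=> hf; have f0 : f 0 = 0.
  by have := hf (-1) 0 0; rewrite scaler0 add0r scaleN1r addNr.
by have := hf c X 0; rewrite f0 !addr0.
Qed.

Lemma mxlin2 (f : 'M[R]_n -> 'M[R]_n) c X d Y : mxlin f ->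
  f (c *: X + d *: Y) = c *: f X + d *: f Y.
Proof. by move=> hf; rewrite hf mxlinZ. Qed.

Lemma mxlin2B (f : 'M[R]_n -> 'M[R]_n) c X d Y : mxlin f ->
  f (c *: X - d *: Y) = c *: f X - d *: f Y.
Proof. by move=> hf; rewrite -!scaleNr mxlin2. Qed.

Lemma mxlinB (f : 'M[R]_n -> 'M[R]_n) U V : mxlin f -> f (U - V) = f U - f V.
Proof.
by move=> hf; have := hf (-1) V U; rewrite !scaleN1r addrC => ->; rewrite addrC.
Qed.

Lemma mxlin_sum (f : 'M[R]_n -> 'M[R]_n) (J : Type) (r : seq J) (X : J -> 'M[R]_n) :
  mxlin f -> f (\sum_(m <- r) X m) = \sum_(m <- r) f (X m).
Proof.
move=> hf; have f0 : f 0 = 0.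
  by have := hf (-1) 0 0; rewrite scaler0 add0r scaleN1r addNr.
elim: r => [|m r IH]; first by rewrite !big_nil.
by rewrite !big_cons -IH -{1}[X m]scale1r hf scale1r.
Qed.

Definition fc (m : int) : 'M[R]_n :=
  \matrix_(i, j) fourier_cos omega tau (fun t => P t i j) m.
Definition fs (m : int) : 'M[R]_n :=
  \matrix_(i, j) fourier_sin omega tau (fun t => P t i j) m.

(* The [m] such that [x = b s + m omega], if there is one. *)
Definition freq_index s (x : R) : int := Num.floor ((x - b s) / omega).

Definition matches s (sg : R * R * nat) : bool :=
  [&& ~~ grow s, sg.1.1 == a s, sg.2 == k s &
      sg.1.2 == b s + (freq_index s sg.1.2)%:~R * omega].

(** [expC - i expD] gathers [(Zc - i Zs) (fc m - i fs m)], the coefficient of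
    [exp (i (b s + m omega) t)]. Several [s] may produce the same triple, hence the sums. *)
Definition expC (sg : R * R * nat) : 'M[R]_n := \sum_(s | matches s sg)
  (Zc s (fc (freq_index s sg.1.2)) - Zs s (fs (freq_index s sg.1.2))).
Definition expD (sg : R * R * nat) : 'M[R]_n := \sum_(s | matches s sg)
  (Zc s (fs (freq_index s sg.1.2)) + Zs s (fc (freq_index s sg.1.2))).
Definition expS : set (R * R * nat) := [set sg | exists s, matches s sg].

Lemma freq_indexK s m : freq_index s (b s + m%:~R * omega) = m.
Proof.
have om0 : 0 < omega := omega_gt0 tau0 omtau.
by rewrite /freq_index addrC addKr mulfK ?gt_eqF // intrKfloor.
Qed.

Lemma expS_countable : countable expS.
Proof.
pose f (p : I * int) : R * R * nat := (a p.1, b p.1 + p.2%:~R * omega, k p.1).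
have sub : expS `<=` f @` setT.
  move=> [[x y] z] [s /and4P[_ /eqP /= -> /eqP -> /eqP hy]].
  by exists (s, freq_index s y) => //; rewrite /f /= -hy.
apply: sub_countable (countableP (setT : set (I * int))).
exact: card_le_trans (subset_card_le sub) (card_image_le f setT).
Qed.

Lemma expS_finite_rates : finite_set [set s.1.1 | s in expS].
Proof.
apply: (@sub_finite_set _ _ (a @` setT)); last exact: finite_image.
by move=> _ [sg [s /and4P[_ /eqP h _ _]] <-]; exists s.
Qed.

Definition reS (J : seq int) t : 'M[R]_n :=
  \matrix_(i, j) tre omega (fourier_list omega tau (fun u => P u i j) J) t.
Definition imS (J : seq int) t : 'M[R]_n :=
  \matrix_(i, j) tim omega (fourier_list omega tau (fun u => P u i j) J) t.

Lemma reSE J t : reS J t = \sum_(m <- J)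
  (cos (m%:~R * omega * t) *: fc m + sin (m%:~R * omega * t) *: fs m).
Proof.
apply/matrixP => i j; rewrite mxE /tre big_map summxE; apply: eq_bigr => m _ /=.
by rewrite !mxE mulrC [X in _ + X = _]mulrC.
Qed.

Lemma imSE J t : imS J t = \sum_(m <- J)
  (sin (m%:~R * omega * t) *: fc m - cos (m%:~R * omega * t) *: fs m).
Proof.
apply/matrixP => i j; rewrite mxE /tim big_map summxE; apply: eq_bigr => m _ /=.
by rewrite !mxE mulrC [X in _ - X = _]mulrC.
Qed.

Definition matched s (J : {fset R * R * nat}) : seq int :=
  [seq freq_index s sg.1.2 | sg <- J & matches s sg].

Lemma matched_uniq s J : uniq (matched s J).
Proof.
rewrite map_inj_in_uniq ?filter_uniq ?fset_uniq //.
move=> [[x y] z] [[x' y'] z']; rewrite !mem_filter /= => /andP[m1 _] /andP[m2 _] e.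
move: m1 m2 => /and4P[_ /eqP /= -> /eqP -> /eqP ->] /and4P[_ /eqP /= -> /eqP -> /eqP ->].
by rewrite e.
Qed.

Local Notation w := weight.

(** Each summand on the right is the real part of [exp (i b t) (Zc - i Zs)] applied to the complex
    Fourier sum [reS + i imS], multiplied by the real weight. The part [imS] appears because
    [matched s J] need not be symmetric. *)
Lemma expansion_partial_sum (J : {fset R * R * nat}) t :
  \sum_(sg <- J | sg \in expS) exp_trig_term expC expD sg t =
  \sum_(s | ~~ grow s)
    (w cos s t *: Zc s (reS (matched s J) t) - w sin s t *: Zc s (imS (matched s J) t)
     + (w cos s t *: Zs s (imS (matched s J) t) + w sin s t *: Zs s (reS (matched s J) t))).
Proof.
have [_ lin _] := NF.
pose term s sg : 'M[R]_n :=
  (t ^+ sg.2 * expR (sg.1.1 * t) * cos (sg.1.2 * t)) *: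
    (Zc s (fc (freq_index s sg.1.2)) - Zs s (fs (freq_index s sg.1.2))) +
  (t ^+ sg.2 * expR (sg.1.1 * t) * sin (sg.1.2 * t)) *:
    (Zc s (fs (freq_index s sg.1.2)) + Zs s (fc (freq_index s sg.1.2))).
transitivity (\sum_(sg <- J) \sum_(s | matches s sg) term s sg).
  rewrite big_mkcond /=; apply: eq_bigr => -[[x y] z] _.
  case: ifP => h.
    by rewrite /exp_trig_term /expC /expD !scaler_sumr -big_split.
  rewrite big1 // => s hs; move: h; rewrite mem_set //; by exists s.
rewrite (exchange_big_dep xpredT) //= (bigID grow) /= big1 ?add0r => [|s gs]; last first.
  by apply: big1_seq => sg /andP[/and4P[]]; rewrite gs.
apply: eq_bigr => s gs.
rewrite -big_filter.
have E sg : matches s sg -> term s sg =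
   w cos s t *: Zc s (cos ((freq_index s sg.1.2)%:~R * omega * t) *: fc (freq_index s sg.1.2)
        + sin ((freq_index s sg.1.2)%:~R * omega * t) *: fs (freq_index s sg.1.2))
   - w sin s t *: Zc s (sin ((freq_index s sg.1.2)%:~R * omega * t) *: fc (freq_index s sg.1.2)
        - cos ((freq_index s sg.1.2)%:~R * omega * t) *: fs (freq_index s sg.1.2))
   + (w cos s t *: Zs s (sin ((freq_index s sg.1.2)%:~R * omega * t) *: fc (freq_index s sg.1.2)
        - cos ((freq_index s sg.1.2)%:~R * omega * t) *: fs (freq_index s sg.1.2))
   + w sin s t *: Zs s (cos ((freq_index s sg.1.2)%:~R * omega * t) *: fc (freq_index s sg.1.2)
        + sin ((freq_index s sg.1.2)%:~R * omega * t) *: fs (freq_index s sg.1.2))).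
  move=> /and4P[_ /eqP e1 /eqP e2 /eqP e3].
  rewrite /term e1 e2.
  set m := freq_index s sg.1.2 in e3 *; rewrite e3.
  have linc := (lin s).1; have lins := (lin s).2.
  rewrite (mxlin2 _ _ _ _ linc) (mxlin2 _ _ _ _ lins).
  rewrite (mxlin2B _ _ _ _ linc) (mxlin2B _ _ _ _ lins).
  rewrite /weight mulrDl cosD sinD.
  move: (Zc s (fc m)) (Zc s (fs m)) (Zs s (fc m)) (Zs s (fs m)) => X1 X2 X3 X4.
  by apply/matrixP => i j; rewrite !mxE; ring.
rewrite reSE imSE /matched !big_map !(mxlin_sum _ _ (lin s).1) !(mxlin_sum _ _ (lin s).2).
rewrite !scaler_sumr -sumrB -!big_split /=.
by apply: eq_big_seq => sg; rewrite mem_filter => /andP[/E -> _].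
Qed.

(** Squared modulus of the complex Fourier error of [P]; its periodicity reduces [[- T, T]] to one
    period. *)
Definition resid (J : seq int) t : R :=
  \sum_i \sum_j ((P t i j - reS J t i j) ^+ 2 + imS J t i j ^+ 2).

Lemma resid_ge0 J t : 0 <= resid J t.
Proof.
by apply: sumr_ge0 => i _; apply: sumr_ge0 => j _; rewrite addr_ge0 // sqr_ge0.
Qed.

Lemma n1_sq_le (X : 'M[R]_n) : n1 X ^+ 2 <=
  2 ^+ size (index_enum ('I_n * 'I_n)%type) * \sum_i \sum_j X i j ^+ 2.
Proof.
rewrite /n1 !pair_bigA /=; apply: le_trans (sq_sum_le _ _) _.
rewrite ler_wpM2l ?exprn_ge0 //; apply: ler_sum => q _.
by rewrite real_normK // num_real.
Qed.

Lemma n1_resid J t : n1 (P t - reS J t) ^+ 2 + n1 (imS J t) ^+ 2 <=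
  2 ^+ size (index_enum ('I_n * 'I_n)%type) * resid J t.
Proof.
apply: le_trans (lerD (n1_sq_le _) (n1_sq_le _)) _.
rewrite -mulrDr ler_wpM2l ?exprn_ge0 // /resid -big_split /=.
apply: ler_sum => i _; rewrite -big_split /=; apply: ler_sum => j _.
have -> // : (P t - reS J t) i j = P t i j - reS J t i j.
by rewrite mxE [X in _ + X = _]mxE.
Qed.

Lemma fourier_list_per (f : R -> R) J t :
  tre omega (fourier_list omega tau f J) (t + tau) =
    tre omega (fourier_list omega tau f J) t /\
  tim omega (fourier_list omega tau f J) (t + tau) =
    tim omega (fourier_list omega tau f J) t.
Proof.
have h (m : int) : cos (m%:~R * omega * (t + tau)) = cos (m%:~R * omega * t) /\
    sin (m%:~R * omega * (t + tau)) = sin (m%:~R * omega * t).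
  rewrite mulrDr -[m%:~R * omega * tau]mulrA omtau cosD sinD.
  by have [-> ->] := cos_sin_2pi_int R m; rewrite !mulr1 !mulr0 subr0 addr0.
by split; apply: eq_bigr => p _; have [-> ->] := h p.1.1.
Qed.

Lemma resid_per J t : resid J (t + tau) = resid J t.
Proof.
apply: eq_bigr => i _; apply: eq_bigr => j _.
rewrite !mxE Pper; have [-> ->] := fourier_list_per (fun u => P u i j) J t.
by [].
Qed.

Lemma resid_entry_L1 J i j :
  L1 0 tau (fun t => (P t i j - reS J t i j) ^+ 2 + imS J t i j ^+ 2).
Proof.
have h1 := M2B (P_entry_M2 tau0 Pper PL2 0 tau i j)
  (tre_M2 omega tau (fourier_list omega tau (fun u => P u i j) J)).
have h2 := tim_M2 omega tau (fourier_list omega tau (fun u => P u i j) J).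
by apply: L1_ext (L1D h1.2 h2.2) => t _; rewrite !mxE.
Qed.

Lemma resid_L1 J : L1 0 tau (resid J).
Proof.
by apply: L1_sum => i _; apply: L1_sum => j _; exact: resid_entry_L1.
Qed.

Lemma resid_small (d : R) : 0 < d -> exists J0 : seq int, forall J, uniq J ->
  {subset J0 <= J} -> \int[mu]_(t in `[0, tau]) resid J t <= d.
Proof.
move=> d0.
have nn0 : 0 < ((n * n).+1)%:R :> R by rewrite ltr0n.
have e0 : 0 < d / ((n * n).+1)%:R by rewrite divr_gt0.
have h i j := fourier_L2_cvg tau0 omtau (P_entry_M2 tau0 Pper PL2 0 tau i j) e0.
pose J0 i j := projT1 (cid (h i j)); have hJ0 i j := projT2 (cid (h i j)).
exists [seq m | q <- index_enum ('I_n * 'I_n)%type, m <- J0 q.1 q.2].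
move=> J uJ sJ; rewrite int_sum => [|i _]; last first.
  by apply: L1_sum => j _; exact: resid_entry_L1.
apply: (@le_trans _ _ (\sum_(i < n) \sum_(j < n) d / ((n * n).+1)%:R)).
  apply: ler_sum => i _; rewrite int_sum => [|j _]; last exact: resid_entry_L1.
  apply: ler_sum => j _; apply: le_trans (hJ0 i j J uJ _); last first.
    move=> m hm; apply: sJ; apply/allpairsPdep; exists (i, j), m.
    by rewrite mem_index_enum.
  by rewrite le_eqVlt; apply/orP; left; apply/eqP; apply: int_ext => t _; rewrite !mxE.
rewrite !sumr_const !card_ord -mulrnA -[leLHS]mulr_natl mulrA ler_pdivrMr //.
by rewrite mulrC ler_wpM2l ?(ltW d0) // ler_nat.
Qed.

(** The weights are bounded on [[- T, T]] and the [Zc s], [Zs s] are linear, so the error of the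
    expansion is controlled by the Fourier error of [P], with [K] independent of [J]. *)
Lemma expansion_error_bound (T : R) : exists K : R, 0 <= K /\
  forall J : {fset R * R * nat}, {ae mu, forall t, - T <= t <= T ->
    enorm (Q t - \sum_(sg <- J | sg \in expS) exp_trig_term expC expD sg t) ^+ 2 <=
    K * \sum_(s | ~~ grow s) resid (matched s J) t}.
Proof.
have [_ lin nf] := NF.
pose N2 : R := 2 ^+ size (index_enum ('I_n * 'I_n)%type).
have hs s : exists K : R, 0 <= K /\ forall (t : R) (X Y : 'M[R]_n) i j, - T <= t <= T ->
   `|(w cos s t *: Zc s X + w sin s t *: Zc s Y +
     (w sin s t *: Zs s X - w cos s t *: Zs s Y)) i j| <= K * (n1 X + n1 Y).
  have [Wc [Wc0 hWc]] := within_continuous_bounded (continuous_subspaceT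
     (weight_continuous (s := s) (@continuous_cos R))
     : {within `[- T, T], continuous _}).
  have [Ws [Ws0 hWs]] := within_continuous_bounded (continuous_subspaceT
     (weight_continuous (s := s) (@continuous_sin R))
     : {within `[- T, T], continuous _}).
  have [Kc [Kc0 hKc]] := mxlin_bound (lin s).1.
  have [Ks [Ks0 hKs]] := mxlin_bound (lin s).2.
  exists ((Wc + Ws) * (Kc + Ks)); split; first by rewrite mulr_ge0 // addr_ge0.
  move=> t X Y i j ht; have wc := hWc t ht; have ws := hWs t ht.
  have -> : (w cos s t *: Zc s X + w sin s t *: Zc s Y +
     (w sin s t *: Zs s X - w cos s t *: Zs s Y)) i j =
     w cos s t * Zc s X i j + w sin s t * Zc s Y i j +
     (w sin s t * Zs s X i j - w cos s t * Zs s Y i j).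
    move: (Zc s X) (Zc s Y) (Zs s X) (Zs s Y) => *; by rewrite !mxE.
  have m (c W z K : R) (Z : 'M[R]_n) : 0 <= K -> `|c| <= W -> `|z| <= K * n1 Z ->
      `|c * z| <= W * (K * n1 Z).
    by move=> K0 cW zK; rewrite normrM; apply: ler_pM.
  apply: le_trans (ler_normD _ _) _.
  apply: le_trans (lerD (ler_normD _ _) (ler_normB _ _)) _.
  have b1 := m _ _ _ _ X Kc0 wc (hKc X i j); have b2 := m _ _ _ _ Y Kc0 ws (hKc Y i j).
  have b3 := m _ _ _ _ X Ks0 ws (hKs X i j); have b4 := m _ _ _ _ Y Ks0 wc (hKs Y i j).
  have x0 := n1_ge0 X; have y0 := n1_ge0 Y.
  have p1 := mulr_ge0 Ws0 (mulr_ge0 Kc0 x0); have p2 := mulr_ge0 Wc0 (mulr_ge0 Kc0 y0).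
  have p3 := mulr_ge0 Wc0 (mulr_ge0 Ks0 x0); have p4 := mulr_ge0 Ws0 (mulr_ge0 Ks0 y0).
  by move: b1 b2 b3 b4 p1 p2 p3 p4; lra.
pose K s := projT1 (cid (hs s)); have hK s := projT2 (cid (hs s)).
(* The factor [2] splits [(n1 X + n1 Y) ^ 2] and [N2] compares [n1] squared with sums of squares;
   below, [N1] pays for squaring the sum over [s] and [n * n] for summing the entries. *)
pose KK := \sum_s 2 * K s ^+ 2 * N2.
have KK0 : 0 <= KK.
  apply: sumr_ge0 => s _; apply: mulr_ge0; last exact: exprn_ge0.
  by apply: mulr_ge0 => //; exact: sqr_ge0.
pose N1 : R := 2 ^+ size (index_enum I).
exists ((n * n)%:R * (N1 * KK)); split.
  apply: mulr_ge0 => //; apply: mulr_ge0 => //; exact: exprn_ge0.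
move=> J; apply: aeS tP => t tt ht.
pose X s := P t - reS (matched s J) t; pose Y s := imS (matched s J) t.
pose d s := w cos s t *: Zc s (X s) + w sin s t *: Zc s (Y s) +
     (w sin s t *: Zs s (X s) - w cos s t *: Zs s (Y s)).
have -> : Q t - \sum_(sg <- J | sg \in expS) exp_trig_term expC expD sg t =
    \sum_(s | ~~ grow s) d s.
  rewrite (expansion_partial_sum).
  have -> : Q t = \sum_(s | ~~ grow s) (w cos s t *: Zc s (P t) + w sin s t *: Zs s (P t)).
    rewrite /conj_flow nf (bigID grow) /= big1 ?add0r // => s gs.
    by have [-> ->] := tt s gs; rewrite !scaler0 addr0.
  rewrite -sumrB; apply: eq_bigr => s _; rewrite /d /X /Y.
  rewrite (mxlinB _ _ (lin s).1) (mxlinB _ _ (lin s).2).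
  move: (Zc s (P t)) (Zs s (P t)) (Zc s (reS _ t)) (Zs s (reS _ t))
    (Zc s (imS _ t)) (Zs s (imS _ t)) => X1 X2 X3 X4 X5 X6.
  by apply/matrixP => i j; rewrite !mxE; ring.
set RS := \sum_(s | _) resid _ t.
have RS0 : 0 <= RS by apply: sumr_ge0 => s _; exact: resid_ge0.
have entry i j : ((\sum_(s | ~~ grow s) d s) i j) ^+ 2 <= N1 * KK * RS.
  rewrite summxE big_mkcond; apply: le_trans (sq_sum_le _ _) _.
  rewrite -/N1 -mulrA ler_wpM2l ?exprn_ge0 //.
  rewrite /KK mulr_suml; apply: ler_sum => s _.
  case: ifP => gs; last first.
    rewrite [leLHS]expr2 mul0r; apply: mulr_ge0 => //.
    by apply: mulr_ge0; [apply: mulr_ge0 => //; exact: sqr_ge0|exact: exprn_ge0].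
  have [K0 hb] := hK s; have := hb t (X s) (Y s) i j ht; rewrite -/(d s) => hd.
  apply: (@le_trans _ _ (K s ^+ 2 * (n1 (X s) + n1 (Y s)) ^+ 2)).
    rewrite -exprMn -[leLHS]real_normK ?num_real // lerXn2r ?nnegrE //.
    by rewrite mulr_ge0 // addr_ge0 // n1_ge0.
  have h2 : (n1 (X s) + n1 (Y s)) ^+ 2 <= 2 * (n1 (X s) ^+ 2 + n1 (Y s) ^+ 2).
    by have := sqr_ge0 (n1 (X s) - n1 (Y s)); rewrite sqrrB sqrrD; lra.
  have -> : 2 * K s ^+ 2 * N2 * RS = K s ^+ 2 * (2 * (N2 * RS)).
    by rewrite [2 * _]mulrC; move: (K s ^+ 2) => x; rewrite !mulrA.
  apply: ler_wpM2l; first exact: sqr_ge0.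
  apply: le_trans h2 _; apply: ler_wpM2l => //.
  apply: le_trans (n1_resid _ _) _; rewrite -/N2; apply: ler_wpM2l.
    exact: exprn_ge0.
  by rewrite /RS (bigD1 s) //= lerDl sumr_ge0 // => s' _; exact: resid_ge0.
rewrite enorm_sq -!mulrA.
apply: (@le_trans _ _ (\sum_(i < n) \sum_(j < n) N1 * (KK * RS))).
  by apply: ler_sum => i _; apply: ler_sum => j _; rewrite mulrA; exact: entry.
by rewrite !sumr_const !card_ord -mulrnA -[leLHS]mulr_natl.
Qed.

Lemma exp_trig_entry_continuous (C D : R * R * nat -> 'M[R]_n) sg i j :
  continuous (fun t => exp_trig_term C D sg t i j).
Proof.
case: sg => [[x y] z].
rewrite (_ : (fun _ => _) = fun t =>
  (t ^+ z * expR (x * t) * cos (y * t)) * C (x, y, z) i j +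
  (t ^+ z * expR (x * t) * sin (y * t)) * D (x, y, z) i j); last first.
  by apply/funext => t; rewrite /exp_trig_term [LHS]mxE [X in X + _]mxE [X in _ + X]mxE.
have h (trig : R -> R) : continuous trig ->
    continuous (fun t : R => t ^+ z * expR (x * t) * trig (y * t)).
  move=> ct t; apply: cvgM; first apply: cvgM.
  - exact: exprn_continuous.
  - by apply: (comp_lin_continuous (h := expR)); exact: continuous_expR.
  - exact: (comp_lin_continuous (h := trig)).
move=> t; apply: cvgD; apply: cvgM; try exact: cvg_cst.
- exact: (h cos (@continuous_cos R)).
- exact: (h sin (@continuous_sin R)).
Qed.

Lemma expansion_error_L1 (J : {fset R * R * nat}) T : L1 (- T) T (fun t =>
  enorm (Q t - \sum_(sg <- J | sg \in expS) exp_trig_term expC expD sg t) ^+ 2).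
Proof.
have : L1 (- T) T (fun t => \sum_i \sum_j (Q t i j -
    \sum_(sg <- J | sg \in expS) exp_trig_term expC expD sg t i j) ^+ 2).
  apply: L1_sum => i _; apply: L1_sum => j _.
  under [X in L1 _ _ X]eq_fun do rewrite -big_filter.
  apply: (M2B (Q_entry_M2 A tau0 Pper PL2 _ _ i j) _).2; apply: M2_sum_gen => sg.
  exact/M2_cont/continuous_subspaceT/exp_trig_entry_continuous.
apply: L1_ext => t _; rewrite enorm_sq.
by apply: eq_bigr => i _; apply: eq_bigr => j _; rewrite [in RHS]mxE [X in _ = (_ + X) ^+ 2]mxE summxE.
Qed.

Lemma expansion_L2_sums_to : L2_sums_to expS (exp_trig_term expC expD) Q.
Proof.
split=> [i j|T T0]; first exact: Q_entry_measurable tau0 Pper PL2 i j.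
apply: totally_cvge0 => [J|e e0].
  by apply: integral_ge0 => t _; rewrite lee_fin sqr_ge0.
have [K [K0 hK]] := expansion_error_bound T.
pose N := (Num.bound (T / tau)).
have hN : T <= N%:R * tau.
  rewrite -ler_pdivrMr // ltW // archi_boundP // divr_ge0 // ltW //.
pose KK : R := (K * (N + N)%:R * #|I|%:R + 1).
have KK0 : 0 < KK by rewrite ltr_wpDl // !mulr_ge0.
have [J0 hJ0] := resid_small (divr_gt0 e0 KK0).
(* These triples pair every term with every frequency of [J0], so that [J0] is contained in
   [matched s J] for all nongrowing [s] at once. *)
exists [fset (a q.1, (b q.1 + q.2%:~R * omega)%R, k q.1)
        | q in [seq (s, m) | s <- enum I, m <- J0]]%fset.
move=> J sJ.
have sm s : ~~ grow s -> {subset J0 <= matched s J}.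
  move=> gs m hm; apply/mapP; exists (a s, b s + m%:~R * omega, k s); last first.
    by rewrite /= freq_indexK.
  rewrite mem_filter /matches gs /= !eqxx freq_indexK // eqxx /=.
  apply: (fsubsetP sJ); apply/imfsetP; exists (s, m) => //=.
  by apply/allpairsP; exists (s, m); rewrite mem_enum.
have rL s : L1 (- T) T (resid (matched s J)).
  by apply: (periodic_L1 tau0 _ (resid_L1 _)) => t; exact: resid_per.
pose F t := K * \sum_(s | ~~ grow s) resid (matched s J) t.
have FL : L1 (- T) T F by apply: L1Z; apply: L1_sum.
have EL := expansion_error_L1 J T.
rewrite ge0_L1_integralE // lee_fin.
apply: le_trans (int_le_ae EL FL _ _ (hK J)) _ => [t|t|]; first exact: sqr_ge0.
  by apply: mulr_ge0 => //; apply: sumr_ge0 => s _; exact: resid_ge0.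
rewrite intZ; last by apply: L1_sum.
rewrite int_sum => [|s _]; last exact: rL.
apply: (@le_trans _ _ (K * \sum_(s in I) ((N + N)%:R * (e / KK)))).
  apply: ler_wpM2l => //; rewrite big_mkcond; apply: ler_sum => s _.
  case: ifP => gs; last by rewrite mulr_ge0 // divr_ge0 // ltW.
  have hN' : - (N%:R * tau) <= - T by rewrite lerN2.
  have := periodic_int_le tau0 (resid_per (matched s J))
    (resid_L1 _) (resid_ge0 _) hN' hN.
  move/le_trans; apply.
  by apply: ler_wpM2l => //; apply: hJ0; [exact: matched_uniq|exact: sm].
rewrite sumr_const -[X in K * X]mulr_natl.
have -> : K * (#|I|%:R * ((N + N)%:R * (e / KK))) = (KK - 1) * (e / KK).
  by rewrite /KK; ring.
by rewrite mulrBl mul1r mulrCA divff ?gt_eqF // mulr1 gerBl divr_ge0 // ltW.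
Qed.

Lemma mxlin_fourier (f : 'M[R]_n -> 'M[R]_n) (trig : R -> R) c i j :
  mxlin f -> continuous trig ->
  f (\matrix_(i, j) (tau^-1 * \int[mu]_(t in `[0, tau]) (P t i j * trig (c * t)))) i j =
  tau^-1 * \int[mu]_(t in `[0, tau]) (trig (c * t) * f (P t) i j).
Proof.
move=> hf ct.
have tM2 : M2 0 tau (fun t => trig (c * t)).
  by apply/M2_cont/continuous_subspaceT; exact: (comp_lin_continuous (h := trig)).
have TL : mx_integrable 0 tau (fun t => trig (c * t) *: P t).
  move=> i' j'; apply: L1_ext (M2_mul tM2 (P_entry_M2 tau0 Pper PL2 0 tau i' j')).
  by move=> t _; rewrite mxE.
have -> : \matrix_(i, j) (tau^-1 * \int[mu]_(t in `[0, tau]) (P t i j * trig (c * t)))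
    = tau^-1 *: mx_integral 0 tau (fun t => trig (c * t) *: P t).
  apply/matrixP => i' j'; rewrite !mxE; congr (_ * _).
  by apply: int_ext => t _; rewrite mxE mulrC.
rewrite (mxlinZ _ _ hf) mxE; congr (_ * _).
rewrite (mxlin_integral i j hf TL).2; apply: int_ext => t _.
by rewrite (mxlinZ _ _ hf) mxE.
Qed.

(** If [b s = m omega], frequency zero arises from the Fourier index [- m]. The sine coefficient is
    odd in the index, which turns the minus sign of [expC] into the plus sign of [averaged_part]. *)
Lemma expC_averaged : expC (0, 0, 0%N) = averaged_part.
Proof.
apply/matrixP => i j; rewrite [RHS]mxE /expC summxE big_mkcond [RHS]big_mkcond.
have [_ lin _] := NF; apply: eq_bigr => s _; rewrite /matches /=.
case gs : (grow s) => //=; rewrite [0 == a s]eq_sym.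
case: eqP => //= as0; have -> : k s = 0%N.
  by case: (nongrowingP (negbT gs)) => [|[]] //; rewrite as0 ltxx.
rewrite eqxx /=.
have -> : (0 == b s + (freq_index s 0)%:~R * omega) =
    `[< exists m : int, b s = m%:~R * omega >].
  apply/eqP/asboolP => [h|[m hm]].
    exists (- freq_index s 0); rewrite mulrNz mulNr.
    by apply/eqP; rewrite -addr_eq0 -h.
  have e : 0 = b s + (- m)%:~R * omega by rewrite hm mulrNz mulNr subrr.
  by rewrite {2}e freq_indexK.
case: ifP => // /asboolP[m hm].
have e : 0 = b s + (- m)%:~R * omega by rewrite hm mulrNz mulNr subrr.
have -> : freq_index s 0 = - m by rewrite e freq_indexK.
rewrite [LHS]mxE [X in _ + X]mxE /fc /fs /fourier_cos /fourier_sin.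
rewrite (mxlin_fourier _ _ _ (lin s).1 (@continuous_cos R)).
rewrite (mxlin_fourier _ _ _ (lin s).2 (@continuous_sin R)).
rewrite mulrNz; congr (_ + _).
  by congr (_ * _); apply: int_ext => t _; rewrite hm !mulNr cosN.
have sL : L1 0 tau (fun t => sin (b s * t) * Zs s (P t) i j).
  have hz := Z_entry_L1 i j 0 tau (lin s).2.
  apply: L1_ext (L1M hz (g := fun t => sin (b s * t)) (K := 1) _ _) => [t _||t _].
  - by rewrite mulrC.
  - apply: measurable_funTS; apply: continuous_measurable_fun.
    exact: sin_lin_continuous.
  - by rewrite ler_norml sin_geN1 sin_le1.
rewrite -mulrN; congr (_ * _); rewrite -mulN1r -intZ.
  by apply: int_ext => t _; rewrite hm !mulNr sinN !mulNr !mul1r opprK.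
by apply: L1_ext (L1Z (-1) sL) => t _; rewrite hm !mulNr sinN mulNr !mul1r.
Qed.

Lemma growing_expS sg : expS sg -> growing sg -> sg = (0, 0, 0%N).
Proof.
case: sg => [[x y] z] [s /and4P[gs /eqP /= -> /eqP -> _]].
have := nongrowingP gs => -[a0|[-> ->]].
  by case=> [|[a1]|[a1]]; [move/(lt_trans a0)|move: a0; rewrite a1|move: a0; rewrite a1]; rewrite ltxx.
by case=> [|[]|[_ _ ->]] //; rewrite ltxx.
Qed.

(** Without a resonant term the zero triple is absent from the index set, and the growth part is an
    empty sum; this reconciles it with [averaged_part]. *)
Lemma averaged_part_eq0 : ~ expS (0, 0, 0%N) -> averaged_part = 0.
Proof.
move=> h; rewrite -expC_averaged /expC big_pred0 // => s.
by apply/negbTE/negP => hs; apply: h; exists s.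
Qed.

Lemma growth_sum (J : {fset R * R * nat}) t : (0, 0, 0%N) \in J ->
  \sum_(sg <- J | sg \in expS `&` @growing R) exp_trig_term expC expD sg t =
    averaged_part.
Proof.
move=> hJ; rewrite big_mkcond (big_fsetD1 _ hJ) /= big1_seq ?addr0; last first.
  move=> sg /andP[_]; rewrite !inE => /andP[ne _].
  case: ifP => //; rewrite inE => -[e1 /(growing_expS e1) e].
  by rewrite e eqxx in ne.
case: ifPn => [_|].
  by rewrite /exp_trig_term !mul0r expR0 cos0 sin0 !mulr1 mulr0 scale0r addr0 scale1r expC_averaged.
move=> h; rewrite averaged_part_eq0 // => h'; move/negP: h; apply.
by rewrite inE; split=> //; apply: Or33.
Qed.

Lemma growth_component : is_growth_component Q (fun=> averaged_part).
Proof.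
exists expS, expC, expD; split.
  split.
  - exact: expS_countable.
  - exact: expS_finite_rates.
  - case=> [[x y] z] [s /and4P[_ _ /eqP -> _]]; by have [kb _ _] := NF.
  - exact: expansion_L2_sums_to.
split=> [i j|T T0]; first exact: measurable_cst.
apply: totally_cvge0 => [J|e e0].
  by apply: integral_ge0 => t _; rewrite lee_fin sqr_ge0.
exists [fset (0, 0, 0%N)]%fset => J; rewrite fsub1set => hJ.
rewrite (eq_integral (fun=> 0%E)) ?integral0 ?lee_fin ?ltW // => t _.
rewrite growth_sum // subrr enorm_sq big1 // => i _; rewrite big1 // => j _.
by rewrite mxE expr0n.
Qed.

Lemma Q_integrable T : mx_integrable 0 T Q.
Proof. by move=> i j; exact: M2_L1 (Q_entry_M2 A tau0 Pper PL2 0 T i j). Qed.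

Lemma integral_n1Q_le : exists Kq, forall t, 0 <= t ->
  \int[mu]_(s in `[0, t]) n1 (Q s) <= Kq * (1 + t).
Proof.
have [C [C0 hC]] := conj_flow_bound.
pose p t := (n * n)%:R * (C * n1 (P t)).
have pL x y : L1 x y p by do 2!apply: L1Z; exact: M2_L1 (n1P_M2 x y).
have pper t : p (t + tau) = p t by rewrite /p Pper.
have p0 t : 0 <= p t by rewrite !mulr_ge0 // n1_ge0.
set J := \int[mu]_(t in `[0, tau]) p t.
have J0 : 0 <= J by apply: int_ge0 => t _.
(* [[0, t]] lies in [N + 1] periods with [N <= t / tau]; the symmetric covering doubles this number,
   and [2 (N + 1) <= 4 (1 / tau + 1) (1 + t)]. *)
exists (4 * J * (tau^-1 + 1)) => t t0.
have QL := n1_L1 (Q_integrable t).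
apply: (@le_trans _ _ (\int[mu]_(s in `[0, t]) p s)).
  apply: int_le_ae => // [s|]; first exact: n1_ge0.
  by apply: aeS hC => s h /andP[s0 _]; apply: n1_le => i j; exact: h.
have [N [s1 [/andP[s10 s1t] et]]] := nat_block tau0 t0.
have Nt : N%:R <= t / tau by rewrite ler_pdivlMr // et lerDr.
have tN : t <= N.+1%:R * tau by rewrite et -natr1 mulrDl mul1r [leRHS]addrC lerD2r.
have N0 : - (N.+1%:R * tau) <= 0 by rewrite oppr_le0 mulr_ge0 // ltW.
apply: le_trans (periodic_int_le tau0 pper (pL 0 tau) p0 N0 tN) _.
have ti : 0 <= tau^-1 by rewrite invr_ge0 ltW.
have tti : 0 <= t / tau by rewrite mulr_ge0.
have h : (N.+1 + N.+1)%:R <= 4 * (tau^-1 + 1) * (1 + t).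
  by rewrite natrD -natr1; move: Nt ti tti t0; lra.
have -> : 4 * J * (tau^-1 + 1) * (1 + t) = J * (4 * (tau^-1 + 1) * (1 + t)).
  by move: (tau^-1) => y; rewrite /J; move: (Rintegral _ _ _) => x; ring.
by rewrite -/J mulrC ler_wpM2l.
Qed.

Lemma deviation_n1_bounded : exists K, forall t, 0 <= t ->
  n1 (mx_integral 0 t (fun s => Q s - averaged_part)) <= K.
Proof.
have [K hK] := average_deviation_bounded.
exists ((n * n)%:R * K) => t t0; apply: n1_le => i j.
rewrite mx_integralE; apply: le_trans (hK t t0 i j).
rewrite le_eqVlt; apply/orP; left; apply/eqP; congr `|_|.
by apply: int_ext => s _; rewrite [LHS]mxE [X in _ + X = _]mxE.
Qed.

End TameAverages.

(** The supremum satisfies [S <= S / 2 + r], hence [S <= 2 r]; the a priori bound [M0] makes it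
    finite, which is what legitimates the absorption. *)
Lemma halving_bound (R : realType) (D : set R) (f : R -> R) (M0 r : R) :
  (forall s, D s -> f s <= M0) ->
  (forall M, (forall s, D s -> f s <= M) -> forall s, D s -> f s <= M / 2 + r) ->
  forall s, D s -> f s <= 2 * r.
Proof.
move=> h0 hM s Ds.
have ub : has_ubound [set f u | u in D] by exists M0 => y [u /h0 + <-].
have le_sup u : D u -> f u <= sup [set f u | u in D].
  by move=> Du; apply: ub_le_sup => //; exists u.
have : sup [set f u | u in D] <= sup [set f u | u in D] / 2 + r.
  by apply: ge_sup; [exists (f s), s|move=> y [u Du <-]; exact: hM].
by have := le_sup s Ds; lra.
Qed.

(** * The averaging estimate *)

Section MatrixIntegrability.
Variable R : realType.
Notation mu := (@lebesgue_measure R).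

Lemma mx_integrable_mulr m p q (T : R) (u : R -> 'M[R]_(m, p)) (V : R -> 'M[R]_(p, q)) :
  mx_integrable 0 T u ->
  (forall i j, {within `[0, T], continuous (fun t => V t i j)}) ->
  mx_integrable 0 T (fun t => u t *m V t).
Proof.
move=> hu cV i j; have : L1 0 T (fun t => \sum_l u t i l * V t l j).
  apply: L1_sum => l _; have [K [_ hK]] := within_continuous_bounded (cV l j).
  exact: L1M (hu i l) (within_continuous_measurable (cV l j)) hK.
by apply: L1_ext => t _; rewrite mxE.
Qed.

Lemma mx_integrable_mull m p q (T : R) (u : R -> 'M[R]_(p, q)) (V : R -> 'M[R]_(m, p)) :
  mx_integrable 0 T u ->
  (forall i j, {within `[0, T], continuous (fun t => V t i j)}) ->
  mx_integrable 0 T (fun t => V t *m u t).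
Proof.
move=> hu cV i j; have : L1 0 T (fun t => \sum_l u t l j * V t i l).
  apply: L1_sum => l _; have [K [_ hK]] := within_continuous_bounded (cV i l).
  exact: L1M (hu l j) (within_continuous_measurable (cV i l)) hK.
by apply: L1_ext => t _; rewrite mxE; apply: eq_bigr => l _; rewrite mulrC.
Qed.

Lemma mx_integrableZ m p (T c : R) (u : R -> 'M[R]_(m, p)) :
  mx_integrable 0 T u -> mx_integrable 0 T (fun t => c *: u t).
Proof. by move=> hu i j; apply: L1_ext (L1Z c (hu i j)) => t _; rewrite mxE. Qed.

Lemma mulmx_entry_continuous m p q (C : 'M[R]_(m, p)) (V : R -> 'M[R]_(p, q)) i j :
  (forall i j, continuous (fun t => V t i j)) -> continuous (fun t => (C *m V t) i j).
Proof.
move=> cV; rewrite (_ : (fun _ => _) = fun t => \sum_l C i l * V t l j); last first.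
  by apply/funext => t; rewrite mxE.
apply: continuous_big => [|l _]; first exact: add_continuous.
by move=> t; apply: cvgM; [exact: cvg_cst|exact: cV].
Qed.

Variables (n : nat) (A : 'M[R]_n).

Lemma mxexp_primitive T :
  primitive T (fun t => mxexp (t *: A)) (fun t => A *m mxexp (t *: A)).
Proof.
apply: primitive_derive => [t|i j]; first exact: mxexp_derive.
by apply: mulmx_entry_continuous => ? ?; exact: mxexp_entry_continuous.
Qed.

Lemma mxexpN_primitive T :
  primitive T (fun t => mxexp (- t *: A)) (fun t => - (A *m mxexp (- t *: A))).
Proof.
apply: primitive_derive => [t|i j]; first exact: mxexpN_derive.
rewrite (_ : (fun _ => _) = fun t => ((- A) *m mxexp (- t *: A)) i j); last first.
  by apply/funext => t; rewrite mulNmx.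
by apply: mulmx_entry_continuous => ? ?; exact: mxexpN_entry_continuous.
Qed.

End MatrixIntegrability.

Section ErrorEstimate.
Variables (R : realType) (n : nat) (Q : R -> 'M[R]_n) (B : 'M[R]_n).
Notation mu := (@lebesgue_measure R).
Variables (K Kq : R).
Hypothesis QL1 : forall T, mx_integrable 0 T Q.
Hypothesis devK : forall t, 0 <= t -> n1 (mx_integral 0 t (fun s => Q s - B)) <= K.
Hypothesis QKq : forall t, 0 <= t -> \int[mu]_(s in `[0, t]) n1 (Q s) <= Kq * (1 + t).

Lemma error_bound (T eps t o ga : R) (E Om g : R -> 'cV[R]_n) : 0 < eps ->
  primitive T E (fun s => eps *: (Q s *m E s) + eps *: ((Q s - B) *m Om s)) ->
  primitive T Om (fun s => eps *: (B *m Om s) + eps *: (Q s *m g s)) ->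
  E 0 = 0 -> 0 <= t <= T -> eps * Kq * (1 + t) <= 1 / 2 -> eps * t <= 1 ->
  (forall s, 0 <= s <= t -> n1 (Om s) <= o) ->
  (forall s, 0 <= s <= t -> n1 (g s) <= ga) ->
  n1 (E t) <= 2 * (eps * K * ((1 + n1 B) * o + ga)).
Proof.
move=> e0 hE hOm E0 /andP[t0 tT] small1 small2 ho hga.
have T0 : 0 <= T := le_trans t0 tT.
have K0 : 0 <= K := le_trans (n1_ge0 _) (devK t0).
have o0 : 0 <= o by apply: le_trans (n1_ge0 _) (ho 0 _); rewrite lexx.
have ga0 : 0 <= ga by apply: le_trans (n1_ge0 _) (hga 0 _); rewrite lexx.
have b0 := n1_ge0 B.
pose U s := mx_integral 0 s (fun s => Q s - B).
have hU : primitive T U (fun s => Q s - B).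
  split; last by move=> s _; rewrite /U mx_integral0 add0r.
  move=> i j; apply: L1_ext (L1B (QL1 T i j) (L1_cst 0 T (B i j))) => s _.
  by rewrite [RHS]mxE [X in _ = _ + X]mxE.
(* Subtracting [eps U Om] from [E] cancels the term [eps (Q - B) Om]; the derivative of [Om] brings
   a second factor [eps]. *)
pose w s := eps *: (Q s *m E s) -
  eps *: (U s *m (eps *: (B *m Om s) + eps *: (Q s *m g s))).
have hD : primitive T (fun s => E s - eps *: (U s *m Om s)) w.
  apply: primitive_ext T0 _ _ (primitiveB hE (primitiveZ eps (primitiveM hU hOm))) => // s _.
  by rewrite /w [X in _ - X]scalerDr opprD addrA addrK.
have EE s : 0 <= s <= T -> E s = eps *: (U s *m Om s) + mx_integral 0 s w.
  move=> hs; have := hD.2 s hs.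
  rewrite E0 [U 0]mx_integral0 mul0mx scaler0 subrr add0r => <-.
  by rewrite addrC subrK.
have [M0 hM0] := primitive_bounded T0 hE.
have qL s : L1 0 s (fun u => n1 (Q u)) := n1_L1 (QL1 s).
(* The remainder adds [eps K o] from the boundary term [eps U Om], [eps K (n1 B) o] from [B Om]
   since [eps s <= 1], and [eps K ga] from [Q g]. *)
have key : forall s, `[0, t]%classic s -> n1 (E s) <= 2 * (eps * K * ((1 + n1 B) * o + ga)).
  apply: (@halving_bound _ _ (fun s => n1 (E s)) M0) => [s|M hM s] /=.
    rewrite in_itv /= => /andP[s0 st]; apply: hM0; rewrite s0; exact: le_trans tT.
  rewrite in_itv /= => /andP[s0 st].
  have sT := le_trans st tT.
  have M0' : 0 <= M.
    by apply: le_trans (n1_ge0 (E 0)) (hM 0 _); rewrite /= in_itv /= lexx.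
  rewrite EE ?s0 //; apply: le_trans (n1D _ _) _.
  have h1 : n1 (eps *: (U s *m Om s)) <= eps * (K * o).
    rewrite n1Z gtr0_norm // ler_pM2l //; apply: le_trans (n1_mulmx _ _) _.
    by apply: ler_pM; rewrite ?n1_ge0 //; [exact: devK|apply: ho; rewrite s0].
  have wi : mx_integrable 0 s w by move=> i j; exact: L1_sub (lexx _) sT (hD.1 i j).
  (* [n1 (w u)] is at most [c1 * n1 (Q u) + c2]: [c1] collects the unknown [E] and the forcing
     [Q g], [c2] the term [B Om]. *)
  pose c1 := eps * M + eps * (K * (eps * ga)); pose c2 := eps * (K * (eps * (n1 B * o))).
  have c10 : 0 <= c1 by rewrite addr_ge0 // !mulr_ge0 // ltW.
  have c20 : 0 <= c2 by rewrite !mulr_ge0 // ltW.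
  have h2 : n1 (mx_integral 0 s w) <= c1 * (Kq * (1 + s)) + c2 * s.
    apply: le_trans (n1_integral wi) _.
    apply: (@le_trans _ _ (\int[mu]_(u in `[0, s]) (c1 * n1 (Q u) + c2))).
      apply: int_le; [exact: n1_L1|exact: L1D (L1Z _ (qL s)) (L1_cst _ _ _)|].
      move=> u /andP[u0 us]; have ut := le_trans us st.
      have q0 := n1_ge0 (Q u).
      rewrite /w -scalerBr n1Z gtr0_norm //.
      have -> : c1 * n1 (Q u) + c2 =
          eps * (n1 (Q u) * M + K * (eps * (n1 B * o) + eps * (n1 (Q u) * ga))).
        by rewrite /c1 /c2; ring.
      rewrite ler_pM2l //; apply: le_trans (n1D _ _) _; apply: lerD.
        apply: le_trans (n1_mulmx _ _) _; apply: ler_wpM2l => //.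
        by apply: hM; rewrite /= in_itv /= u0.
      rewrite -scaleN1r n1Z normrN1 mul1r; apply: le_trans (n1_mulmx _ _) _.
      apply: ler_pM; rewrite ?n1_ge0 //; first exact: devK.
      apply: le_trans (n1D _ _) _; rewrite !n1Z gtr0_norm //.
      apply: lerD; rewrite ler_pM2l //; apply: le_trans (n1_mulmx _ _) _.
        by apply: ler_wpM2l => //; apply: ho; rewrite u0.
      by apply: ler_wpM2l => //; apply: hga; rewrite u0.
    rewrite intD; [|exact: L1Z (qL s)|exact: L1_cst].
    rewrite intZ // int_cst // subr0 lerD2r; apply: ler_wpM2l => //; exact: QKq.
  have Kq0 : 0 <= Kq.
    have := QKq (lexx 0); rewrite int0 addr0 mulr1; exact.
  have e1 : eps * (Kq * (1 + s)) <= 1 / 2.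
    apply: le_trans small1; rewrite mulrA; apply: ler_wpM2l; first by rewrite mulr_ge0 // ltW.
    by rewrite lerD2l.
  have e2 : eps * s <= 1 by apply: le_trans small2; rewrite ler_pM2l.
  have f1 : M * (eps * (Kq * (1 + s))) <= M * (1 / 2) by exact: ler_wpM2l.
  have f2 : eps * K * ga * (eps * (Kq * (1 + s))) <= eps * K * ga * (1 / 2).
    by apply: ler_wpM2l => //; rewrite !mulr_ge0 // ltW.
  have f3 : eps * K * (n1 B * o) * (eps * s) <= eps * K * (n1 B * o) * 1.
    by apply: ler_wpM2l => //; rewrite !mulr_ge0 // ltW.
  have f4 : 0 <= eps * K * ga by rewrite !mulr_ge0 // ltW.
  move: h1 h2 f1 f2 f3 f4; rewrite /c1 /c2; set x := n1 (_ *: _); set y := n1 (mx_integral _ _ _).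
  move: (Kq * (1 + s)) => z; set b := n1 B; lra.
by apply: key; rewrite /= in_itv /= t0 lexx.
Qed.

End ErrorEstimate.

Section Averaging.
Variables (R : realType) (n : nat) (A : 'M[R]_n) (P : R -> 'M[R]_n) (B : 'M[R]_n).
Notation mu := (@lebesgue_measure R).
Local Notation Q := (conj_flow A P).
Local Notation N t := (mxexp (- t *: A)).

Lemma solves_conj (T eps : R) (f x : R -> 'cV[R]_n) : 0 <= T ->
  solves T (fun t v => A *m v + eps *: (P t *m v) + f t) x ->
  primitive T (fun t => N t *m x t)
    (fun t => eps *: (Q t *m (N t *m x t)) + N t *m f t).
Proof.
move=> T0 hx.
apply: primitive_ext T0 _ _ (primitiveM (mxexpN_primitive A T) hx) => // t _.
rewrite mulNmx mxexp_comm !mulmxDr -scalemxAr !addrA.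
have -> : N t *m (A *m x t) = N t *m A *m x t by rewrite mulmxA.
rewrite addNr add0r; congr (_ *: _ + _).
rewrite /conj_flow -!mulmxA; congr (_ *m (_ *m _)).
by rewrite mulmxA mxexpKN mul1mx.
Qed.

(** Existence of [Omega] has to be proved; Duhamel's formula with generator [eps *: B] provides
    it. *)
Lemma variation_of_constants (T eps : R) (x0 : 'cV[R]_n) (F : R -> 'cV[R]_n) :
  0 <= T -> mx_integrable 0 T F ->
  exists Om : R -> 'cV[R]_n, Om 0 = x0 /\
    primitive T Om (fun t => eps *: (B *m Om t) + eps *: F t).
Proof.
move=> T0 hF; pose G := eps *: B.
have hG : mx_integrable 0 T (fun s => eps *: (mxexp (- s *: G) *m F s)).
  apply/mx_integrableZ/mx_integrable_mull => // i j.
  exact/continuous_subspaceT/mxexpN_entry_continuous.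
exists (fun t => mxexp (t *: G) *m
  (x0 + mx_integral 0 t (fun s => eps *: (mxexp (- s *: G) *m F s)))).
split; first by rewrite scale0r mx_integral0 addr0 -(scale0r G) mxexp0 mul1mx.
apply: primitive_ext T0 _ _
  (primitiveM (mxexp_primitive G T) (primitive_integral x0 hG)) => // t _.
congr (_ + _); first by rewrite /G -!scalemxAl mulmxA.
by rewrite -scalemxAr mulmxA mxexpKN mul1mx.
Qed.

Variables (K Kq : R).
Hypothesis QL1 : forall T, mx_integrable 0 T Q.
Hypothesis devK : forall t, 0 <= t -> n1 (mx_integral 0 t (fun s => Q s - B)) <= K.
Hypothesis QKq : forall t, 0 <= t -> \int[mu]_(s in `[0, t]) n1 (Q s) <= Kq * (1 + t).

Lemma averaging_estimate (f : R -> 'cV[R]_n) (Chat : R) : 0 < Chat ->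
  (\forall eps \near 0^'+, mx_integrable 0 (Chat / eps) (fun t => N t *m f t)) ->
  let g := fun t => mx_integral 0 t (fun tau => N tau *m f tau) in
  let F := fun t => Q t *m g t in
  exists c C : R, [/\ 0 < c, c <= Chat, 0 < C &
    \forall eps \near 0^'+, forall x : R -> 'cV[R]_n,
      solves (Chat / eps) (fun t v => A *m v + eps *: (P t *m v) + f t) x ->
      exists Omega E : R -> 'cV[R]_n,
        [/\ Omega 0 = x 0,
            solves (Chat / eps) (fun t v => eps *: (B *m v) + eps *: F t) Omega,
            forall t, 0 <= t <= Chat / eps ->
              x t = mxexp (t *: A) *m (Omega t + g t + E t) &
            forall t, 0 <= t <= c / eps ->
              enorm (E t) <= C * eps * expR (eps ^+ 2 * C * t) *
                (sup_norm t Omega + sup_norm t g)]].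
Proof.
move=> Chat0 hf g F.
have Kq0 : 0 <= Kq.
  apply: le_trans (_ : \int[mu]_(s in `[0, 0]) n1 (Q s) <= _).
    by apply: int_ge0 => s _; exact: n1_ge0.
  by have := QKq (lexx 0); rewrite addr0 mulr1.
have K0 : 0 <= K := le_trans (n1_ge0 _) (devK (lexx 0)).
(* [Chat] keeps [t] in the domain, [1] gives [eps t <= 1], and the last entry gives [Kq c <= 1 / 4],
   so that [eps Kq (1 + t) <= 1 / 2] when also [eps < c]. *)
pose c := Num.min (Num.min Chat 1) (1 / (4 * (Kq + 1))).
have c0 : 0 < c by rewrite !lt_min Chat0 ltr01 divr_gt0 // mulr_gt0 // ltr_wpDl.
have cChat : c <= Chat by rewrite !ge_min lexx.
have c1 : c <= 1 by rewrite !ge_min lexx orbT.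
have cK : Kq * c <= 1 / 4.
  have : c <= 1 / (4 * (Kq + 1)) by rewrite ge_min lexx orbT.
  have k1 : 0 < Kq + 1 by rewrite ltr_wpDl.
  by rewrite ler_pdivlMr ?mulr_gt0 //; have := ltW c0; lra.
(* The constant of [error_bound], with a factor [n] for passing from [n1] to [enorm] on column
   vectors; the [1] ensures positivity. *)
pose C := 2 * (K * ((1 + n1 B) * n%:R + n%:R)) + 1.
have C0 : 0 < C.
  by rewrite ltr_wpDl // !mulr_ge0 // addr_ge0 // mulr_ge0 // addr_ge0 // n1_ge0.
exists c, C; split => //.
have epos : \forall eps \near 0^'+, 0 < eps :> R by exact: nbhs_right_gt.
have ec : \forall eps \near 0^'+, eps < c :> R by exact: nbhs_right_lt.
apply: filterS3 hf epos ec => eps phi e0 ec x hx.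
have T0 : 0 <= Chat / eps by rewrite divr_ge0 // ltW.
have hg : primitive (Chat / eps) g (fun t => N t *m f t).
  by split=> // t _; rewrite /g mx_integral0 add0r.
have hF : mx_integrable 0 (Chat / eps) F.
  by apply: mx_integrable_mulr => // i j; exact: (@primitive_continuous _ _ _ _ _ _ i j T0 hg).
have [Om [Om0 hOm]] := variation_of_constants eps (x 0) T0 hF.
have hy := solves_conj T0 hx.
pose y t := N t *m x t.
pose E t := y t - Om t - g t.
have E0 : E 0 = 0.
  by rewrite /E /y Om0 /g mx_integral0 subr0 oppr0 mxexp0 mul1mx subrr.
have hE : primitive (Chat / eps) E
    (fun s => eps *: (Q s *m E s) + eps *: ((Q s - B) *m Om s)).
  apply: primitive_ext T0 _ _ (primitiveB (primitiveB hy hOm) hg) => // s _.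
  rewrite /E /F -/(y s) !mulmxBr mulmxBl !scalerBr.
  move: (eps *: (Q s *m y s)) (N s *m f s) (eps *: (B *m Om s))
    (eps *: (Q s *m g s)) (eps *: (Q s *m Om s)) => v1 v2 v3 v4 v5.
  by apply/matrixP => i j; rewrite !mxE; ring.
exists Om, E; split => //.
  move=> t _; have -> : Om t + g t + E t = y t.
    rewrite /E; move: (y t) (Om t) (g t) => v1 v2 v3.
    by apply/matrixP => i j; rewrite !mxE; ring.
  by rewrite /y mulmxA mxexpKN mul1mx.
move=> t /andP[t0 tc].
have etc : eps * t <= c by rewrite mulrC -ler_pdivlMr.
have tT : 0 <= t <= Chat / eps.
  by rewrite t0 (le_trans tc) // ler_pM2r ?invr_gt0.
have [MO hMO] := primitive_bounded T0 hOm; have [Mg hMg] := primitive_bounded T0 hg.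
have sub s : 0 <= s <= t -> 0 <= s <= Chat / eps.
  by move=> /andP[s0 st]; rewrite s0 (le_trans st) //; case/andP: tT.
have bO s : 0 <= s <= t -> n1 (Om s) <= n%:R * sup_norm t Om.
  move=> hs; apply: le_trans (n1_le_enorm _) _; rewrite muln1 ler_wpM2l //.
  by apply: (sup_norm_ge (K := MO)) => // s' /sub; exact: hMO.
have bg s : 0 <= s <= t -> n1 (g s) <= n%:R * sup_norm t g.
  move=> hs; apply: le_trans (n1_le_enorm _) _; rewrite muln1 ler_wpM2l //.
  by apply: (sup_norm_ge (K := Mg)) => // s' /sub; exact: hMg.
have s1 : eps * Kq * (1 + t) <= 1 / 2.
  have h1 : Kq * eps <= Kq * c by rewrite ler_wpM2l // ltW.
  have h2 : Kq * (eps * t) <= Kq * c by rewrite ler_wpM2l.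
  by move: h1 h2; rewrite mulrA; lra.
have h := error_bound QL1 devK QKq e0 hE hOm E0 tT s1 (le_trans etc c1) bO bg.
apply: le_trans (enorm_le_n1 _) _; apply: le_trans h _.
have so : 0 <= sup_norm t Om.
  apply: le_trans (_ : enorm (Om 0) <= _); first exact: sqrtr_ge0.
  by apply: (sup_norm_ge (K := MO)) => [s' /sub|]; [exact: hMO|rewrite lexx].
have sg : 0 <= sup_norm t g.
  apply: le_trans (_ : enorm (g 0) <= _); first exact: sqrtr_ge0.
  by apply: (sup_norm_ge (K := Mg)) => [s' /sub|]; [exact: hMg|rewrite lexx].
(* The estimate obtained has no exponential factor; the stated one follows as that factor is at
   least [1]. *)
have ex1 : 1 <= expR (eps ^+ 2 * C * t).
  by rewrite -expR0 ler_expR !mulr_ge0 // ?sqr_ge0 // ltW.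
apply: (@le_trans _ _ (C * eps * (sup_norm t Om + sup_norm t g))); last first.
  apply: ler_wpM2r; first exact: addr_ge0.
  by rewrite ler_peMr // mulr_ge0 // ltW.
rewrite /C; move: (sup_norm t Om) (sup_norm t g) so sg => o ga so sg.
have b0 := n1_ge0 B; have n0 : 0 <= n%:R :> R by [].
have p1 := mulr_ge0 (mulr_ge0 (ltW e0) K0) (mulr_ge0 n0 so).
have p2 := mulr_ge0 (mulr_ge0 (ltW e0) K0) (mulr_ge0 (mulr_ge0 (addr_ge0 ler01 b0) n0) sg).
have p3 := mulr_ge0 (ltW e0) so; have p4 := mulr_ge0 (ltW e0) sg.
by move: p1 p2 p3 p4; move: (n1 B) (n%:R) => b m; lra.
Qed.

End Averaging.

(** * Equivalence of boundedness and convergence of averages; assembly *)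

Section Equivalences.
Variables (R : realType) (n : nat) (A : 'M[R]_n) (P : R -> 'M[R]_n) (tau : R).
Notation mu := (@lebesgue_measure R).
Hypothesis tau0 : 0 < tau.
Hypothesis Pper : forall t, P (t + tau) = P t.
Hypothesis PL2 : mx_square_integrable 0 tau P.
Local Notation Q := (conj_flow A P).

Lemma ess_L2_unif_bounded : ess_bounded Q -> L2_unif_bounded tau Q.
Proof.
move=> [K hK]; exists (K ^+ 2 * tau) => s s0.
have EL := enormQ_L1 A tau0 Pper PL2 s (s + tau).
rewrite ge0_L1_integralE // lee_fin.
have -> : K ^+ 2 * tau = \int[mu]_(t in `[s, s + tau]) K ^+ 2.
  by rewrite int_cst ?lerDl ?ltW // addrC addKr.
apply: int_le_ae => // [|t|t|]; [exact: L1_cst|exact: sqr_ge0|exact: sqr_ge0|].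
apply: aeS hK => t h /andP[st _]; have eK := h (le_trans s0 st).
have e0 : 0 <= enorm (Q t) by exact: sqrtr_ge0.
by rewrite lerXn2r ?nnegrE // (le_trans e0).
Qed.

End Equivalences.

Theorem theorem1 (R : realType) (n : nat) (A : 'M[R]_n) (P : R -> 'M[R]_n)
    (omega : R) (omega_gt0 : 0 < omega)
    (P_periodic : forall t, P (t + 2 * pi / omega) = P t)
    (P_L2 : mx_square_integrable 0 (2 * pi / omega) P) :
  let Q := conj_flow A P in
  [/\ (exists B, is_time_average Q B) <->
        L2_unif_bounded (2 * pi / omega) Q,
      ess_bounded P ->
        ((exists B, is_time_average Q B) <-> ess_bounded Q) &
      L2_unif_bounded (2 * pi / omega) Q ->
      exists B : 'M[R]_n,
        [/\ forall (f : R -> 'cV[R]_n) (Chat : R), 0 < Chat ->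
              (\forall eps \near 0^'+,
                 mx_integrable 0 (Chat / eps)
                   (fun t => mxexp (- t *: A) *m f t)) ->
              let g := fun t => mx_integral 0 t
                         (fun tau => mxexp (- tau *: A) *m f tau) in
              let F := fun t => Q t *m g t in
              exists c C : R, [/\ 0 < c, c <= Chat, 0 < C &
                \forall eps \near 0^'+, forall x : R -> 'cV[R]_n,
                  solves (Chat / eps)
                    (fun t v => A *m v + eps *: (P t *m v) + f t) x ->
                  exists Omega E : R -> 'cV[R]_n,
                    [/\ Omega 0 = x 0,
                        solves (Chat / eps)
                          (fun t v => eps *: (B *m v) + eps *: F t) Omega,
                        forall t, 0 <= t <= Chat / eps ->
                          x t = mxexp (t *: A) *m (Omega t + g t + E t) &
                        forall t, 0 <= t <= c / eps ->
                          enorm (E t) <=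
                            C * eps * expR (eps ^+ 2 * C * t) *
                            (sup_norm t Omega + sup_norm t g)]],
            is_growth_component Q (fun=> B) &
            is_time_average Q B]].
Proof.
move=> Q; set tau := 2 * pi / omega in P_periodic P_L2 *.
have tau0 : 0 < tau by rewrite divr_gt0 // mulr_gt0 // pi_gt0.
have omtau : omega * tau = pi *+ 2.
  by rewrite /tau mulrCA divff ?gt_eqF // mulr1 mulr_natl.
have [I [a [b [k [Zc [Zs [NF slowNF]]]]]]] := conj_flow_normal_form A tau0.
(* The hub of all equivalences: convergent averages and L^2 boundedness each imply it through slow
   primitives, and it implies both in turn. *)
pose good := {ae @lebesgue_measure R, forall t, tame a k Zc Zs (P t)}.
have slow_good : (forall T, 0 <= T <= tau -> power_slow A tau (prim_Q A P T)) -> good.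
  move=> h; apply: (tame_ae tau0 P_periodic P_L2 NF slowNF) => T hT.
  exact: (slow_tame slowNF (h T hT)).
have L2_good : L2_unif_bounded tau Q -> good.
  by move=> h; apply: slow_good => T; exact: prim_Q_slow_of_L2.
have avg_good : (exists B, is_time_average Q B) -> good.
  by move=> [B hB]; apply: slow_good => T; exact: prim_Q_slow_of_average hB.
have good_avg : good -> exists B, is_time_average Q B.
  by move=> tP; exists (averaged_part P omega tau a b k Zc Zs); exact: tame_time_average.
split.
- split=> [/avg_good tP|/L2_good/good_avg //].
  exact: (tame_L2_unif_bounded tau0 P_periodic P_L2 NF tP).
(* Domination of [Q] by [P] transfers the essential bound from [P]; conversely an essential bound on
   [Q] is a uniform L^2 bound on windows. *)
- move=> bP; split=> [/avg_good tP|bQ]; first exact: (ess_bounded_conj_flow NF tP bP).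
  by apply/good_avg/L2_good; exact: ess_L2_unif_bounded.
move=> /L2_good tP; exists (averaged_part P omega tau a b k Zc Zs); split.
- have [K hK] := deviation_n1_bounded tau0 omtau P_periodic P_L2 NF tP.
  have [Kq hKq] := integral_n1Q_le tau0 P_periodic P_L2 NF tP.
  exact: averaging_estimate (Q_integrable A tau0 P_periodic P_L2) hK hKq.
- exact: growth_component.
exact: tame_time_average.
Qed.
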